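(* There exists a non-empty open set $V$ in $(\mathrm{Poly}_{\deg\geq2})^3$ such that for any $(h_1,h_2,h_3)\in V$, the semigroup $G=\langle h_1,h_2,h_3\rangle$ satisfies $G\in\mathcal{G}_{dis}$, $\bigcup_{j=1}^{2}J(h_j)\subset J_{\min}(G)$, $J_{\max}(G)=J(h_3)$, $h_j^{-1}(J(h_3))\cap J_{\min}(G)\neq\emptyset$ for each $j=1,2$, and $\sharp(\hat{\mathcal{J}}_G)=\aleph_0$.
   Context: $\hat{\mathbb{C}}$ is the Riemann sphere. $\mathrm{Poly}_{\deg\geq2}$ is the set of polynomial maps $\hat{\mathbb{C}}\to\hat{\mathbb{C}}$ of degree at least two with the topology of uniform convergence on $\hat{\mathbb{C}}$ with respect to the spherical distance. A polynomial semigroup is a semigroup, under composition, generated by a non-empty family of non-constant polynomial maps; $\langle h_1,h_2,h_3\rangle$ is the semigroup generated by $h_1,h_2,h_3$. The Fatou set $F(G)$ is the set of $z\in\hat{\mathbb{C}}$ having a neighborhood on which $G$ is a normal family; the Julia set is $J(G)=\hat{\mathbb{C}}\setminus F(G)$; for a single map $g$, $J(g)=J(\langle g\rangle)$. $CV(g)$ is the set of critical values of $g:\hat{\mathbb{C}}\to\hat{\mathbb{C}}$, $P(G)=\overline{\bigcup_{g\in G}CV(g)}$ (closure in $\hat{\mathbb{C}}$), and $P^{\ast}(G)=P(G)\setminus\{\infty\}$. $\mathcal{G}$ is the set of all polynomial semigroups $G$ such that each element of $G$ has degree at least two and $P^{\ast}(G)$ is bounded in $\mathbb{C}$; $\mathcal{G}_{dis}$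 is the set of $G\in\mathcal{G}$ with $J(G)$ disconnected. $\hat{\mathcal{J}}_G$ is the set of all connected components of $J(G)$; for $G\in\mathcal{G}_{dis}$ all of them are contained in $\mathbb{C}$. Surrounding order: for connected sets $K_1,K_2\subset\mathbb{C}$, $K_1\leq K_2$ means that $K_1=K_2$ or $K_1$ is included in a bounded component of $\mathbb{C}\setminus K_2$. For $G\in\mathcal{G}_{dis}$, $J_{\min}(G)$ and $J_{\max}(G)$ denote the (existing, unique) elements of $\hat{\mathcal{J}}_G$ with $J_{\min}(G)\leq J\leq J_{\max}(G)$ for all $J\in\hat{\mathcal{J}}_G$. *)

(* Defs.v *)
From HB Require Import structures.
From mathcomp Require Import all_boot all_order all_algebra.
From mathcomp Require Import complex ring lra.
From mathcomp Require Import all_classical all_reals all_analysis.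

Set Implicit Arguments.
Unset Strict Implicit.
Unset Printing Implicit Defensive.

Import Order.TTheory GRing.Theory Num.Theory ComplexField.
Import numFieldNormedType.Exports.

Local Open Scope classical_set_scope.
Local Open Scope ring_scope.

(* Naming R[i] as a numClosedFieldType equips it with the topology of its
   modulus and with complex differentiability. *)
Definition Cplx (R : realType) : numClosedFieldType := R[i].

(* None is the point at infinity. *)
Definition sphere (R : realType) : Type := option (Cplx R).

HB.instance Definition _ (R : realType) :=
  Choice.copy (sphere R) (option (Cplx R)).

Definition modulus (R : realType) (a : Cplx R) : R := Normc.normc a.

Definition chordal (R : realType) (x y : sphere R) : R :=
  match x, y with
  | Some a, Some b => 2 * modulus (a - b) /
      (Num.sqrt (1 + modulus a ^+ 2) * Num.sqrt (1 + modulus b ^+ 2))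
  | Some a, None | None, Some a => 2 / Num.sqrt (1 + modulus a ^+ 2)
  | None, None => 0
  end.

Section chordal_metric.
Variable R : realType.
Implicit Types (x y z : sphere R) (a b : R[i]).

(* Homogeneous coordinates [h0 : h1]. *)
Let h0 x : R[i] := if x is Some a then a else 1.
Let h1 x : R[i] := if x is Some _ then 1 else 0.
Let hn x : R := Num.sqrt (Normc.normc (h0 x) ^+ 2 + Normc.normc (h1 x) ^+ 2).
Let hdet x y : R[i] := h0 x * h1 y - h0 y * h1 x.
Let hdot x y : R[i] := h0 x * (h0 y)^*%C + h1 x * (h1 y)^*%C.

Let normcX2 a : Normc.normc a ^+ 2 = complex.Re a ^+ 2 + complex.Im a ^+ 2.
Proof. by case: a => u v; rewrite /= sqr_sqrtr// addr_ge0 ?sqr_ge0. Qed.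

Let normc_ge0 a : 0 <= Normc.normc a.
Proof. by case: a => u v; exact: sqrtr_ge0. Qed.

Let nc0 : Normc.normc (0 : R[i]) = 0. Proof. exact: Normc.normc0. Qed.
Let nc1 : Normc.normc (1 : R[i]) = 1. Proof. exact: Normc.normc1. Qed.

Let hn_sqr x : hn x ^+ 2 = Normc.normc (h0 x) ^+ 2 + Normc.normc (h1 x) ^+ 2.
Proof. by rewrite sqr_sqrtr// addr_ge0 ?sqr_ge0. Qed.

Let hnS a : hn (Some a) = Num.sqrt (1 + modulus a ^+ 2).
Proof. by rewrite /hn nc1 expr1n addrC. Qed.

Let hnN : hn None = 1.
Proof. by rewrite /hn nc1 nc0 expr1n expr0n addr0 sqrtr1. Qed.

Let hn_gt0 x : 0 < hn x.
Proof.
case: x => [a|]; last by rewrite hnN.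
by rewrite hnS sqrtr_gt0 ltr_wpDr// sqr_ge0.
Qed.

Let chordalE x y : chordal x y = 2 * Normc.normc (hdet x y) / (hn x * hn y).
Proof.
case: x y => [a|] [b|]; rewrite /chordal -?hnS ?hnN ?mulr1 ?mul1r.
- by rewrite /hdet /= !mulr1.
- by rewrite /hdet /= mulr0 mulr1 sub0r normcN nc1 mulr1.
- by rewrite /hdet /= mulr0 mulr1 subr0 nc1 mulr1.
- by rewrite (_ : hdet None None = 0) ?nc0 ?mulr0 ?mul0r// /hdet subrr.
Qed.

Let cauchy_schwarz x y : Normc.normc (hdot x y) <= hn x * hn y.
Proof.
rewrite -(@ler_pXn2r _ 2)// ?nnegrE;
  [|exact: normc_ge0|by rewrite mulr_ge0 ?(ltW (hn_gt0 _))].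
rewrite exprMn !hn_sqr !normcX2 -subr_ge0 /hdot.
case: (h0 x) (h1 x) (h0 y) (h1 y) => [p q] [r s] [t u] [v w] /=.
suff -> : (p ^+ 2 + q ^+ 2 + (r ^+ 2 + s ^+ 2)) *
    (t ^+ 2 + u ^+ 2 + (v ^+ 2 + w ^+ 2)) -
   ((p * t - q * - u + (r * v - s * - w)) ^+ 2 +
    (p * - u + q * t + (r * - w + s * v)) ^+ 2) =
   ((p * v - q * w) - (t * r - u * s)) ^+ 2 +
    ((p * w + q * v) - (t * s + u * r)) ^+ 2.
  by rewrite addr_ge0 ?sqr_ge0.
ring.
Qed.

Let hdet_expand x y z : hdet x z * (hn y ^+ 2)%:C%C =
  hdot x y * hdet y z + hdet x y * hdot z y.
Proof.
rewrite hn_sqr !normcX2 /hdet /hdot.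
case: (h0 x) (h1 x) (h0 y) (h1 y) (h0 z) (h1 z)
  => [p q] [r s] [t u] [v w] [k l] [m n].
by apply/eqP; rewrite eq_complex /=; apply/andP; split; apply/eqP; ring.
Qed.

Let chordal_triangle y x z : chordal x z <= chordal x y + chordal y z.
Proof.
rewrite !chordalE.
have hx := hn_gt0 x; have hy := hn_gt0 y; have hz := hn_gt0 z.
have : Normc.normc (hdet x z) * hn y ^+ 2 <=
    hn x * hn y * Normc.normc (hdet y z) + Normc.normc (hdet x y) * (hn z * hn y).
  have -> : hn y ^+ 2 = Normc.normc (hn y ^+ 2)%:C%C.
    by rewrite /= expr0n /= addr0 sqrtr_sqr ger0_norm// sqr_ge0.
  rewrite -Normc.normcM hdet_expand; apply: le_trans (le_normcD _ _) _.
  by rewrite !Normc.normcM lerD// ?ler_wpM2r ?ler_wpM2l.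
set d1 := Normc.normc _; set d2 := Normc.normc _; set d3 := Normc.normc _.
move=> H; rewrite -subr_ge0.
have -> : 2 * d3 / (hn x * hn y) + 2 * d2 / (hn y * hn z) - 2 * d1 / (hn x * hn z)
    = 2 * (hn x * hn y * d2 + d3 * (hn z * hn y) - d1 * hn y ^+ 2) /
      (hn x * hn y ^+ 2 * hn z).
  by field; rewrite !gt_eqF.
by rewrite divr_ge0 ?mulr_ge0 ?subr_ge0 ?sqr_ge0 ?(ltW (hn_gt0 _)).
Qed.

Let chordal_xx x : chordal x x = 0.
Proof.
by rewrite chordalE (_ : hdet x x = 0) ?nc0 ?mulr0 ?mul0r// /hdet subrr.
Qed.

Let chordal_eq0 x y : chordal x y = 0 -> x = y.
Proof.
have hxy0 : hn x * hn y != 0 by rewrite gt_eqF// mulr_gt0.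
rewrite chordalE => /eqP.
rewrite mulf_eq0 invr_eq0 (negbTE hxy0) orbF mulf_eq0 pnatr_eq0 /=.
move=> /eqP /Normc.eq0_normc; rewrite /hdet {hxy0}.
case: x y => [a|] [b|] //=; rewrite ?(mulr0, mulr1, subr0, sub0r).
- by move=> /eqP; rewrite subr_eq0 => /eqP ->.
- by move=> /eqP; rewrite oppr_eq0 oner_eq0.
- by move=> /eqP; rewrite oner_eq0.
Qed.

Let chordal_sym x y : chordal x y = chordal y x.
Proof.
by rewrite !chordalE /hdet -normcN opprB [hn x * _]mulrC.
Qed.

HB.instance Definition _ := @isMetric.Build R (sphere R) (@chordal R)
  chordal_xx chordal_eq0 chordal_sym chordal_triangle.

End chordal_metric.

(* The extension of a polynomial to the sphere, for nonconstant p. *)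
Definition poly_map (R : realType) (p : {poly Cplx R}) (x : sphere R) :
    sphere R :=
  if x is Some a then Some p.[a] else None.

Definition poly_maps (R : realType) (d : nat) : set (sphere R -> sphere R) :=
  [set g | exists2 p : {poly Cplx R}, (d < size p)%N & g = poly_map p].
Arguments poly_maps : clear implicits.

Definition Poly_deg_ge2 (R : realType) : set {uniform sphere R -> sphere R} :=
  poly_maps R 2.
Arguments Poly_deg_ge2 : clear implicits.

Definition semigroup_gen (R : realType) (S : set (sphere R -> sphere R)) :
    set (sphere R -> sphere R) :=
  smallest [set M : set (sphere R -> sphere R) |
    forall f g, M f -> M g -> M (f \o g)] S.

Definition polynomial_semigroup (R : realType)
    (G : set (sphere R -> sphere R)) : Prop :=
  exists S, [/\ S !=set0, S `<=` poly_maps R 1 & G = semigroup_gen S].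

Definition normal_on (R : realType) (G : set (sphere R -> sphere R))
    (U : set (sphere R)) : Prop :=
  forall u : nat -> sphere R -> sphere R, (forall n, G (u n)) ->
  exists s : nat -> nat, {homo s : m n / (m < n)%N} /\
  exists f : sphere R -> sphere R,
  forall K, compact K -> K `<=` U -> {uniform K, (u \o s) @ \oo --> f}.

Definition Fatou (R : realType) (G : set (sphere R -> sphere R)) :
    set (sphere R) :=
  [set z | exists2 U, open_nbhs z U & normal_on G U].

Definition Julia (R : realType) (G : set (sphere R -> sphere R)) :
    set (sphere R) := ~` Fatou G.

Definition Julia_map (R : realType) (g : sphere R -> sphere R) :
    set (sphere R) := Julia (semigroup_gen [set g]).

(* Local coordinates near a: the identity if a is finite, w |-> 1/w if not. The
   value at points outside of the chart (0 in the chart at infinity, infinity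
   in a finite chart) is irrelevant. *)
Definition chart (R : realType) (a x : sphere R) : Cplx R :=
  match a, x with
  | Some _, Some w => w
  | None, Some w => w^-1
  | _, None => 0
  end.

Definition chart_inv (R : realType) (a : sphere R) (w : Cplx R) : sphere R :=
  if a is None then (if w == 0 then None else Some w^-1) else Some w.

Definition critical_points (R : realType) (g : sphere R -> sphere R) :
    set (sphere R) :=
  [set a | is_derive (chart a a) (1 : Cplx R)
             (chart (g a) \o g \o chart_inv a) (0 : Cplx R)].

Definition critical_values (R : realType) (g : sphere R -> sphere R) :
    set (sphere R) := g @` critical_points g.

Definition postcritical (R : realType) (G : set (sphere R -> sphere R)) :
    set (sphere R) := closure (\bigcup_(g in G) critical_values g).

Definition finite_part (R : realType) (A : set (sphere R)) : set (Cplx R) :=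
  [set z | A (Some z)].

Definition calG (R : realType) (G : set (sphere R -> sphere R)) : Prop :=
  [/\ polynomial_semigroup G, G `<=` poly_maps R 2
    & bounded_set (finite_part (postcritical G))].

Definition calG_dis (R : realType) (G : set (sphere R -> sphere R)) : Prop :=
  calG G /\ ~ connected (Julia G).

Definition Julia_components (R : realType) (G : set (sphere R -> sphere R)) :
    set (set (sphere R)) :=
  [set connected_component (Julia G) z | z in Julia G].

Definition surrounding_le (R : realType) (K1 K2 : set (Cplx R)) : Prop :=
  K1 = K2 \/ exists2 z, (~` K2) z &
    bounded_set (connected_component (~` K2) z) /\
    K1 `<=` connected_component (~` K2) z.

(* For G in calG_dis every component of the Julia set avoids infinity, so
   finite_part loses nothing. *)
Definition is_J_min (R : realType) (G : set (sphere R -> sphere R))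
    (K : set (sphere R)) : Prop :=
  Julia_components G K /\
  forall J, Julia_components G J ->
    surrounding_le (finite_part K) (finite_part J).

Definition is_J_max (R : realType) (G : set (sphere R -> sphere R))
    (K : set (sphere R)) : Prop :=
  Julia_components G K /\
  forall J, Julia_components G J ->
    surrounding_le (finite_part J) (finite_part K).

(* Main.v *)
Require Import Defs.
From mathcomp Require Import all_boot all_order all_algebra.
From mathcomp Require Import complex ring lra.
From mathcomp Require Import all_classical all_reals all_analysis.
Set Implicit Arguments.
Unset Strict Implicit.
Unset Printing Implicit Defensive.
Import Order.TTheory GRing.Theory Num.Theory ComplexField.
Import numFieldNormedType.Exports.
Local Open Scope classical_set_scope.
Local Open Scope ring_scope.

(** The model maps (z - 1/4)^16, (z + 1/4)^16 and z^16 / 3^15 contract the disc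
|z| < 1/2 into itself, push |z| > 4 to infinity and expand on the annulus
A = {1/2 <= |z| <= 4}, and all polynomials uniformly close to them on the sphere
do the same. Hence J(G) is the set of the points whose orbit along some infinite
word in the generators stays in A. For a finite word w, the set w^-1(A) is
connected: the preimage under a generator of a set exp(S), with S connected and
2 pi i-periodic, is again of this form. The circle |z| = 3/2 separates
h3^-1(J(G)) from B = h1^-1(J(G)) U h2^-1(J(G)). If w starts with h1 and v with
h2, then w^-1(A) separates the points of v^-1(A) on the positive half-axis from
those on the negative one, because the annuli h1^-1(A) and h2^-1(A) are centred
near 1/4 and -1/4 and are thin; so w^-1(A) meets v^-1(A). Therefore B and its
preimages h3^-n(B) are connected, as decreasing intersections of connected
compact sets, and they are, together with J(h3), the components of J(G). *)

(** * Plane topology through the real-valued modulus *)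

(** Preimages are handled by hand-made inverse branches. For a perturbed power q of degree d and u
    in S, exactly one root of q = exp u lies near the model root. It depends continuously on u and
    has a continuous logarithm Psi with Psi(u + 2 pi i d) = Psi(u) + 2 pi i, so that q^-1(exp S) =
    exp(Psi(S)). Roots are localised by factoring over the zeros and comparing products of
    distances. Closeness in the uniform chordal distance gives no a priori bound on the degree.
    Counting zeros, through the growth between two large radii, forces degree at most 16; Cauchy's
    estimate then makes the coefficients of the perturbation small. Expansion on A serves one
    purpose: the derivatives along a word that keeps z in A are unbounded, which excludes normality
    at z. The exponent 16 gives (3/4)^16 < 1/2, (5/4)^16 > 4 and room in the crossing inequalities.
    The factor 3^-15 makes the circle |z| = 3 invariant under the third model map, beyond 3/2 and
    inside A. *)

Lemma modulusE (R : realType) (z : Cplx R) : `|z| = (modulus z)%:C%C.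
Proof. by []. Qed.

Section modulus.
Variable R : realType.
Implicit Types x y z : Cplx R.

Lemma modulus_ge0 z : 0 <= modulus z.
Proof. by case: z => u v; exact: sqrtr_ge0. Qed.

Lemma modulus0 : modulus (0 : Cplx R) = 0. Proof. exact: Normc.normc0. Qed.
Lemma modulus1 : modulus (1 : Cplx R) = 1. Proof. exact: Normc.normc1. Qed.

Lemma modulusM x y : modulus (x * y) = modulus x * modulus y.
Proof. exact: Normc.normcM. Qed.

Lemma modulusX x n : modulus (x ^+ n) = modulus x ^+ n.
Proof.
by elim: n => [|n IH]; rewrite ?expr0 ?modulus1// !exprS modulusM IH.
Qed.

Lemma modulusN x : modulus (- x) = modulus x.
Proof. exact: normcN. Qed.

Lemma modulusD x y : modulus (x + y) <= modulus x + modulus y.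
Proof. exact: le_normcD. Qed.

Lemma modulusB x y : modulus (x - y) <= modulus x + modulus y.
Proof. by rewrite -(modulusN y) modulusD. Qed.

Lemma modulusC x y : modulus (x - y) = modulus (y - x).
Proof. by rewrite -modulusN opprB. Qed.

Lemma modulus_lowerB x y : modulus x - modulus y <= modulus (x - y).
Proof. by rewrite lerBlDr -{1}(subrK y x) modulusD. Qed.

Lemma modulus_lowerD x y : modulus x - modulus y <= modulus (x + y).
Proof. by rewrite -(modulusN y) -{2}(opprK y) modulus_lowerB. Qed.

Lemma modulus_tri z x y : modulus (x - y) <= modulus (x - z) + modulus (z - y).
Proof. by rewrite (_ : x - y = (x - z) + (z - y)) ?modulusD// subrKA. Qed.

Lemma modulus_eq0 x : (modulus x == 0) = (x == 0).
Proof.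
apply/eqP/eqP => [|->]; [exact: Normc.eq0_normc|exact: modulus0].
Qed.

Lemma modulus_gt0 x : (0 < modulus x) = (x != 0).
Proof. by rewrite lt0r modulus_ge0 andbT modulus_eq0. Qed.

Lemma modulusV x : modulus x^-1 = (modulus x)^-1.
Proof.
have [->|x0] := eqVneq x 0; first by rewrite !(invr0, modulus0).
apply: (mulfI (x := modulus x)); first by rewrite modulus_eq0.
by rewrite -modulusM !divff ?modulus_eq0// modulus1.
Qed.

Lemma modulus_real (t : R) : modulus t%:C%C = `|t|.
Proof. by rewrite /modulus /= expr0n addr0 sqrtr_sqr. Qed.

Lemma modulus_nat n : modulus (n%:R : Cplx R) = n%:R.
Proof.
by rewrite -(rmorph_nat (@real_complex R : {rmorphism R -> R[i]})) modulus_real ger0_norm.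
Qed.

Lemma modulus_sum I (r : seq I) (P : pred I) (F : I -> Cplx R) :
  modulus (\sum_(i <- r | P i) F i) <= \sum_(i <- r | P i) modulus (F i).
Proof.
elim/big_rec2: _ => [|i y1 y2 _ h]; first by rewrite modulus0.
by rewrite (le_trans (modulusD _ _))// lerD2l.
Qed.

Lemma modulus_prod I (r : seq I) (P : pred I) (F : I -> Cplx R) :
  modulus (\prod_(i <- r | P i) F i) = \prod_(i <- r | P i) modulus (F i).
Proof. by rewrite (big_morph _ modulusM modulus1). Qed.

Lemma Re_le_modulus z : `|complex.Re z| <= modulus z.
Proof.
case: z => u v; rewrite /modulus /= -sqrtr_sqr ler_sqrt ?lerDl ?sqr_ge0//.
by rewrite addr_ge0 ?sqr_ge0.
Qed.

Lemma Im_le_modulus z : `|complex.Im z| <= modulus z.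
Proof.
case: z => u v; rewrite /modulus /= -sqrtr_sqr ler_sqrt ?lerDr ?sqr_ge0//.
by rewrite addr_ge0 ?sqr_ge0.
Qed.

Lemma modulus_le_ReIm z : modulus z <= `|complex.Re z| + `|complex.Im z|.
Proof.
case: z => u v; rewrite /modulus /=.
rewrite -(@ler_pXn2r _ 2)// ?nnegrE ?sqrtr_ge0 ?addr_ge0//.
rewrite sqr_sqrtr ?addr_ge0 ?sqr_ge0// sqrrD !real_normK ?num_real//.
have : 0 <= `|u| * `|v| by rewrite mulr_ge0.
lra.
Qed.

(** Balls of [Cplx R] have radii in [R[i]]. A positive element of [R[i]] has zero imaginary part, so
    real radii suffice and the topology can be handled through [modulus]. *)
Lemma nbhs_modulusP z (S : set (Cplx R)) :
  nbhs z S <-> exists2 e : R, 0 < e & forall y, modulus (z - y) < e -> S y.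
Proof.
split=> [/nbhs_ballP[e /= e0 zS]|[e e0 zS]].
  have [[u v]] : {e' | e = e'} by exists e.
  move=> eE; move: e0; rewrite eE ltcE /= => /andP[/eqP v0 u0].
  exists u => // y yz; apply: zS; rewrite /ball /= eE modulusE v0 ltcE /= eqxx.
  exact: yz.
apply/nbhs_ballP; exists e%:C%C => /=; first by rewrite ltcR.
by move=> y; rewrite /ball/= modulusE ltcR; exact: zS.
Qed.

Lemma open_modulusP (S : set (Cplx R)) :
  open S <-> forall z, S z ->
    exists2 e : R, 0 < e & forall y, modulus (z - y) < e -> S y.
Proof.
rewrite openE; split=> h z /h; first by move=> /nbhs_modulusP.
by move=> ?; apply/nbhs_modulusP.
Qed.

Lemma continuous_modulus : continuous (@modulus R).
Proof.
move=> z; apply/(@cvgrPdist_lt _ _ _ (nbhs z)) => e e0; apply/nbhs_modulusP.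
exists e => // y; apply: le_lt_trans.
rewrite ler_norml modulus_lowerB andbT lerNl opprB modulusC.
exact: modulus_lowerB.
Qed.

Lemma continuous_Re : continuous (@complex.Re R : Cplx R -> R).
Proof.
move=> z; apply/(@cvgrPdist_lt _ _ _ (nbhs z)) => e e0; apply/nbhs_modulusP.
exists e => // y; apply: le_lt_trans.
have -> : complex.Re z - complex.Re y = complex.Re (z - y) by case: z y => ? ? [].
exact: Re_le_modulus.
Qed.

Lemma continuous_Im : continuous (@complex.Im R : Cplx R -> R).
Proof.
move=> z; apply/(@cvgrPdist_lt _ _ _ (nbhs z)) => e e0; apply/nbhs_modulusP.
exists e => // y; apply: le_lt_trans.
have -> : complex.Im z - complex.Im y = complex.Im (z - y) by case: z y => ? ? [].
exact: Im_le_modulus.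
Qed.

Lemma cvg_complex (T : Type) (F : set_system T) (FF : Filter F)
    (f g : T -> R) (u v : R) :
  f @ F --> u -> g @ F --> v ->
  ((fun t => Complex (f t) (g t) : Cplx R) @ F --> (Complex u v : Cplx R)).
Proof.
move=> fu gv S /nbhs_modulusP[e e0 eS].
have e20 : 0 < e / 2 by rewrite divr_gt0.
move/cvgrPdist_lt: fu => /(_ _ e20) fu; move/cvgrPdist_lt: gv => /(_ _ e20) gv.
rewrite /fmap /nbhs/=; apply: filterS2 fu gv => t h1 h2 /=; apply: eS.
apply: le_lt_trans (modulus_le_ReIm _) _ => /=; lra.
Qed.

Lemma cvg_modulusP (T : Type) (F : set_system T) (FF : Filter F)
    (f : T -> Cplx R) (l : Cplx R) :
  (f @ F --> l) <-> forall e : R, 0 < e -> \forall t \near F, modulus (l - f t) < e.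
Proof.
split=> [fl e e0|h S /nbhs_modulusP[e e0 eS]].
  by apply: (fl [set y | modulus (l - y) < e]); apply/nbhs_modulusP; exists e.
by rewrite /fmap /nbhs/=; apply: filterS (h _ e0) => t; exact: eS.
Qed.

Lemma continuous_hornerC (p : {poly Cplx R}) : continuous (horner p).
Proof.
elim/poly_ind: p => [|p c IH] z.
  rewrite (_ : horner 0 = cst 0); first exact: (@cst_continuous (Cplx R) (Cplx R) 0).
  by apply/funext => x; rewrite horner0.
rewrite (_ : horner _ = (fun x => p.[x] * x + c)); last first.
  by apply/funext => x; rewrite hornerMXaddC.
apply: (@cvgD _ _ _ (nbhs z)); last first.
  exact: (@cst_continuous (Cplx R) (Cplx R) c).
by apply: (@cvgM _ _ (nbhs z)); [exact: IH|exact: cvg_id].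
Qed.

End modulus.

(** * The sphere and compactness *)

Section open_discs.
Variable R : realType.

Lemma open_modulus_lt (M : R) : open [set z : Cplx R | modulus z < M].
Proof.
rewrite (_ : mkset _ = @modulus R @^-1` [set t : R | t < M])//.
by apply: open_comp; [move=> z _; exact: continuous_modulus|exact: open_lt].
Qed.

Lemma open_modulus_gt (M : R) : open [set z : Cplx R | M < modulus z].
Proof.
rewrite (_ : mkset _ = @modulus R @^-1` [set t : R | t > M])//.
by apply: open_comp; [move=> z _; exact: continuous_modulus|exact: open_gt].
Qed.

End open_discs.

Section sphere_topology.
Variable R : realType.
Implicit Types (x y : sphere R) (a b : Cplx R).

Lemma nbhs_sphereP x (S : set (sphere R)) :
  nbhs x S <-> exists2 e : R, 0 < e & forall y, chordal x y < e -> S y.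
Proof.
split=> [/nbhs_ballP[e e0 xS]|[e e0 xS]]; first by exists e.
by apply/nbhs_ballP; exists e.
Qed.

Lemma open_sphereP (S : set (sphere R)) :
  open S <-> forall x, S x ->
    exists2 e : R, 0 < e & forall y, chordal x y < e -> S y.
Proof.
rewrite openE; split=> h z /h; first by move=> /nbhs_sphereP.
by move=> ?; apply/nbhs_sphereP.
Qed.

Lemma chordal_xx x : chordal x x = 0.
Proof. exact: (mdistxx (x : sphere R)). Qed.

Lemma chordal_sym x y : chordal x y = chordal y x.
Proof. exact: (metric_sym (x : sphere R)). Qed.

Lemma chordal_triangle y x z : chordal x z <= chordal x y + chordal y z.
Proof. exact: (@metric_triangle _ (sphere R)). Qed.

Lemma sqrt1D_ge1 (t : R) : 1 <= Num.sqrt (1 + t ^+ 2).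
Proof. by rewrite -[leLHS]sqrtr1 ler_sqrt ?lerDl ?sqr_ge0// addr_ge0// sqr_ge0. Qed.

Lemma sqrt1D_gt0 (t : R) : 0 < Num.sqrt (1 + t ^+ 2).
Proof. exact: lt_le_trans ltr01 (sqrt1D_ge1 t). Qed.

Lemma sqrt1D_ge (t : R) : 0 <= t -> t <= Num.sqrt (1 + t ^+ 2).
Proof.
move=> t0; rewrite -{1}(ger0_norm t0) -sqrtr_sqr ler_sqrt ?lerDr// addr_ge0//.
exact: sqr_ge0.
Qed.

Lemma sqrt1D_le (t : R) : 0 <= t -> Num.sqrt (1 + t ^+ 2) <= 1 + t.
Proof.
move=> t0; have t1 : 0 <= 1 + t by lra.
rewrite -[leRHS](ger0_norm t1) -sqrtr_sqr ler_sqrt ?sqr_ge0//; nra.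
Qed.

Lemma chordal_le2 a b : chordal (Some a) (Some b) <= 2 * modulus (a - b).
Proof.
rewrite /chordal ler_pdivrMr ?mulr_gt0 ?sqrt1D_gt0//.
rewrite ler_peMr ?mulr_ge0 ?modulus_ge0//.
by rewrite mulr_ege1 ?sqrt1D_ge1.
Qed.

(** Turns chordal bounds into Euclidean ones near a bounded point. The condition [d * (1 + M) <= 1]
    excludes infinity, which is at chordal distance at least 2 / (1 + M) from [a], and permits the
    absorption below. *)
Lemma chordal_finite (M d : R) a x : modulus a <= M -> d * (1 + M) <= 1 ->
  chordal (Some a) x <= d ->
  exists2 b, x = Some b & modulus (a - b) <= d * (1 + M) ^+ 2.
Proof.
move=> aM dM.
have a0 := modulus_ge0 a; set A := Num.sqrt (1 + modulus a ^+ 2).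
have A1 : 1 <= A by exact: sqrt1D_ge1.
have AM : A <= 1 + M by apply: le_trans (sqrt1D_le a0) _; lra.
case: x => [b|]; rewrite /chordal -/A; last first.
  rewrite ler_pdivrMr; last lra.
  move=> h; exfalso.
  have d0 : 0 <= d.
    rewrite leNgt; apply/negP => d0; nra.
  have : d * A <= d * (1 + M) by rewrite ler_wpM2l.
  lra.
set B := Num.sqrt _ => h; exists b => //.
set t := modulus (a - b) in h *.
have t0 : 0 <= t by exact: modulus_ge0.
have B0 : 0 < B by exact: sqrt1D_gt0.
(* With this, 2t <= dAB gives 2t <= dA^2 + dAt <= dA^2 + t: the factor 2 of the chordal distance
   absorbs the last term. *)
have BA : B <= A + t.
  rewrite -(@ler_pXn2r _ 2)// ?nnegrE; [|exact: ltW|lra].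
  rewrite sqr_sqrtr; last by rewrite addr_ge0// sqr_ge0.
  have bt : modulus b <= modulus a + t.
    by rewrite /t modulusC -lerBlDl modulus_lowerB.
  have AE : A ^+ 2 = 1 + modulus a ^+ 2.
    by rewrite sqr_sqrtr// addr_ge0// sqr_ge0.
  have aA : modulus a <= A by exact: sqrt1D_ge.
  have b0 := modulus_ge0 b.
  have : modulus b ^+ 2 <= (modulus a + t) ^+ 2.
    by rewrite ler_pXn2r// nnegrE; lra.
  have : modulus a * t <= A * t by rewrite ler_wpM2r.
  rewrite !sqrrD AE; lra.
move: h; rewrite ler_pdivrMr; last by rewrite mulr_gt0//; lra.
move=> h.
have d0 : 0 <= d.
  have : 0 <= d * (A * B) by apply: le_trans h; rewrite mulr_ge0.
  by rewrite pmulr_lge0// mulr_gt0//; lra.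
have h2 : d * A * B <= d * A * (A + t) by rewrite ler_wpM2l// mulr_ge0//; lra.
have dA : d * A <= 1 by apply: le_trans dM; rewrite ler_wpM2l.
have h3 : d * A * t <= t by rewrite -[leRHS]mul1r ler_wpM2r.
have h4 : d * A ^+ 2 <= d * (1 + M) ^+ 2.
  by rewrite ler_wpM2l// ler_pXn2r// nnegrE; lra.
apply: le_trans h4; move: h h2 h3; rewrite expr2; lra.
Qed.

Lemma chordal_infty b (r : R) : 0 < r -> r <= modulus b ->
  chordal None (Some b) <= 2 / r.
Proof.
move=> r0 rb; rewrite /chordal ler_pM2l// lef_pV2 ?posrE ?sqrt1D_gt0//.
exact: le_trans rb (sqrt1D_ge (modulus_ge0 b)).
Qed.

Lemma chordal_infty_lt b (r : R) : 0 <= r ->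
  chordal None (Some b) < 2 / (1 + r) -> r < modulus b.
Proof.
move=> r0; rewrite /chordal ltr_pM2l// ltf_pV2 ?posrE ?sqrt1D_gt0//; last lra.
move=> h; have := lt_le_trans h (sqrt1D_le (modulus_ge0 b)); lra.
Qed.

Lemma continuous_Some : continuous (@Some (Cplx R) : Cplx R -> sphere R).
Proof.
move=> a S /nbhs_sphereP[e e0 eS]; apply/nbhs_modulusP.
exists (e / 2); first by rewrite divr_gt0.
move=> b ab; apply: eS; apply: le_lt_trans (chordal_le2 _ _) _; lra.
Qed.

Lemma open_Some (S : set (Cplx R)) : open S -> open ((@Some (Cplx R) @` S) : set (sphere R)).
Proof.
move=> /open_modulusP oS; apply/open_sphereP => _ [a /oS[e e0 eS] <-].
set M := modulus a; have M0 : 0 <= M by exact: modulus_ge0.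
have M1 : 0 < 1 + M by lra.
have M2 : 0 < (1 + M) ^+ 2 by rewrite exprn_gt0.
exists (Num.min (1 + M)^-1 (e / 2 / (1 + M) ^+ 2)).
  by rewrite lt_min invr_gt0 M1 !divr_gt0.
move=> y; rewrite lt_min => /andP[h1 h2].
pose d := Num.min (1 + M)^-1 (e / 2 / (1 + M) ^+ 2).
have [|||b -> ab] := @chordal_finite M d a y.
- exact: lexx.
- by rewrite -ler_pdivlMr// mul1r ge_min lexx.
- by rewrite ltW// lt_min h1.
exists b => //; apply: eS; apply: le_lt_trans ab _.
have : d <= e / 2 / (1 + M) ^+ 2 by rewrite ge_min lexx orbT.
rewrite ler_pdivlMr//; lra.
Qed.

Lemma open_outside (r : R) : 0 <= r ->
  open [set x : sphere R | forall a, x = Some a -> r < modulus a].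
Proof.
move=> r0; have r1 : 0 < 1 + r by lra.
apply/open_sphereP => -[a|] /= xr; last first.
  exists (2 / (1 + r)); first by rewrite divr_gt0.
  move=> [b|]//= h c [<-]; exact: chordal_infty_lt.
have /open_sphereP := open_Some (@open_modulus_gt R r).
move=> /(_ (Some a))[|e e0 eS]; first by exists a => //=; exact: xr.
exists e => // y /eS[b rb <-] c [<-]; exact: rb.
Qed.

Lemma open_preimage_Some (S : set (sphere R)) : open S -> open (finite_part S).
Proof.
move=> oS; apply: (@open_comp _ _ (@Some (Cplx R) : Cplx R -> sphere R)) oS.
by move=> z _; exact: continuous_Some.
Qed.

Lemma connected_Some (S : set (Cplx R)) : connected S ->
  connected ((@Some (Cplx R) @` S) : set (sphere R)).
Proof.
move=> cS; apply: connected_continuous_connected => //.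
exact/continuous_subspaceT/continuous_Some.
Qed.

Lemma uniform_chordalP (K : set (sphere R)) (g : nat -> sphere R -> sphere R)
    (f : sphere R -> sphere R) :
  {uniform K, g @ \oo --> f} <->
  forall e : R, 0 < e -> \forall n \near \oo,
    forall x, K x -> chordal (f x) (g n x) < e.
Proof.
split=> [h e e0|h P /uniform_nbhs[E [/=]]].
  apply: (h [set k | forall x, K x -> chordal (f x) (k x) < e]).
  apply/uniform_nbhs; exists [set xy | chordal xy.1 xy.2 < e]; split => //.
  exact: (@entourage_ball R (sphere R) (PosNum e0)).
rewrite -(@entourage_ballE _ (sphere R)) => -[e /= e0 eE EP].
rewrite /fmap /nbhs/=; apply: filterS (h _ e0) => n hn; apply: EP => x Kx.
exact/eE/hn.
Qed.

Lemma uniform_sphere_nbhs (f : {uniform sphere R -> sphere R}) (e : R) : 0 < e ->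
  nbhs f [set g : {uniform sphere R -> sphere R} | forall x, chordal (f x) (g x) < e].
Proof.
move=> e0; apply/uniform_nbhs; exists [set xy | chordal xy.1 xy.2 < e]; split.
  exact: (@entourage_ball R (sphere R) (PosNum e0)).
by move=> g h x /=; exact: h.
Qed.

End sphere_topology.

Section plane_topology.
Variable R : realType.

Lemma compact_rectangle (M : R) :
  compact [set z : Cplx R | `|complex.Re z| <= M /\ `|complex.Im z| <= M].
Proof.
have -> : [set z : Cplx R | `|complex.Re z| <= M /\ `|complex.Im z| <= M] =
    (fun p : R * R => Complex p.1 p.2 : Cplx R) @` (`[- M, M] `*` `[-M, M]).
  apply/seteqP; split=> [[u v] /= [hu hv]|_ [[u v] /= [hu hv] <-]/=].
    by exists (u, v) => //=; rewrite !in_itv/= -!ler_norml.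
  by move: hu hv; rewrite !in_itv/= -!ler_norml.
apply: continuous_compact; last by apply: compact_setX; exact: segment_compact.
apply: continuous_subspaceT => -[u v].
by apply: cvg_complex; [exact: cvg_fst|exact: cvg_snd].
Qed.

Lemma compact_closed_bounded (M : R) (S : set (Cplx R)) : closed S ->
  (forall z, S z -> modulus z <= M) -> compact S.
Proof.
move=> cS SM; apply: subclosed_compact cS (@compact_rectangle M) _ => z /SM zM.
by split; [apply: le_trans (Re_le_modulus z) zM|apply: le_trans (Im_le_modulus z) zM].
Qed.

Lemma closed_modulus_le (M : R) : closed [set z : Cplx R | modulus z <= M].
Proof.
rewrite (_ : mkset _ = @modulus R @^-1` [set t : R | t <= M])//.
by apply: preimage_closed; [move=> z _; exact: continuous_modulus|exact: closed_le].
Qed.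

Lemma closed_modulus_ge (M : R) : closed [set z : Cplx R | M <= modulus z].
Proof.
rewrite (_ : mkset _ = @modulus R @^-1` [set t : R | t >= M])//.
by apply: preimage_closed; [move=> z _; exact: continuous_modulus|exact: closed_ge].
Qed.

Lemma compact_disc (c : Cplx R) (r : R) : compact [set z : Cplx R | modulus (z - c) <= r].
Proof.
apply: (@compact_closed_bounded (r + modulus c)).
  rewrite (_ : mkset _ = (fun z => z - c) @^-1` [set z | modulus z <= r])//.
  apply: preimage_closed; last exact: closed_modulus_le.
  by move=> z _; apply: (@cvgB _ _ _ (nbhs z)); [exact: cvg_id|exact: cst_continuous].
move=> z /= zr; rewrite -lerBlDr; exact: le_trans (modulus_lowerB _ _) zr.
Qed.

End plane_topology.

Lemma separated_open (T : topologicalType) (A B : set T) :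
  open A -> open B -> A `&` B = set0 -> separated A B.
Proof.
move=> oA oB /disjoints_subset AB; split; apply/disjoints_subset.
  rewrite (closure_id (~` B)).1; first exact: closureS.
  exact: open_closedC.
apply: subsetCr; rewrite (closure_id (~` A)).1; last exact: open_closedC.
by apply: closureS; exact: subsetCr.
Qed.

(** * Decreasing sequences of compact plane sets *)

Section nested_compacts.
Variable R : realType.
Variables (K : nat -> set (Cplx R)) (M : R).
Hypotheses (clK : forall n, closed (K n)) (decK : forall n, K n.+1 `<=` K n).
Hypothesis K0M : forall z, K 0%N z -> modulus z <= M.

Let decmn m n : (m <= n)%N -> K n `<=` K m.
Proof.
move/subnK => <-; elim: (n - m)%N => // k IH; rewrite addSn.
exact: subset_trans (@decK _) IH.
Qed.

Lemma nested_nonempty : (forall n, K n !=set0) -> \bigcap_n K n !=set0.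
Proof.
move=> neK.
have [x Kx] := choice neK.
have [|p [_ clp]] := compact_closed_bounded (@clK 0%N) K0M (fmap_proper_filter x _ : ProperFilter (x @ \oo)).
  by exists 0%N => // n _; exact/(decmn (leq0n n))/Kx.
exists p => m _; rewrite (closure_id (K m)).1// => B Bp.
have [_ [[n /= mn <-] Bx]] : (x @` [set n | (m <= n)%N] `&` B) !=set0.
  by apply: clp Bp; exists m => // n mn; exists n.
by exists (x n); split => //; exact: (decmn mn (Kx n)).
Qed.

End nested_compacts.

Section nested_connected.
Variable R : realType.
Variables (K : nat -> set (Cplx R)) (M : R).
Hypotheses (clK : forall n, closed (K n)) (decK : forall n, K n.+1 `<=` K n).
Hypothesis K0M : forall z, K 0%N z -> modulus z <= M.

(** A splitting of the intersection into two closed pieces extends to two disjoint open sets; by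
    compactness these already cover some [K n] and would split it. *)
Lemma nested_connected : (forall n, connected (K n)) -> connected (\bigcap_n K n).
Proof.
move=> conK; apply: contrapT => /connectedPn[E [neE KE [sep2 sep1]]].
have clI : closed (\bigcap_n K n) by apply: closed_bigI => n _; exact: clK.
have clE b : closed (E b).
  apply/closure_id/seteqP; split; first exact: subset_closure.
  move=> x Ex.
  have : (\bigcap_n K n) x.
    rewrite (closure_id (\bigcap_n K n)).1//; apply: closureS Ex.
    by rewrite KE; case: b => ? ?; [right|left].
  rewrite KE; case: b Ex => Ex [] //= Ex2.
    by have : (E false `&` closure (E true)) x by []; rewrite sep1.
  by have : (closure (E false) `&` E true) x by []; rewrite sep2.
have Ereal z b : E b z -> modulus z <= M.
  move=> Ez; apply: K0M; suff : (\bigcap_n K n) z by exact.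
  by rewrite KE; case: b Ez; [right|left].
have hC : hausdorff_space (Cplx R) by exact: norm_hausdorff.
(* Radius [M + 1] instead of [M]: the compact set must be a neighbourhood of every point of
   [E false]. *)
have [||U /= snU clU] := @compact_normal_local (Cplx R) _ hC
    (@compact_disc R 0 (M + 1)) (E false) _ (clE false) (~` E true).
- move=> z Ez; apply/nbhs_modulusP; exists 1 => // y zy /=.
  rewrite subr0; have := modulus_lowerB y z; rewrite modulusC.
  have := Ereal _ _ Ez; lra.
- move=> z Ez; apply: open_nbhs_nbhs; split; first exact/closed_openC/clE.
  move=> Ez2; have : (E false `&` closure (E true)) z.
    by split => //; exact: subset_closure.
  by rewrite sep1.
set V := ~` closure U.
have oV : open V by exact/closed_openC/closed_closure.
have oU : open U° by exact: open_interior.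
have [n Kn] : exists n, K n `<=` U° `|` V.
  apply: contrapT => /forallNP nK.
  have [||||z Kz] := @nested_nonempty R (fun n => K n `\` (U° `|` V)) M.
  - by move=> n; apply: closedI => //; exact/open_closedC/openU.
  - by move=> n z [/decK Kz ?].
  - by move=> z [/K0M].
  - by move=> n; have /existsNP[z /not_implyP[]] := nK n; exists z.
  have /= [_ nz] := Kz 0%N I.
  have : (\bigcap_n K n) z by move=> n _; have /= [] := Kz n I.
  rewrite KE => -[Ez|Ez]; apply: nz; [left; exact: snU|right].
  by move=> /clU.
have sub b : E b `<=` K n.
  move=> z Ez; suff : (\bigcap_n K n) z by move/(_ n I).
  by rewrite KE; case: b Ez; [right|left].
have UV0 : U° `&` V = set0.
  by apply/seteqP; split => // z [/interior_subset/subset_closure].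
have sepUV : separated U° V by exact: separated_open.
have [z0 Ez0] := neE false; have [z1 Ez1] := neE true.
have [KU|KV] := connected_subset sepUV Kn (conK n).
  have /interior_subset/subset_closure/clU := KU _ (sub _ _ Ez1); exact.
apply: (KV _ (sub _ _ Ez0)); apply: subset_closure.
apply: nbhs_singleton; exact: snU.
Qed.

End nested_connected.

(** * Complex exponential, logarithm and roots of unity *)

Section complex_exponential.
Variable R : realType.
Implicit Types u v z : Cplx R.

Definition cexp u : Cplx R :=
  Complex (expR (complex.Re u) * cos (complex.Im u))
          (expR (complex.Re u) * sin (complex.Im u)).

Definition twopii : Cplx R := Complex 0 (pi *+ 2).

Lemma cexp0 : cexp 0 = 1.
Proof. by rewrite /cexp /= expR0 cos0 sin0 mulr1 mulr0. Qed.

Lemma cexpD u v : cexp (u + v) = cexp u * cexp v.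
Proof.
case: u v => a b [c d]; rewrite /cexp/= expRD cosD sinD.
by apply/eqP; rewrite eq_complex /=; apply/andP; split; apply/eqP; ring.
Qed.

Lemma modulus_cexp u : modulus (cexp u) = expR (complex.Re u).
Proof.
by rewrite /modulus/= !exprMn -mulrDr cos2Dsin2 mulr1 sqrtr_sqr ger0_norm// expR_ge0.
Qed.

Lemma cexp_neq0 u : cexp u != 0.
Proof. by rewrite -modulus_gt0 modulus_cexp expR_gt0. Qed.

Lemma cexpMn u n : cexp (u *+ n) = cexp u ^+ n.
Proof. by elim: n => [|n IH]; rewrite ?mulr0n ?cexp0// mulrS cexpD IH exprS. Qed.

Lemma cexp_twopii : cexp twopii = 1.
Proof. by rewrite /cexp /= expR0 cos2pi sin2pi !mul1r. Qed.

Lemma cexp_real (t : R) : cexp (t%:C%C) = (expR t)%:C%C.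
Proof. by rewrite /cexp /= cos0 sin0 mulr1 mulr0. Qed.

Lemma continuous_cexp : continuous cexp.
Proof.
have ce : continuous (fun u => expR (complex.Re u)).
  move=> u; apply: (@continuous_comp _ _ _ (@complex.Re R : Cplx R -> R) expR).
    exact: continuous_Re.
  exact: continuous_expR.
have ci (f : R -> R) : continuous f -> continuous (fun u => f (complex.Im u)).
  move=> cf u; apply: (@continuous_comp _ _ _ (@complex.Im R : Cplx R -> R) f).
    exact: continuous_Im.
  exact: cf.
move=> u.
have h (f : R -> R) : continuous f ->
    (fun v => expR (complex.Re v) * f (complex.Im v)) @ nbhs u -->
    expR (complex.Re u) * f (complex.Im u).
  move=> cf; apply: (@cvgM _ _ (nbhs u)); [exact: ce|exact: ci].
exact: (@cvg_complex _ _ (nbhs u) _ _ _ _ _ (h _ (@continuous_cos R)) (h _ (@continuous_sin R))).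
Qed.

Lemma cexp_surj z : z != 0 -> exists u, cexp u = z.
Proof.
rewrite -modulus_gt0; case: z => x y; rewrite /modulus/=.
set r := Num.sqrt _ => r0.
have rr : r ^+ 2 = x ^+ 2 + y ^+ 2 by rewrite sqr_sqrtr// addr_ge0 ?sqr_ge0.
have xr : -1 <= x / r <= 1.
  rewrite ler_pdivlMr// ler_pdivrMr// mulN1r mul1r -ler_norml.
  exact: (@Re_le_modulus R (Complex x y)).
have yr : y ^+ 2 = r ^+ 2 * (1 - (x / r) ^+ 2).
  rewrite mulrBr mulr1 exprMn mulrCA -exprMn divff ?gt_eqF// expr1n mulr1 rr.
  by ring.
have rs : r * Num.sqrt (1 - (x / r) ^+ 2) = `|y|.
  rewrite -sqrtr_sqr yr sqrtrM ?sqr_ge0// sqrtr_sqr ger0_norm//; exact: ltW.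
have [y0|y0] := leP 0 y.
  exists (Complex (ln r) (acos (x / r))).
  rewrite /cexp /= lnK ?posrE// acosK ?in_itv//= sin_acos// rs ger0_norm//.
  by rewrite mulrC divfK// gt_eqF.
exists (Complex (ln r) (- acos (x / r))).
rewrite /cexp /= lnK ?posrE// cosN sinN acosK ?in_itv//= sin_acos// mulrN rs.
by rewrite ltr0_norm// opprK mulrC divfK// gt_eqF.
Qed.

(** The principal logarithm, but only on the right half-plane; it will be applied to ratios at
    distance less than 1 from 1. *)
Definition clog z : Cplx R :=
  Complex (ln (modulus z)) (atan (complex.Im z / complex.Re z)).

Lemma clogK z : 0 < complex.Re z -> cexp (clog z) = z.
Proof.
move=> x0; have z0 : 0 < modulus z.
  by apply: lt_le_trans (Re_le_modulus z); rewrite gtr0_norm.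
rewrite /cexp/= lnK ?posrE//; move: x0 z0; case: z => x y /= x0 z0.
have [_ tanE] := atan_def (y / x).
have cE : modulus (Complex x y : Cplx R) * cos (atan (y / x)) = x.
  rewrite cos_atan; have -> : modulus (Complex x y : Cplx R) = x * Num.sqrt (1 + (y / x) ^+ 2).
    transitivity (Num.sqrt (x ^+ 2 * (1 + (y / x) ^+ 2))); last first.
      by rewrite sqrtrM ?sqr_ge0// sqrtr_sqr gtr0_norm.
    by rewrite /modulus/= mulrDr mulr1 -exprMn mulrCA divff ?gt_eqF// mulr1.
  by rewrite mulfK// gt_eqF// sqrt1D_gt0.
rewrite cE; congr Complex.
have c0 : cos (atan (y / x)) != 0.
  by apply/eqP => c0; move: cE; rewrite c0 mulr0 => /esym/eqP; rewrite gt_eqF.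
move: tanE; rewrite /tan => /(canRL (mulfVK c0)) ->.
by rewrite mulrCA cE divfK// gt_eqF.
Qed.

Lemma continuous_clog z : 0 < complex.Re z -> {for z, continuous clog}.
Proof.
move=> x0; have z0 : 0 < modulus z.
  by apply: lt_le_trans (Re_le_modulus z); rewrite gtr0_norm.
have h1 : (fun w => ln (modulus w)) @ nbhs z --> ln (modulus z).
  apply: (@continuous_comp _ _ _ (@modulus R) (@ln R)).
    exact: continuous_modulus.
  exact: continuous_ln.
have h2 : (fun w => complex.Im w / complex.Re w) @ nbhs z -->
    complex.Im z / complex.Re z.
  apply: (@cvgM _ _ (nbhs z)); first exact: continuous_Im.
  apply: cvgV; first by rewrite gt_eqF.
  exact: continuous_Re.
have h3 : (fun w => atan (complex.Im w / complex.Re w)) @ nbhs z -->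
    atan (complex.Im z / complex.Re z).
  apply: (cvg_comp _ _ h2); exact: continuous_atan.
exact: (@cvg_complex _ _ (nbhs z) _ _ _ _ _ h1 h3).
Qed.

Definition unit_root n : Cplx R := cexp (Complex 0 (pi *+ 2 / n%:R)).

Lemma unit_root_prim n : (0 < n)%N -> n.-primitive_root (unit_root n).
Proof.
move=> n0; apply/andP; split => //; apply/forallP => /= i.
have nR : (0 : R) < n%:R by rewrite ltr0n.
have rE k : unit_root n ^+ k = cexp (Complex 0 (pi *+ 2 * (k%:R / n%:R))).
  rewrite /unit_root -cexpMn; congr cexp.
  elim: k => [|k IH]; first by rewrite mulr0n mul0r mulr0.
  rewrite mulrS IH; apply/eqP; rewrite eq_complex /= addr0 eqxx /=; apply/eqP.
  by rewrite -natr1; field; rewrite gt_eqF.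
apply/eqP; have [->|iN] := eqVneq i.+1 n.
  by rewrite unity_rootE rE divff ?pnatr_eq0 -?lt0n// mulr1 cexp_twopii eqxx.
rewrite unity_rootE rE; apply/negP => /eqP.
set t := _ / _; rewrite /cexp /= expR0 !mul1r => -[+ _].
have t0 : 0 < t by rewrite divr_gt0// ltr0n.
have t1 : t < 1.
  by rewrite ltr_pdivrMr// mul1r ltr_nat ltn_neqAle iN ltn_ord.
(* cos(2 pi t) = 1 makes cos(pi t)^2 = 1, hence sin(pi t) = 0, which is impossible for 0 < t < 1. *)
rewrite mulrnAl cos_mulr2n => h.
have : 0 < sin (pi * t).
  by apply: sin_gt0_pi; rewrite mulr_gt0 ?pi_gt0// gtr_pMr// pi_gt0.
have := cos2Dsin2 (pi * t); nra.
Qed.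

Lemma modulus_unit_root n : modulus (unit_root n) = 1.
Proof. by rewrite modulus_cexp /= expR0. Qed.

Lemma modulus_unit_rootX n k : modulus (unit_root n ^+ k) = 1.
Proof. by rewrite modulusX modulus_unit_root expr1n. Qed.

Lemma prod_unit_root n x y : (0 < n)%N ->
  \prod_(i < n) (x - y * unit_root n ^+ i) = x ^+ n - y ^+ n.
Proof.
move=> n0; have [->|y0] := eqVneq y 0.
  under eq_bigr do rewrite mul0r subr0.
  by rewrite prodr_const card_ord expr0n gtn_eqF// subr0.
have := factor_Xn_sub_1 (unit_root_prim n0); rewrite big_mkord.
move=> /(congr1 (fun p => y ^+ n * p.[x / y])).
rewrite !hornerE horner_prod => /esym H.
rewrite -[x in LHS](divfK y0) -[x in RHS](divfK y0) exprMn.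
transitivity (y ^+ n * ((x / y) ^+ n - 1)); last by ring.
rewrite H -[in y ^+ n](card_ord n) -prodr_const -big_split/=.
by apply: eq_bigr => i _; rewrite !hornerE; ring.
Qed.

(** Otherwise every factor exceeds [t], and the product exceeds the power. Applied to factorisations
    over the roots, this does the work of Rouche's theorem. *)
Lemma min_factor (s : seq (Cplx R)) (t : R) : (0 < size s)%N -> 0 <= t ->
  modulus (\prod_(z <- s) z) <= t ^+ size s -> exists2 z, z \in s & modulus z <= t.
Proof.
move=> s0 t0 h; apply: contrapT => nex.
have hs z : z \in s -> t < modulus z.
  by move=> zs; rewrite ltNge; apply/negP => zt; apply: nex; exists z.
move: h; apply/negP; rewrite -ltNge modulus_prod.
elim: s s0 hs {nex} => // z [|w s] IH _ hs.
  by rewrite big_seq1 expr1; apply: hs; rewrite inE.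
rewrite big_cons exprS; apply: ltr_pM => //; first by rewrite exprn_ge0.
  by apply: hs; rewrite inE eqxx.
by apply: IH => // y ys; apply: hs; rewrite inE ys orbT.
Qed.

Lemma exists_unit_root n x y (t : R) : (0 < n)%N -> 0 <= t ->
  modulus (x ^+ n - y ^+ n) <= t ^+ n ->
  exists k : nat, modulus (x - y * unit_root n ^+ k) <= t.
Proof.
move=> n0 t0; rewrite -prod_unit_root// => h.
set s := [seq x - y * unit_root n ^+ i | i <- index_iota 0 n].
have sz : size s = n by rewrite size_map size_iota subn0.
have [|//||z /mapP[i _ ->] zt] := @min_factor s t; first by rewrite sz.
  by rewrite sz big_map big_mkord.
by exists i.
Qed.

End complex_exponential.

(** * Coefficient estimates *)

Section cauchy_estimate.
Variable R : realType.
Implicit Types (p q r : {poly Cplx R}) (x y z : Cplx R).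

Lemma sum_unit_root n m : (0 < n)%N ->
  \sum_(j < n) (unit_root R n ^+ m) ^+ j = if (n %| m)%N then n%:R else 0.
Proof.
move=> n0; have prim := unit_root_prim R n0; rewrite (prim_order_dvd prim).
have [->|w1] := eqVneq.
  by under eq_bigr do rewrite expr1n; rewrite sumr_const card_ord.
apply/eqP; have := subrX1 (unit_root R n ^+ m) n.
rewrite exprAC (prim_expr_order prim) expr1n subrr => /esym/eqP.
by rewrite mulf_eq0 subr_eq0 (negbTE w1).
Qed.

(** Cauchy's estimate, with the contour integral replaced by an average over roots of unity of an
    order [n] larger than the degree and [k]. *)
Lemma coef_bound p (rho M : R) k : 0 <= rho ->
  (forall x, modulus x = rho -> modulus p.[x] <= M) ->
  modulus p`_k * rho ^+ k <= M.
Proof.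
move=> rho0 pM; pose n := (size p + k).+1.
have n0 : (0 < n)%N by [].
have kn : (k < n)%N by rewrite ltnS leq_addl.
have sn : (size p <= n)%N by rewrite leqW// leq_addr.
pose w := unit_root R n; pose rC : Cplx R := rho%:C%C.
(* The factor [(w ^+ j) ^+ (n - k)] is w^(-jk). The exponents i + n - k with i < n lie strictly
   between 0 and 2n, so only i = k gives a multiple of n and survives the sum over [j]. *)
have key : \sum_(j < n) p.[rC * w ^+ j] * (w ^+ j) ^+ (n - k) =
    n%:R * (p`_k * rC ^+ k).
  transitivity (\sum_(i < n) p`_i * rC ^+ i * \sum_(j < n) (w ^+ (i + (n - k))) ^+ j).
    under eq_bigr => j _.
      rewrite (horner_coef_wide _ sn) mulr_suml.
      under eq_bigr => i _.
        rewrite exprMn mulrA -mulrA -exprD exprAC.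
        over.
      over.
    by rewrite exchange_big; apply: eq_bigr => i _; rewrite -mulr_sumr.
  rewrite (bigD1 (Ordinal kn))//= [X in _ + X]big1 ?addr0.
    by rewrite sum_unit_root// subnKC ?dvdnn 1?mulrC// ltnW.
  move=> i /eqP ik; rewrite sum_unit_root//.
  case: ifPn => [ndvd|]; last by rewrite mulr0.
  exfalso; apply: ik; apply: val_inj => /=.
  have : (i + (n - k) == n)%N.
    have h2 : (i + (n - k) < n + n)%N.
      by rewrite -addSn leq_add// leq_subr.
    have h1 : (0 < i + (n - k))%N by rewrite addn_gt0 subn_gt0 kn orbT.
    case/dvdnP: ndvd h1 h2 => -[|[|m]] ->; rewrite ?mul0n ?mul1n//.
    by rewrite !mulSn addnA => _; rewrite ltnNge leq_addr.
  move=> /eqP E; apply/eqP; rewrite -(eqn_add2r (n - k)) E subnKC//.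
  exact: ltnW.
have : modulus (n%:R * (p`_k * rC ^+ k)) <= n%:R * M.
  rewrite -key; apply: le_trans (modulus_sum _ _ _) _.
  rewrite [leRHS](_ : _ = \sum_(j < n) M); last first.
    by rewrite sumr_const card_ord mulr_natl.
  apply: ler_sum => j _; rewrite modulusM modulusX modulus_unit_rootX expr1n.
  rewrite mulr1; apply: pM.
  by rewrite modulusM modulus_real ger0_norm// modulus_unit_rootX mulr1.
rewrite !modulusM modulusX modulus_nat modulus_real ger0_norm// ler_pM2l// ltr0n.
Qed.

(** [p - w%:P] keeps the degree and leading coefficient of [p], so the hypothesis bounds the product
    of the distances from [z] to its roots by a power of [t]. *)
Lemma exists_root_near p w z (t : R) : (1 < size p)%N -> 0 <= t ->
  modulus (p.[z] - w) <= modulus (lead_coef p) * t ^+ (size p).-1 ->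
  exists2 z1, p.[z1] = w & modulus (z - z1) <= t.
Proof.
move=> sp t0 h.
have szw : (size (- w%:P : {poly Cplx R}) < size p)%N.
  by rewrite size_polyN; apply: leq_ltn_trans (size_polyC_leq1 _) sp.
have spw : size (p - w%:P) = size p by rewrite size_polyDl.
have lpw : lead_coef (p - w%:P) = lead_coef p by rewrite lead_coefDl.
have [s sE] := closed_field_poly_normal (p - w%:P).
have p0 : p != 0 by rewrite -size_poly_gt0 (ltn_trans _ sp).
have lp0 : 0 < modulus (lead_coef p) by rewrite modulus_gt0 lead_coef_eq0.
have ss : size s = (size p).-1.
  rewrite -spw sE lpw size_scale ?lead_coef_eq0// size_prod_XsubC//.
have hz x : p.[x] - w = lead_coef p * \prod_(y <- s) (x - y).
  transitivity (p - w%:P).[x]; first by rewrite !hornerE.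
  rewrite sE hornerZ horner_prod lpw; congr (_ * _).
  by apply: eq_bigr => y _; rewrite !hornerE.
move: h; rewrite hz modulusM ler_pM2l// -ss => h.
have [|//||y /mapP[x xs ->] yt] := @min_factor _ [seq z - x | x <- s] t.
- by rewrite size_map ss -subn1 subn_gt0.
- by rewrite size_map big_map.
exists x => //; apply/eqP; rewrite -subr_eq0 hz (big_rem x)//= subrr mul0r mulr0.
by rewrite eqxx.
Qed.

Lemma subXn_le x y (M : R) n : modulus x <= M -> modulus y <= M ->
  modulus (x ^+ n - y ^+ n) <= n%:R * M ^+ n.-1 * modulus (x - y).
Proof.
move=> xM yM; case: n => [|n]; first by rewrite subrr modulus0 !mul0r.
have M0 : 0 <= M by apply: le_trans (modulus_ge0 x) xM.
rewrite subrXX modulusM mulrC ler_wpM2r ?modulus_ge0//=.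
apply: le_trans (modulus_sum _ _ _) _.
rewrite [leRHS](_ : _ = \sum_(i < n.+1) M ^+ n); last first.
  by rewrite sumr_const card_ord mulr_natl.
apply: ler_sum => i _; rewrite modulusM !modulusX.
rewrite -[X in _ <= M ^+ X](subnK (_ : i <= n)%N) -1?ltnS// exprD.
by rewrite ler_pM ?exprn_ge0 ?modulus_ge0// lerXn2r ?nnegrE ?modulus_ge0.
Qed.

End cauchy_estimate.

(** * Polynomials with small coefficients *)

Section perturbation.
Variables (R : realType) (d : nat) (tau c : R).
Implicit Types (x y z : Cplx R) (r : {poly Cplx R}).

(** For M >= 1/4 each power M^k with k <= d is at most 4^d M^d, whence the factor 4^d; (d + 1)^2
    pays for the number of coefficients and for the factor k produced by differences and
    derivatives. So [r] is dominated by [tau] times the leading term c M^d at every scale M >=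
    1/4. *)
Definition small_coefs r := (size r <= d.+1)%N /\
  forall k, modulus r`_k <= tau * c / (d.+1%:R ^+ 2 * 4 ^+ d).

Hypotheses (c0 : 0 <= c) (tau0 : 0 <= tau).

Let pow_le (M : R) k : (k <= d)%N -> 1/4 <= M -> M ^+ k <= 4 ^+ d * M ^+ d.
Proof.
move=> kd M4; have M0 : 0 <= M by lra.
rewrite -exprMn -[d in leRHS](subnK kd) exprD.
apply: (@le_trans _ _ (1 * (4 * M) ^+ k)).
  by rewrite mul1r lerXn2r ?nnegrE//; lra.
by rewrite ler_wpM2r ?exprn_ge0 ?exprn_ege1//; lra.
Qed.

Let bound_le (n : nat) (M : R) m : 0 <= M -> (n <= d.+1 ^ 2)%N ->
  n%:R * (tau * c / (d.+1%:R ^+ 2 * 4 ^+ d) * (4 ^+ d * M ^+ m)) <= tau * c * M ^+ m.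
Proof.
move=> M0 nd.
have q0 : 0 < 4 ^+ d :> R by rewrite exprn_gt0.
have d0 : 0 < d.+1%:R ^+ 2 :> R by rewrite exprn_gt0// ltr0n.
have -> : n%:R * (tau * c / (d.+1%:R ^+ 2 * 4 ^+ d) * (4 ^+ d * M ^+ m)) =
    (n%:R / d.+1%:R ^+ 2) * (tau * c * M ^+ m).
  by field; rewrite !gt_eqF// addrC natr1 ltr0n.
rewrite ler_piMl ?mulr_ge0 ?exprn_ge0// ler_pdivrMr// mul1r.
by rewrite -natrX ler_nat.
Qed.

Lemma small_horner r (M : R) x : small_coefs r -> 1/4 <= M -> modulus x <= M ->
  modulus r.[x] <= tau * c * M ^+ d.
Proof.
move=> [sr rk] M4 xM; have M0 : 0 <= M by lra.
apply: le_trans (@bound_le d.+1 M d M0 _); last by rewrite expnS leq_pmulr// expn_gt0.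
rewrite (horner_coef_wide _ sr); apply: le_trans (modulus_sum _ _ _) _.
rewrite mulr_natl -[X in _ *+ X](card_ord d.+1) -sumr_const.
apply: ler_sum => i _; rewrite modulusM modulusX.
apply: ler_pM; rewrite ?exprn_ge0 ?modulus_ge0//.
apply: le_trans (pow_le (ltn_ord i : (i <= d)%N) M4).
by rewrite lerXn2r ?nnegrE ?modulus_ge0.
Qed.

Let pow_le1 (M : R) k : (k <= d)%N -> 1/4 <= M -> M ^+ k.-1 <= 4 ^+ d * M ^+ d.-1.
Proof.
move=> kd M4; have M0 : 0 <= M by lra.
have : M ^+ k.-1 <= 4 ^+ d.-1 * M ^+ d.-1.
  rewrite -exprMn -[d.-1 in leRHS](subnK (_ : k.-1 <= d.-1)%N); last first.
    by rewrite -!subn1 leq_sub2r.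
  rewrite exprD; apply: (@le_trans _ _ (1 * (4 * M) ^+ k.-1)).
    by rewrite mul1r lerXn2r ?nnegrE//; lra.
  by rewrite ler_wpM2r ?exprn_ge0 ?exprn_ege1//; lra.
move/le_trans; apply; rewrite ler_wpM2r ?exprn_ge0//.
by rewrite ler_weXn2l ?leq_pred//; lra.
Qed.

Lemma small_lipschitz r (M : R) x y : small_coefs r -> 1/4 <= M ->
  modulus x <= M -> modulus y <= M ->
  modulus (r.[x] - r.[y]) <= tau * c * M ^+ d.-1 * modulus (x - y).
Proof.
move=> [sr rk] M4 xM yM; have M0 : 0 <= M by lra.
rewrite !(horner_coef_wide _ sr) -sumrB.
apply: (@le_trans _ _ ((d.+1 * d)%N%:R * (tau * c / (d.+1%:R ^+ 2 * 4 ^+ d) * (4 ^+ d * M ^+ d.-1)) * modulus (x - y))); last first.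
  rewrite ler_wpM2r ?modulus_ge0// bound_le//.
  by rewrite expnS expn1 leq_mul.
apply: le_trans (modulus_sum _ _ _) _.
rewrite natrM -(mulrA d.+1%:R) -(mulrA d.+1%:R) mulr_natl -[X in _ *+ X](card_ord d.+1) -sumr_const.
apply: ler_sum => i _; rewrite -mulrBr modulusM.
apply: (@le_trans _ _ (tau * c / (d.+1%:R ^+ 2 * 4 ^+ d) * (d%:R * (4 ^+ d * M ^+ d.-1) * modulus (x - y)))).
  apply: ler_pM; rewrite ?modulus_ge0//.
  apply: le_trans (subXn_le i xM yM) _.
  rewrite ler_wpM2r ?modulus_ge0//.
  rewrite ler_pM ?ler0n ?exprn_ge0 ?ler_nat//; first by rewrite -ltnS.
  by rewrite pow_le1// -ltnS.
set K := tau * c / _; set Q := 4 ^+ d * _; rewrite le_eqVlt; apply/orP; left; apply/eqP; ring.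
Qed.

Lemma small_deriv r (M : R) x : small_coefs r -> 1/4 <= M -> modulus x <= M ->
  modulus r^`().[x] <= tau * c * M ^+ d.-1.
Proof.
move=> [sr rk] M4 xM; have M0 : 0 <= M by lra.
have sr' : (size r^`() <= d)%N.
  have [->|r0] := eqVneq r 0; first by rewrite deriv0 size_poly0.
  by rewrite -ltnS; exact: leq_trans (lt_size_deriv r0) sr.
rewrite (horner_coef_wide _ sr').
apply: le_trans (@bound_le (d * d.+1)%N M d.-1 M0 _); last first.
  by rewrite expnS expn1 leq_mul.
apply: le_trans (modulus_sum _ _ _) _.
rewrite natrM -(mulrA d%:R) mulr_natl -[X in _ *+ X](card_ord d) -sumr_const.
apply: ler_sum => i _; rewrite modulusM modulusX coef_deriv.
apply: (@le_trans _ _ ((d.+1%:R * (tau * c / (d.+1%:R ^+ 2 * 4 ^+ d))) * (4 ^+ d * M ^+ d.-1))); last first.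
  set K := tau * c / _; set Q := 4 ^+ d * _; rewrite le_eqVlt; apply/orP; left; apply/eqP; ring.
apply: ler_pM; rewrite ?exprn_ge0 ?modulus_ge0//.
  rewrite -[r`_i.+1 *+ _]mulr_natl modulusM modulus_nat.
  by rewrite ler_pM ?ler0n ?modulus_ge0// ler_nat ltnS ltnW.
apply: le_trans (@pow_le1 M i.+1 (ltn_ord i) M4) => /=.
by rewrite lerXn2r ?nnegrE ?modulus_ge0.
Qed.

End perturbation.

(** * Inverse branches of near-powers *)

Definition near_power (R : realType) (d : nat) (tau c : R) (e : Cplx R)
    (q : {poly Cplx R}) :=
  exists2 r, small_coefs d tau c r & q = (c%:C%C *: 'X^d + r) \Po ('X - e%:P).

(** Connectedness alone is not inherited by preimages under a power: a small disc away from 0 pulls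
    back to d components. A connected periodic set [S] of logarithms is inherited, and it ties the d
    sheets together. *)
Definition annular (R : realType) (X : set (Cplx R)) :=
  exists S : set (Cplx R),
    [/\ connected S, forall u, S u -> S (u + twopii R) /\ S (u - twopii R) &
        X = @cexp R @` S].

Lemma annular_connected (R : realType) (X : set (Cplx R)) :
  annular X -> connected X.
Proof.
move=> [S [cS _ ->]]; apply: connected_continuous_connected => //.
exact/continuous_subspaceT/continuous_cexp.
Qed.

Lemma continuous_affine (R : realType) (a b : Cplx R) :
  continuous (fun u : Cplx R => (u - b) / a).
Proof.
rewrite (_ : (fun u => _) = horner ('X * (a^-1)%:P - (b / a)%:P)).
  exact: continuous_hornerC.
by apply/funext => u; rewrite !hornerE mulrBl.
Qed.

Section inverse_branch.
Variables (R : realType) (d : nat) (kap c : R) (e : Cplx R) (q r : {poly Cplx R}).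
Implicit Types (x y z u v xi : Cplx R).
Hypotheses (d4 : (4 <= d)%N) (kap0 : 0 < kap) (dkap : 8 * d%:R * kap <= 1).
Hypotheses (d34 : (3/4) ^+ d <= 1/4 :> R) (c0 : 0 < c) (c1 : c <= 1).
Hypothesis (e4 : modulus e <= 1/4).
(** Roots move by the d-th root of the relative error, hence [kap ^+ d]; the 1/2 matches the lower
    bound [c / 2] for the leading coefficient. *)
Let tau : R := kap ^+ d / 2.
Hypotheses (smallr : small_coefs d tau c r).
Hypothesis qE : q = (c%:C%C *: 'X^d + r) \Po ('X - e%:P).

Let d4R : 4 <= d%:R :> R. Proof. by rewrite ler_nat. Qed.
Let kap32 : kap <= 1/32.
Proof. have : 4 * kap <= d%:R * kap by rewrite ler_pM2r. by move: dkap; lra. Qed.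
Let kapM (m : R) : 0 <= m -> 0 <= kap * m /\ kap * m <= m / 32.
Proof.
move=> m0; split; first by rewrite mulr_ge0// ltW.
by have := ler_wpM2r m0 kap32; lra.
Qed.
Let kapd : kap ^+ d <= kap.
Proof.
rewrite -(prednK (ltn_trans (isT : 0 < 3)%N d4)) exprS.
by rewrite ler_piMr ?exprn_ile1 ?(ltW kap0)//; move: kap32; lra.
Qed.
Let tau0 : 0 < tau. Proof. by rewrite divr_gt0// exprn_gt0. Qed.
Let tau64 : tau <= 1/64. Proof. by move: kap32 kapd; rewrite /tau; lra. Qed.
Let tau2 : tau * 2 ^+ d.-1 <= 1.
Proof.
apply: (@le_trans _ _ ((2 * kap) ^+ d)); last first.
  by rewrite exprn_ile1//; move: kap0 kap32; lra.
rewrite /tau exprMn.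
have -> : 2 ^+ d = 2 * 2 ^+ d.-1 :> R by rewrite -exprS prednK// (ltn_trans (isT : 0 < 3)%N d4).
have : 0 <= kap ^+ d * 2 ^+ d.-1 by rewrite mulr_ge0 ?exprn_ge0// ltW.
lra.
Qed.

Let near_hornerE z : q.[z] = c%:C%C * (z - e) ^+ d + r.[z - e].
Proof. by rewrite qE horner_comp !hornerE. Qed.

(** As long as 2nt <= 1, each further factor moves the product by at most 2t. Two bases occur
    because the terms x^i y^j of (x^d - y^d) / (x - y) are to be compared with 1. *)
Let near_one x y (t : R) k l : modulus (x - 1) <= t -> modulus (y - 1) <= t ->
  2 * (k + l)%:R * t <= 1 -> modulus (x ^+ k * y ^+ l - 1) <= 2 * (k + l)%:R * t.
Proof.
move=> xt yt; have t0 : 0 <= t by apply: le_trans (modulus_ge0 _) xt.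
have step (P z : Cplx R) n : modulus (z - 1) <= t -> 2 * n.+1%:R * t <= 1 ->
    modulus (P - 1) <= 2 * n%:R * t -> modulus (z * P - 1) <= 2 * n.+1%:R * t.
  move=> zt; rewrite -natr1 => n1 Pn.
  rewrite (_ : z * P - 1 = (z - 1) * P + (P - 1)); last by ring.
  apply: le_trans (modulusD _ _) _; rewrite modulusM.
  have : modulus P <= 1 + 2 * n%:R * t.
    by have := modulus_lowerB P 1; rewrite modulus1; lra.
  have := modulus_ge0 P; have := modulus_ge0 (z - 1); nra.
have mono (m n : nat) : (m <= n)%N -> 2 * n%:R * t <= 1 -> 2 * m%:R * t <= 1.
  move=> mn; apply: le_trans; rewrite ler_wpM2r// ler_wpM2l// ler_nat//.
elim: k => [|k IH].
  rewrite mul1r add0n; elim: l => [|l IH] h.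
    by rewrite expr0 subrr modulus0 mulr0 mul0r.
  by rewrite exprS; apply: step => //; apply/IH/mono/h.
rewrite addSn => h; rewrite exprS -mulrA; apply: step => //; apply/IH/mono/h.
exact: leqnSn.
Qed.

(** The quotient (x^d - y^d) / (x - y) is a sum of d terms, each within 4 (d - 1) kap <= 1/2 of 1 by
    [dkap]. *)
Let pow_inj x y : modulus (x - 1) <= 2 * kap -> modulus (y - 1) <= 2 * kap ->
  d%:R / 2 * modulus (x - y) <= modulus (x ^+ d - y ^+ d).
Proof.
move=> xk yk; rewrite subrXX modulusM mulrC ler_wpM2l ?modulus_ge0//.
pose s := \sum_(i < d) (x ^+ (d.-1 - i) * y ^+ i - 1).
have -> : \sum_(i < d) x ^+ (d.-1 - i) * y ^+ i = s + d%:R.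
  by rewrite /s sumrB sumr_const card_ord subrK.
rewrite addrC; apply: le_trans (modulus_lowerD _ _); rewrite modulus_nat.
suff : modulus s <= d%:R * (1/2) by lra.
apply: le_trans (modulus_sum _ _ _) _.
rewrite mulr_natl -[X in _ *+ X](card_ord d) -sumr_const.
apply: ler_sum => i _.
have id : (d.-1 - i + i = d.-1)%N.
  by rewrite subnK// -ltnS prednK// (ltn_trans (isT : 0 < 3)%N d4).
have h : 2 * (d.-1 - i + i)%:R * (2 * kap) <= 1/2.
  rewrite id; have : (d.-1%:R : R) <= d%:R by rewrite ler_nat leq_pred.
  by move=> /(ler_wpM2r (ltW kap0)); move: dkap; lra.
by apply: (le_trans (near_one xk yk _) h); apply: (le_trans h _); lra.
Qed.

(** In units of [c * modulus xi ^+ d.-1], the pure power separates points by a factor d/2 >= 2 and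
    the perturbation takes away at most 1. The radius [2 * kap], twice that of the root
    localisation, leaves room for roots belonging to nearby values, as continuity requires. *)
Let near_inj xi x y : 1/4 <= modulus xi ->
  modulus (x - xi) <= 2 * kap * modulus xi ->
  modulus (y - xi) <= 2 * kap * modulus xi ->
  c * modulus xi ^+ d.-1 * modulus (x - y) <=
  modulus ((c%:C%C * x ^+ d + r.[x]) - (c%:C%C * y ^+ d + r.[y])).
Proof.
move=> xi4 xx yx; have m0 : 0 < modulus xi by lra.
have xi0 : xi != 0 by rewrite -modulus_gt0.
have ratio z : modulus (z - xi) <= 2 * kap * modulus xi -> modulus (z / xi - 1) <= 2 * kap.
  by rewrite -ler_pdivrMr// -modulusV -modulusM mulrBl divff.
have dE (z : Cplx R) : z ^+ d = xi ^+ d * (z / xi) ^+ d.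
  by rewrite -exprMn mulrC divfK.
have small z : modulus (z - xi) <= 2 * kap * modulus xi -> modulus z <= 2 * modulus xi.
  by move=> h; have := modulus_lowerB z xi; have [_] := kapM (ltW m0); lra.
have M4 : 1/4 <= 2 * modulus xi by lra.
have lip := small_lipschitz (ltW c0) (ltW tau0) smallr M4 (small _ xx) (small _ yx).
have pin := pow_inj (ratio _ xx) (ratio _ yx).
have pin2 : c * modulus xi ^+ d.-1 * (d%:R / 2) * modulus (x - y) <= modulus (c%:C%C * (x ^+ d - y ^+ d)).
  rewrite (dE x) (dE y) -mulrBr !modulusM modulus_real gtr0_norm// modulusX.
  rewrite -!mulrA ler_pM2l//.
  have -> : modulus xi ^+ d = modulus xi ^+ d.-1 * modulus xi.
    by rewrite -exprSr prednK// (ltn_trans (isT : 0 < 3)%N d4).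
  rewrite -mulrA ler_wpM2l ?exprn_ge0 ?modulus_ge0//.
  apply: le_trans (ler_wpM2l (ltW m0) pin).
  have -> : x - y = xi * (x / xi - y / xi) by rewrite -mulrBl mulrC divfK.
  by rewrite modulusM le_eqVlt; apply/orP; left; apply/eqP; ring.
have -> : c%:C%C * x ^+ d + r.[x] - (c%:C%C * y ^+ d + r.[y]) =
    c%:C%C * (x ^+ d - y ^+ d) + (r.[x] - r.[y]) by ring.
apply: le_trans (modulus_lowerD _ _).
have lip2 : modulus (r.[x] - r.[y]) <= c * modulus xi ^+ d.-1 * modulus (x - y).
  apply: le_trans lip _; rewrite ler_wpM2r ?modulus_ge0//.
  rewrite exprMn.
  have : 0 <= c * modulus xi ^+ d.-1 by rewrite mulr_ge0 ?exprn_ge0// ltW.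
  move: tau2; set A := 2 ^+ _; set B := modulus xi ^+ _ => h1 h2.
  have := ler_wpM2r h2 h1; lra.
have : 0 <= c * modulus xi ^+ d.-1 * modulus (x - y).
  by rewrite !mulr_ge0 ?exprn_ge0 ?modulus_ge0// ltW.
have d2 : d%:R / 2 - 2 >= 0 :> R by move: d4R; lra.
move: pin2 lip2; set B := c * _; set m := modulus (x - y) => p1 p2 p3.
have : 0 <= (B * m) * (d%:R / 2 - 2) by rewrite mulr_ge0.
lra.
Qed.

(** A solution of c xi^d = exp u, that is, the model root before translation by [e]. The logarithm
    [u], not the value exp u, selects the branch. *)
Let xi u : Cplx R := cexp ((u - (ln c)%:C%C) / d%:R).

Let d0 : (0 < d)%N. Proof. exact: ltn_trans d4. Qed.
Let dC0 : d%:R != 0 :> Cplx R. Proof. by rewrite pnatr_eq0 -lt0n. Qed.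

Let xiX u : c%:C%C * xi u ^+ d = cexp u.
Proof.
rewrite /xi -cexpMn -[_ / _ *+ d]mulr_natr divfK// -{1}(lnK (_ : c \in Num.pos)) ?posrE//.
by rewrite -cexp_real -cexpD addrC subrK.
Qed.

Let dom u := 1/4 < modulus (cexp u).

Let xi_mod u : c * modulus (xi u) ^+ d = modulus (cexp u).
Proof. by rewrite -xiX modulusM modulus_real gtr0_norm// modulusX. Qed.

Let xi_ge u : dom u -> 3/4 <= modulus (xi u).
Proof.
rewrite /dom -xi_mod => du; rewrite leNgt; apply/negP => h.
have h2 : modulus (xi u) ^+ d <= 1/4.
  by apply: le_trans d34; rewrite lerXn2r ?nnegrE ?modulus_ge0 ?ltW//; lra.
have : c * modulus (xi u) ^+ d <= 1 * (1/4).
  by rewrite ler_pM ?exprn_ge0 ?modulus_ge0// ltW.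
by move: c1; lra.
Qed.

Lemma near_size : size q = d.+1 /\ c / 2 <= modulus (lead_coef q).
Proof.
have [sr rk] := smallr.
have sX : size ('X - e%:P) = 2 by rewrite size_XsubC.
pose p := c%:C%C *: 'X^d + r; have qp : q = p \Po ('X - e%:P) by [].
have cd : c / 2 <= modulus p`_d.
  rewrite /p coefD coefZ coefXn eqxx mulr1.
  apply: le_trans (modulus_lowerD _ _); rewrite modulus_real gtr0_norm//.
  suff : modulus r`_d <= c / 2 by move: c0; lra.
  apply: le_trans (rk d) _.
  have D1 : 1 <= d.+1%:R ^+ 2 * 4 ^+ d :> R.
    by rewrite mulr_ege1// ?exprn_ege1// ?ler1n//; lra.
  rewrite ler_pdivrMr; last by lra.
  have : tau * c <= c / 2 by have := ler_wpM2r (ltW c0) tau64; move: c0; lra.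
  by move/le_trans; apply; rewrite ler_peMr//; move: c0; lra.
have pd : p`_d != 0 by rewrite -modulus_gt0; move: c0; lra.
have sp : size p = d.+1.
  apply/eqP; rewrite eqn_leq; apply/andP; split.
    apply: leq_trans (size_polyD _ _) _; rewrite geq_max sr andbT.
    by apply: leq_trans (size_scale_leq _ _) _; rewrite size_polyXn.
  by rewrite ltnNge; apply: contra pd => h; rewrite nth_default.
have sq : size q = d.+1 by rewrite qp size_comp_poly2.
split => //.
have -> : lead_coef q = lead_coef p.
  by rewrite qp lead_coef_comp ?sX// lead_coefXsubC expr1n mulr1.
by rewrite lead_coefE sp.
Qed.

(* The value of q at e + xi u differs from cexp u by less than |lead_coef q| times
   (kap |xi u|) ^ d, so that one of the d zeros of q - cexp u is that close. *)
Let branch_ex u : dom u ->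
  exists2 z, q.[z] = cexp u & modulus (z - e - xi u) <= kap * modulus (xi u).
Proof.
move=> du; have x34 := xi_ge du; have [sq lq] := near_size.
have m0 : 0 <= modulus (xi u) by lra.
have [|||z qz zk] := @exists_root_near R q (cexp u) (e + xi u) (kap * modulus (xi u)).
- by rewrite sq ltnS.
- by rewrite mulr_ge0// ltW.
- have -> : q.[e + xi u] - cexp u = r.[xi u].
    rewrite near_hornerE (_ : e + xi u - e = xi u); last by ring.
    by rewrite xiX; ring.
  rewrite sq /= exprMn.
  have x4 : 1/4 <= modulus (xi u) by lra.
  apply: le_trans (small_horner (ltW c0) (ltW tau0) smallr x4 (lexx _)) _.
  rewrite /tau mulrA ler_wpM2r ?exprn_ge0//.
  rewrite [leRHS]mulrC -[leLHS]mulrA ler_wpM2l ?exprn_ge0 ?(ltW kap0)//; lra.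
exists z => //; rewrite (_ : z - e - xi u = z - (e + xi u)) 1?modulusC//; ring.
Qed.

(** Accounts for all the roots: (z - e)^d and xi^d differ by r(z - e) / c only, so some d-th root of
    unity brings [z - e] and [xi u] together. *)
Let root_ex u z : dom u -> q.[z] = cexp u ->
  exists k : nat, modulus (z - e - xi u * unit_root R d ^+ k) <= kap * modulus (xi u).
Proof.
move=> du qz; have x34 := xi_ge du.
have m0 : 0 <= modulus (xi u) by lra.
apply: exists_unit_root => //; first by rewrite mulr_ge0// ltW.
set x := z - e; set M := Num.max (modulus x) (modulus (xi u)).
have M4 : 1/4 <= M by rewrite le_max; apply/orP; right; lra.
have rx : modulus r.[x] <= tau * c * M ^+ d.
  by apply: (small_horner (ltW c0) (ltW tau0) smallr M4); rewrite le_max lexx.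
have E : c%:C%C * (x ^+ d - xi u ^+ d) = - r.[x].
  by rewrite mulrBr xiX -qz near_hornerE -/x opprD addrA subrr sub0r.
have h1 : modulus (x ^+ d - xi u ^+ d) <= tau * M ^+ d.
  rewrite -(ler_pM2l c0) -{1}(gtr0_norm c0) -modulus_real -modulusM E modulusN.
  by rewrite mulrA (mulrC c).
apply: (le_trans h1 _); rewrite exprMn.
(* The error bound involves |x| itself; as [tau] is small it can be absorbed, giving |x|^d <= 2
   |xi|^d. *)
have Mxi : M ^+ d <= 2 * modulus (xi u) ^+ d.
  rewrite /M; case: (leP (modulus x) (modulus (xi u))) => xx.
    have : 0 <= modulus (xi u) ^+ d by rewrite exprn_ge0.
    lra.
  have : modulus (x ^+ d - xi u ^+ d) <= tau * modulus x ^+ d.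
    by apply: le_trans h1 _; rewrite /M (max_l (ltW xx)).
  have := modulus_lowerB (x ^+ d) (xi u ^+ d); rewrite !modulusX.
  have : 0 <= modulus x ^+ d by rewrite exprn_ge0// modulus_ge0.
  move: tau64; nra.
have : tau * M ^+ d <= tau * (2 * modulus (xi u) ^+ d) by rewrite ler_pM2l.
by rewrite /tau => /le_trans; apply; rewrite mulrA divfK// pnatr_eq0.
Qed.

Let xi_periodn u k : xi (u + twopii R *+ k) = xi u * unit_root R d ^+ k.
Proof.
rewrite /xi /unit_root -cexpMn -cexpD; congr cexp.
have -> : Complex 0 (pi *+ 2 / d%:R) = twopii R / d%:R :> Cplx R.
  apply: (mulIf dC0); rewrite divfK//.
  rewrite -(rmorph_nat (@real_complex R : {rmorphism R -> R[i]})).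
  apply/eqP; rewrite eq_complex /=; apply/andP; split; apply/eqP; first by ring.
  by rewrite mulr0 addrC addr0 divfK// pnatr_eq0 -lt0n.
by rewrite -mulrnAl -mulrDl; congr (_ / _); ring.
Qed.

Let xi_periodd u : xi (u + twopii R *+ d) = xi u.
Proof. by rewrite xi_periodn (prim_expr_order (unit_root_prim R d0)) mulr1. Qed.

(** The choice is canonical on [dom], where [near_inj] leaves a single candidate; this uniqueness
    makes it periodic. The default 0 occurs only outside [dom]. *)
Let sig u : Cplx R := xget 0 [set z | q.[z] = cexp u /\
  modulus (z - e - xi u) <= kap * modulus (xi u)].

Let sigP u : dom u -> q.[sig u] = cexp u /\
  modulus (sig u - e - xi u) <= kap * modulus (xi u).
Proof.
move=> /branch_ex[z h1 h2]; rewrite /sig.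
by case: xgetP => [y _ []//|/(_ z)[]].
Qed.

Let sig_uniq u z : dom u -> q.[z] = cexp u ->
  modulus (z - e - xi u) <= kap * modulus (xi u) -> z = sig u.
Proof.
move=> du qz zk; have [qs sk] := sigP du; have x34 := xi_ge du.
have x4 : 1/4 <= modulus (xi u) by lra.
have k2 y : modulus (y - e - xi u) <= kap * modulus (xi u) ->
    modulus (y - e - xi u) <= 2 * kap * modulus (xi u).
  by have [] := kapM (modulus_ge0 (xi u)); lra.
have := near_inj x4 (k2 _ zk) (k2 _ sk).
rewrite -!near_hornerE qz qs subrr modulus0 pmulr_rle0; last first.
  by rewrite mulr_gt0 ?exprn_gt0//; lra.
move=> h; have : modulus (z - e - (sig u - e)) == 0.
  by rewrite eq_le h modulus_ge0.
rewrite modulus_eq0 => /eqP E; apply/eqP; rewrite -subr_eq0; apply/eqP.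
by rewrite -E; ring.
Qed.

Let continuous_xi : continuous xi.
Proof.
move=> u; apply: (@continuous_comp _ _ _ (fun u : Cplx R => (u - (ln c)%:C%C) / d%:R) (@cexp R)).
  exact: continuous_affine.
exact: continuous_cexp.
Qed.

Let open_dom u : dom u -> \forall v \near nbhs u, dom v.
Proof.
move=> du; apply: (@continuous_cexp R u [set z | 1/4 < modulus z]).
by apply: open_nbhs_nbhs; split => //; exact: open_modulus_gt.
Qed.

(** [near_inj] bounds |sig u - sig v| by a multiple of |exp u - exp v|, in place of the implicit
    function theorem. *)
Let continuous_sig u : dom u -> sig @ nbhs u --> sig u.
Proof.
move=> du; have x34 := xi_ge du; have m0 : 0 < modulus (xi u) by lra.
have x4 : 1/4 <= modulus (xi u) by lra.
apply/(@cvg_modulusP _ _ (nbhs u)) => eps eps0.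
set D := c * modulus (xi u) ^+ d.-1.
have D0 : 0 < D by rewrite mulr_gt0 ?exprn_gt0.
have ck : 0 < kap * modulus (xi u) / 4 by rewrite divr_gt0// mulr_gt0.
have cxi := (@cvg_modulusP _ _ (nbhs u) _ _ _).1 (@continuous_xi u) _ ck.
have cex := (@cvg_modulusP _ _ (nbhs u) _ _ _).1 (@continuous_cexp R u) _ (mulr_gt0 D0 eps0).
near=> v.
have dv : dom v by near: v; exact: open_dom.
have hxi : modulus (xi u - xi v) < kap * modulus (xi u) / 4 by near: v; exact: cxi.
have hex : modulus (cexp u - cexp v) < D * eps by near: v; exact: cex.
have [qu su] := sigP du; have [qv sv] := sigP dv.
have [km0 km1] := kapM (ltW m0).
have s2u : modulus (sig u - e - xi u) <= 2 * kap * modulus (xi u) by lra.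
have s2v : modulus (sig v - e - xi u) <= 2 * kap * modulus (xi u).
  apply: le_trans (modulus_tri (xi v) _ _) _; rewrite (modulusC (xi v)).
  have : modulus (xi v) <= modulus (xi u) + modulus (xi u - xi v).
    by rewrite modulusC -lerBlDl modulus_lowerB.
  move=> /(ler_wpM2l (ltW kap0)); rewrite mulrDr.
  have [_] := kapM (modulus_ge0 (xi u - xi v)); lra.
have := near_inj x4 s2u s2v; rewrite -!near_hornerE qu qv -/D.
rewrite (_ : sig u - e - (sig v - e) = sig u - sig v); last by ring.
by move=> h; rewrite -(ltr_pM2l D0); apply: (le_lt_trans h hex).
Unshelve. all: by end_near. Qed.

Let sig_ratio u : dom u -> 0 < complex.Re (sig u / xi u).
Proof.
move=> du; have x34 := xi_ge du; have m0 : 0 < modulus (xi u) by lra.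
have x0 : xi u != 0 by rewrite -modulus_gt0.
have [_ su] := sigP du.
have h : modulus (sig u / xi u - 1) < 1.
  rewrite -(divff x0) -mulrBl modulusM modulusV ltr_pdivrMr// mul1r.
  apply: le_lt_trans (modulus_tri (e + xi u) _ _) _.
  rewrite (_ : sig u - (e + xi u) = sig u - e - xi u); last by ring.
  rewrite (_ : e + xi u - xi u = e); last by ring.
  have [_] := kapM (ltW m0); move: e4 su x34; lra.
have : `|complex.Re (sig u / xi u - 1)| < 1.
  exact: le_lt_trans (Re_le_modulus _) h.
rewrite (_ : complex.Re (sig u / xi u - 1) = complex.Re (sig u / xi u) - 1).
  by rewrite ltr_norml => /andP[+ _]; rewrite ltrBrDr addNr.
by case: (sig u / xi u).
Qed.

(** A logarithm of [sig u], not of [sig u - e], because the next pullback again needs logarithms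
    around 0. Since |e| <= 1/4 and |xi u| >= 3/4, the ratio [sig u / xi u] stays in the right
    half-plane, where [clog] is continuous. *)
Let Psi u : Cplx R := (u - (ln c)%:C%C) / d%:R + clog (sig u / xi u).

Let cexp_Psi u : dom u -> cexp (Psi u) = sig u.
Proof.
move=> du; rewrite cexpD clogK ?sig_ratio// -/(xi u) mulrC divfK//.
exact: cexp_neq0.
Qed.

Let continuous_Psi u : dom u -> {for u, continuous Psi}.
Proof.
move=> du; apply: (@cvgD _ _ _ (nbhs u)).
  exact: continuous_affine.
have h : (fun u => sig u / xi u) @ nbhs u --> sig u / xi u.
  apply: (@cvgM _ _ (nbhs u)); first exact: continuous_sig.
  by apply: (@cvgV _ _ (nbhs u)); [exact: cexp_neq0|exact: continuous_xi].
apply: (cvg_comp _ _ h); apply: continuous_clog; exact: sig_ratio.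
Qed.

Let dom_period u : dom u -> dom (u + twopii R *+ d).
Proof.
suff : cexp (u + twopii R *+ d) = cexp u by rewrite /dom => ->.
by rewrite cexpD cexpMn cexp_twopii expr1n mulr1.
Qed.

Let Psi_period u : dom u -> Psi (u + twopii R *+ d) = Psi u + twopii R.
Proof.
move=> du; rewrite /Psi xi_periodd.
have -> : sig (u + twopii R *+ d) = sig u.
  have [qs sk] := sigP (dom_period du).
  apply: sig_uniq => //; last by move: sk; rewrite xi_periodd.
  by rewrite qs cexpD cexpMn cexp_twopii expr1n mulr1.
rewrite -(mulr_natr (twopii R)); field; exact: dC0.
Qed.

(** The new set of logarithms is the image of [S] under [Psi]. A shift by 2 pi i there comes from a
    shift of [u] by 2 pi i d, and the shifts of [u] by 2 pi i k reach all the roots over exp u. The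
    bound 1/2 keeps [S] inside [dom]. *)
Lemma annular_preimage_aux X : annular X -> (forall z, X z -> 1/2 <= modulus z) ->
  annular (horner q @^-1` X).
Proof.
move=> [S [cS perS XE]] Xge.
have Sdom u : S u -> dom u.
  move=> Su; rewrite /dom; apply: lt_le_trans (Xge _ _); first lra.
  by rewrite XE; exists u.
have perSn u k : S u -> S (u + twopii R *+ k) /\ S (u - twopii R *+ k).
  move=> Su; elim: k => [|k [IH1 IH2]]; first by rewrite mulr0n subr0 addr0.
  by rewrite !mulrSr opprD !addrA; split; [exact: (perS _ IH1).1|exact: (perS _ IH2).2].
exists (Psi @` S); split.
- apply: (connected_continuous_connected cS).
  apply: continuous_in_subspaceT => u /set_mem Su.
  exact/continuous_Psi/Sdom.
- move=> _ [u Su <-]; have [S1 S2] := perSn u d Su; split.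
    by exists (u + twopii R *+ d) => //; rewrite Psi_period//; exact: Sdom.
  exists (u - twopii R *+ d) => //.
  by rewrite -[in RHS](subrK (twopii R *+ d) u) Psi_period ?addrK//; exact: Sdom.
- apply/seteqP; split=> [z /= Xq|_ [_ [u Su <-] <-]].
    move: Xq; rewrite XE => -[u Su qz].
    have du := Sdom _ Su; have [k hk] := root_ex du (esym qz).
    have Sk := (perSn u k Su).1; have dk := Sdom _ Sk.
    exists (Psi (u + twopii R *+ k)); first by exists (u + twopii R *+ k).
    rewrite cexp_Psi//; apply/esym/sig_uniq => //.
      by rewrite cexpD cexpMn cexp_twopii expr1n mulr1.
    by rewrite xi_periodn; apply: le_trans hk _; rewrite modulusM modulus_unit_rootX mulr1.
  have du := Sdom _ Su.
  by rewrite /= cexp_Psi// (sigP du).1 XE; exists u.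
Qed.

End inverse_branch.

(** * Perturbed maps *)

(** [hyp_expand] asks that the image also avoid the small disc: at points near |z| = 1/2 the
    derivative may be tiny. *)
Record hyperbolic_poly (R : realType) (q : {poly Cplx R}) : Prop := HyperbolicPoly {
  hyp_disc : forall z, modulus z <= 1/2 -> modulus q.[z] < 1/2 ;
  hyp_contract : forall x y, modulus x <= 1/2 -> modulus y <= 1/2 ->
    modulus (q.[x] - q.[y]) <= modulus (x - y) / 2 ;
  hyp_escape : forall z, 4 <= modulus z -> 2 * modulus z <= modulus q.[z] ;
  hyp_expand : forall z, 1/2 <= modulus z -> modulus z <= 4 ->
    1/2 <= modulus q.[z] -> 3/2 <= modulus q^`().[z] ;
  hyp_crit : forall z, 1/2 <= modulus z -> q^`().[z] != 0 ;
  hyp_size : size q = 17 ;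
  hyp_annular : forall X : set (Cplx R), annular X ->
    (forall z, X z -> 1/2 <= modulus z) -> annular (horner q @^-1` X) }.

Section good_polynomials.
Variable R : realType.
Implicit Types (x y z e : Cplx R) (q : {poly Cplx R}).

(* With this bound, a perturbed 16th power c (z - e)^16 takes the value c xi^16
   exactly once within |xi| / 128 of each point e + xi zeta, zeta^16 = 1. *)
Definition pert_size : R := (1/128) ^+ 16 / 2.
Definition near16 c e q := near_power 16 pert_size c e q.

Lemma pert_size_gt0 : 0 < pert_size.
Proof. by rewrite divr_gt0// exprn_gt0// divr_gt0. Qed.

Lemma pert_size_le : pert_size <= 1/100.
Proof. by rewrite /pert_size; lra. Qed.

Lemma near16_estimates c e q : 0 < c -> near16 c e q ->
  [/\ forall M z, 1/4 <= M -> modulus (z - e) <= M ->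
        modulus (q.[z] - c%:C%C * (z - e) ^+ 16) <= pert_size * c * M ^+ 16,
      forall M z, 1/4 <= M -> modulus (z - e) <= M ->
        modulus (q^`().[z] - c%:C%C * (16%:R * (z - e) ^+ 15)) <=
          pert_size * c * M ^+ 15 &
      forall M x y, 1/4 <= M -> modulus (x - e) <= M -> modulus (y - e) <= M ->
        modulus (q.[x] - q.[y]) <= (16 + pert_size) * c * M ^+ 15 * modulus (x - y)].
Proof.
move=> c0 [r sr qE].
have qz z : q.[z] = c%:C%C * (z - e) ^+ 16 + r.[z - e].
  by rewrite qE horner_comp !hornerE.
have t0 := ltW pert_size_gt0.
split=> [M z M4 zM|M z M4 zM|M x y M4 xM yM].
- rewrite qz addrAC subrr add0r; exact: (small_horner (ltW c0) t0 sr M4 zM).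
- rewrite qE deriv_comp derivB derivX derivC subr0 mulr1 horner_comp derivD.
  rewrite derivZ derivXn hornerD hornerZ hornerMn hornerXn hornerXsubC -[16.-1%N]/15%N.
  rewrite [X in modulus X](_ : _ = r^`().[z - e]); last by ring.
  exact: (small_deriv (ltW c0) t0 sr M4 zM).
- rewrite !qz [X in modulus X <= _](_ : _ = c%:C%C * ((x - e) ^+ 16 - (y - e) ^+ 16) +
    (r.[x - e] - r.[y - e])); last by ring.
  apply: le_trans (modulusD _ _) _.
  have lip := small_lipschitz (ltW c0) t0 sr M4 xM yM.
  have pw := subXn_le 16 xM yM.
  have xy : x - e - (y - e) = x - y by ring.
  rewrite xy /= in lip pw; rewrite modulusM modulus_real gtr0_norm//.
  have := ler_wpM2l (ltW c0) pw.
  move: lip; set A := M ^+ 15; set m := modulus (x - y); lra.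
Qed.

Lemma near16_bounds c e q : 0 < c -> near16 c e q ->
  [/\ forall M z, 1/4 <= M -> modulus (z - e) <= M ->
        modulus q.[z] <= 101/100 * c * M ^+ 16,
      forall z, 1/4 <= modulus (z - e) ->
        99/100 * c * modulus (z - e) ^+ 16 <= modulus q.[z] &
      forall z, 1/4 <= modulus (z - e) ->
        15 * c * modulus (z - e) ^+ 15 <= modulus q^`().[z]].
Proof.
move=> c0 /(near16_estimates c0)[e0 e1 _].
have t1 := pert_size_le; have t0 := pert_size_gt0.
have cM (M : R) n : 0 <= M -> 0 <= c * M ^+ n.
  by move=> M0; rewrite mulr_ge0 ?exprn_ge0// ltW.
have tcM (M : R) n : 0 <= M -> pert_size * c * M ^+ n <= 1/100 * (c * M ^+ n).
  by move=> M0; rewrite -mulrA ler_wpM2r// cM.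
split=> [M z M4 zM|z z4|z z4].
- have M0 : 0 <= M by lra.
  have := e0 M z M4 zM; have := modulus_lowerB q.[z] (c%:C%C * (z - e) ^+ 16).
  rewrite modulusM modulus_real gtr0_norm// modulusX.
  have : c * modulus (z - e) ^+ 16 <= c * M ^+ 16.
    by rewrite ler_pM2l// lerXn2r ?nnegrE ?modulus_ge0.
  have := tcM M 16 M0; lra.
- have M0 : 0 <= modulus (z - e) by lra.
  have := e0 _ z z4 (lexx _); have := modulus_lowerB (c%:C%C * (z - e) ^+ 16) q.[z].
  rewrite modulusM modulus_real gtr0_norm// modulusX [X in _ <= X -> _]modulusC.
  have := tcM _ 16 M0; lra.
- have M0 : 0 <= modulus (z - e) by lra.
  have := e1 _ z z4 (lexx _).
  have := modulus_lowerB (c%:C%C * (16%:R * (z - e) ^+ 15)) q^`().[z].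
  rewrite modulusM [modulus (16%:R * _)]modulusM modulusX modulus_nat modulus_real gtr0_norm// [X in _ <= X -> _]modulusC.
  have := tcM _ 15 M0; have := cM _ 15 M0; lra.
Qed.

(** One argument serves the three maps: [c <= 1] yields contraction of the disc and c >= 3^-15
    yields escape from |z| >= 4; the values used are c = 1 and c = 3^-15. *)
Lemma near16_hyperbolic c e q : 0 < c -> c <= 1 -> 1 <= c * 3 ^+ 15 ->
  modulus e <= 1/4 -> near16 c e q -> hyperbolic_poly q.
Proof.
move=> c0 c1 c3 e4 nq.
have [b0 b1 b2] := near16_bounds c0 nq.
have [_ _ lip] := near16_estimates c0 nq.
have t1 := pert_size_le; have t0 := pert_size_gt0.
have ze z : modulus z - 1/4 <= modulus (z - e).
  by apply: le_trans (modulus_lowerB _ _); lra.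
have ze2 z : modulus (z - e) <= modulus z + 1/4.
  by apply: (le_trans (modulusB _ _)); lra.
have q34 : 1/4 <= 3/4 :> R by lra.
split.
- move=> z z2; have zM : modulus (z - e) <= 3/4 by have := ze2 z; lra.
  have := b0 _ _ q34 zM.
  have : c * (3/4) ^+ 16 <= 1 * (1/50) by rewrite ler_pM ?exprn_ge0 ?(ltW c0)//; lra.
  lra.
- move=> x y x2 y2; have xM : modulus (x - e) <= 3/4 by have := ze2 x; lra.
  have yM : modulus (y - e) <= 3/4 by have := ze2 y; lra.
  apply: (le_trans (lip _ _ _ q34 xM yM)); rewrite mulrC ler_wpM2l ?modulus_ge0//.
  have : (16 + pert_size) * c <= 17 * 1 by rewrite ler_pM ?(ltW c0)//; lra.
  move=> h; have : (16 + pert_size) * c * (3/4) ^+ 15 <= 17 * 1 * (1/40).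
    by rewrite ler_pM ?exprn_ge0 ?mulr_ge0 ?(ltW c0)//; lra.
  lra.
- move=> z z4; have zM := ze z; have z14 : 1/4 <= modulus (z - e) by lra.
  apply: le_trans (b1 z z14).
  have zM2 : 15/16 * modulus z <= modulus (z - e) by lra.
  rewrite exprS.
  have h15 : (15/4) ^+ 15 <= modulus (z - e) ^+ 15.
    by rewrite lerXn2r ?nnegrE ?modulus_ge0//; lra.
  have h : 21 <= c * modulus (z - e) ^+ 15.
    apply: (@le_trans _ _ (c * (15/4) ^+ 15)); last by rewrite ler_pM2l.
    have -> : c * (15/4) ^+ 15 = (c * 3 ^+ 15) * (5/4) ^+ 15.
      by rewrite -mulrA -exprMn; congr (_ * _ ^+ _); field.
    have : 1 * 21 <= c * 3 ^+ 15 * (5/4) ^+ 15 by rewrite ler_pM//; lra.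
    lra.
  have : 21 * (15/16 * modulus z) <= c * modulus (z - e) ^+ 15 * modulus (z - e).
    by rewrite ler_pM//; lra.
  have := modulus_ge0 z; lra.
(* Here |q'(z)| |z - e| >= 15 c |z - e|^16 >= 15 (100/101) |q(z)| > 7, while |z - e| <= 17/4. *)
- move=> z z2 z4 qz; have zM := ze z; have z14 : 1/4 <= modulus (z - e) by lra.
  have zM2 := ze2 z.
  have := b0 _ _ z14 (lexx _); rewrite exprS.
  have := b2 _ z14; have := modulus_ge0 (q^`().[z]).
  set D := modulus q^`().[z]; set x := modulus (z - e) in z14 zM zM2 *.
  move=> D0 h1 h2.
  have h3 : 15 * c * x ^+ 15 * x <= D * x by rewrite ler_wpM2r//; lra.
  have h4 : D * x <= D * (17/4) by rewrite ler_wpM2l//; lra.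
  lra.
- move=> z z2; have zM := ze z; have z14 : 1/4 <= modulus (z - e) by lra.
  rewrite -modulus_gt0; apply: lt_le_trans (b2 _ z14).
  by rewrite pmulr_rgt0 ?exprn_gt0 ?pmulr_rgt0//; lra.
- have [r sr qE] := nq.
  have [] // := @near_size R 16 (1/128) c e q r _ _ _ _ sr qE => //; lra.
- move=> X aX Xge; have [r sr qE] := nq.
  by apply: (@annular_preimage_aux R 16 (1/128) c e q r) => //; lra.
Qed.

Lemma center_outside e q z : modulus e <= 1/4 -> near16 1 e q ->
  3/2 <= modulus z -> 4 < modulus q.[z].
Proof.
move=> e4 nq z2; have [_ b1 _] := near16_bounds ltr01 nq.
have zM : 5/4 <= modulus (z - e).
  by apply: le_trans (modulus_lowerB _ _); lra.
apply: lt_le_trans (b1 _ _); last lra.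
have : (5/4) ^+ 16 <= modulus (z - e) ^+ 16.
  by rewrite lerXn2r ?nnegrE ?modulus_ge0//; lra.
lra.
Qed.

Lemma outer_inside q z : near16 (3 ^- 15) 0 q ->
  modulus z <= 3/2 -> modulus q.[z] < 1/2.
Proof.
have c0 : 0 < 3 ^- 15 :> R by rewrite invr_gt0 exprn_gt0.
move=> nq z2; have [b0 _ _] := near16_bounds c0 nq.
have h : 1/4 <= 3/2 :> R by lra.
have := b0 _ z h; rewrite subr0 => /(_ z2) /le_lt_trans; apply.
have -> : 101/100 * 3 ^- 15 * (3/2) ^+ 16 = 101/100 * (3/2) * (1/2) ^+ 15 * (3 ^- 15 * 3 ^+ 15) :> R.
  by field.
rewrite mulVf ?expf_neq0 ?pnatr_eq0//; lra.
Qed.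

(** At -t the centre 1/4 is farther than the centre -1/4. A value of [q2] outside the small disc
    forces |t - 1/4| > 9/10, as (9/10)^16 < 1/5, so t > 23/20; then t + 1/4 > 7/5, and (7/5)^16 >
    200. *)
Lemma crossing_left q1 q2 (t : R) : 0 <= t ->
  near16 1 (1/4)%:C%C q1 -> near16 1 (- (1/4)%:C%C) q2 ->
  1/2 <= modulus q2.[(- t)%:C%C] -> 4 < modulus q1.[(- t)%:C%C].
Proof.
move=> t0 n1 n2.
have [b0 _ _] := near16_bounds ltr01 n2.
have [_ b1 _] := near16_bounds ltr01 n1.
have E1 : modulus ((- t)%:C%C - (1/4)%:C%C) = t + 1/4.
  by rewrite -rmorphB modulus_real ler0_norm; lra.
have E2 : modulus ((- t)%:C%C - - (1/4)%:C%C) = `|1/4 - t|.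
  by rewrite -rmorphN -rmorphB modulus_real; congr `|_|; ring.
move=> h.
have h9 : 9/10 < `|1/4 - t|.
  rewrite ltNge; apply/negP => h9.
  have := b0 (9/10) ((- t)%:C%C); rewrite E2 => /(_ _ h9); lra.
have t1 : 23/20 < t by move: h9; case: (ger0P (1/4 - t)); lra.
apply: lt_le_trans (b1 _ _); rewrite E1; last lra.
have : (7/5) ^+ 16 <= (t + 1/4) ^+ 16 by rewrite lerXn2r ?nnegrE//; lra.
lra.
Qed.

(** The mirror estimate: (11/10)^16 > 4.5 forces t + 1/4 < 11/10, so |t - 1/4| <= 3/5, and (3/5)^16
    is tiny. *)
Lemma crossing_right q1 q2 (t : R) : 0 <= t ->
  near16 1 (1/4)%:C%C q1 -> near16 1 (- (1/4)%:C%C) q2 ->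
  modulus q2.[t%:C%C] <= 4 -> modulus q1.[t%:C%C] < 1/2.
Proof.
move=> t0 n1 n2.
have [b0 _ _] := near16_bounds ltr01 n1.
have [_ b1 _] := near16_bounds ltr01 n2.
have E1 : modulus (t%:C%C - (1/4)%:C%C) = `|t - 1/4|.
  by rewrite -rmorphB modulus_real.
have E2 : modulus (t%:C%C - - (1/4)%:C%C) = t + 1/4.
  by rewrite -rmorphN -rmorphB modulus_real opprK ger0_norm; lra.
move=> h.
have t1 : t + 1/4 < 11/10.
  rewrite ltNge; apply/negP => h9.
  have := b1 (t%:C%C); rewrite E2 => /(_ _).
  have : (11/10) ^+ 16 <= (t + 1/4) ^+ 16 by rewrite lerXn2r ?nnegrE//; lra.
  lra.
have h6 : modulus (t%:C%C - (1/4)%:C%C) <= 3/5.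
  by rewrite E1; case: (ger0P (t - 1/4)); lra.
have := b0 (3/5) _ _ h6; lra.
Qed.

End good_polynomials.

(** * Uniform neighbourhoods of the model maps *)

Section chordal_neighbourhood.
Variable R : realType.
Implicit Types (p q : {poly Cplx R}) (x : Cplx R).

Definition base_poly (c : R) (e : Cplx R) : {poly Cplx R} :=
  c%:C%C *: ('X - e%:P) ^+ 16.

(* |s A ^ 2 - y| >= (A - 1) |s A - y| for every zero y of q. *)
Lemma zeros_growth q (s A : R) : 0 <= s -> 1 <= A -> q != 0 ->
  (forall x, root q x -> modulus x <= s) ->
  modulus q.[(s * A)%:C%C] * (A - 1) ^+ (size q).-1 <=
  modulus q.[(s * A ^+ 2)%:C%C].
Proof.
move=> s0 A1 q0 qs; have [r rE] := closed_field_poly_normal q.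
have l0 : lead_coef q != 0 by rewrite lead_coef_eq0.
have sr : (size q).-1 = size r by rewrite rE size_scale// size_prod_XsubC.
have hz x : q.[x] = lead_coef q * \prod_(y <- r) (x - y).
  rewrite {1}rE hornerZ horner_prod; congr (_ * _).
  by apply: eq_bigr => y _; rewrite !hornerE.
have rs y : y \in r -> modulus y <= s.
  move=> yr; apply: qs; rewrite /root hz (big_rem y)//= subrr mul0r mulr0.
  exact: eqxx.
have sA : 0 <= s * A by rewrite mulr_ge0//; lra.
have sA2 : 0 <= s * A ^+ 2 by rewrite mulr_ge0// exprn_ge0//; lra.
have A0 : 0 <= A - 1 by lra.
rewrite !hz !modulusM sr -mulrA ler_wpM2l ?modulus_ge0// !modulus_prod.
elim: r rs {rE sr hz} => [|y r IH] rs; first by rewrite !big_nil expr0 mulr1.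
rewrite !big_cons /= [_ ^+ (size r).+1]exprS mulrACA; apply: ler_pM.
- by rewrite mulr_ge0 ?modulus_ge0.
- by rewrite mulr_ge0 ?exprn_ge0// prodr_ge0// => i _; exact: modulus_ge0.
- have ys : modulus y <= s by apply: rs; rewrite inE eqxx.
  have := modulusB (s * A)%:C%C y; have := modulus_lowerB (s * A ^+ 2)%:C%C y.
  rewrite !modulus_real !ger0_norm// => h1 h2.
  have := ler_wpM2r A0 h2; have := ler_wpM2r A0 ys; rewrite expr2 in h1 *; nra.
- by apply: IH => z zs; apply: rs; rewrite inE zs orbT.
Qed.

Let pow_step n (x y : R) : 0 <= x -> x <= y -> 1 <= y -> x ^+ n <= y ^+ n.+1.
Proof.
move=> x0 xy y1; apply: (@le_trans _ _ (y ^+ n)); last exact: ler_weXn2l.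
by rewrite lerXn2r// nnegrE (le_trans x0).
Qed.

(** From radius 3A to 3A^2 with A = 32, the monomial x^16 grows by 32^16, whereas a polynomial with
    at least 17 zeros in |x| <= 3 grows by at least 31^17. *)
Let growth_constant : 2 * 32 ^+ 16 <= 31 ^+ 17 :> R.
Proof.
have h : 22/25 * 32 ^+ 4 <= 31 ^+ 4 :> R by lra.
have h0 : 0 <= 22/25 * 32 ^+ 4 :> R by lra.
have := @lerXn2r R 4 (22/25 * 32 ^+ 4) (31 ^+ 4).
rewrite !nnegrE => /(_ h0 (le_trans h0 h) h).
have -> : 31 ^+ 17 = 31 * (31 ^+ 4) ^+ 4 :> R by rewrite -exprM -exprS.
have -> : 32 ^+ 16 = (32 ^+ 4) ^+ 4 :> R by rewrite -exprM.
rewrite exprMn.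
have : 0 <= (32 ^+ 4) ^+ 4 :> R by rewrite exprn_ge0// exprn_ge0.
move: ((32 ^+ 4) ^+ 4 : R) ((31 ^+ 4) ^+ 4 : R) => a b; lra.
Qed.

(** Here B = c (3A)^16, L = 32^16, K = 31^17, and [u], [v] are the moduli of the polynomial at 3A
    and 3A^2. Then u >= 9B/10 gives v >= uK >= 9BL/5, against v <= BL + 1/10. *)
Let growth_absurd (B K L u v f g m : R) : m <= 1/10 -> 2 * L <= K -> 1 <= L ->
  1 <= B -> B - u <= f -> v - B * L <= g -> f <= m -> g <= m ->
  u * K <= v -> False.
Proof.
move=> m10 K12 K1 B1 L1 L2 h1 h2 uv.
have u9 : 9/10 * B <= u by lra.
have h3 : 9/10 * B * (2 * L) <= u * K by apply: ler_pM => //; lra.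
have h4 : 1 * 1 <= B * L by apply: ler_pM => //; lra.
lra.
Qed.

(** After recentring at [e], chordal closeness becomes Euclidean closeness on |x| <= 3A^2. All zeros
    lie in |x| <= 3, so the growth comparison bounds the degree by 16, and [coef_bound] on the unit
    circle controls the coefficients. *)
Lemma chordal_near16 (c : R) (e : Cplx R) : 0 < c -> 1 <= c * 3 ^+ 15 ->
  exists2 d : R, 0 < d & forall q, (2 < size q)%N ->
    (forall y : sphere R, chordal (poly_map (base_poly c e) y) (poly_map q y) <= d) ->
    near16 c e q.
Proof.
move=> c0 c3.
have [A AE] : exists A : R, A = 32 by exists 32.
have A32 : 0 < 3 * A by lra.
have A3072 : 0 < 3 * A ^+ 2 by rewrite pmulr_rgt0// exprn_gt0//; lra.
have A3 : 3 <= 3 * A by lra.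
have A31 : 1 <= 3 * A by lra.
have AA : 3 * A <= 3 * A ^+ 2 by rewrite expr2; nra.
pose M := c * (3 * A ^+ 2) ^+ 16; have M0 : 0 < M by rewrite pmulr_rgt0// exprn_gt0.
pose eta := pert_size R * c / (17%:R ^+ 2 * 4 ^+ 16).
have eta0 : 0 < eta.
  by apply: divr_gt0; apply: mulr_gt0 => //; [exact: pert_size_gt0|apply: exprn_gt0..].
pose m := Num.min eta (1/10).
have m0 : 0 < m by rewrite lt_min eta0; lra.
(* Chosen so that d (1 + M) <= 1/2 and d (1 + M)^2 <= m, the two quantities entering
   [chordal_finite]. *)
pose d := Num.min (1/2) (m / (1 + M)) / (1 + M).
have M1 : 0 < 1 + M by lra.
have d0 : 0 < d.
  by rewrite divr_gt0// lt_min; apply/andP; split; [lra|exact: divr_gt0].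
have d1 : d * (1 + M) <= 1/2 by rewrite divfK ?gt_eqF// ge_min lexx.
have d2 : d * (1 + M) ^+ 2 <= m.
  rewrite expr2 mulrA divfK ?gt_eqF// -ler_pdivlMr// ge_min lexx orbT//.
exists d => // q sq chq.
pose qt := q \Po ('X + e%:P).
have qtE x : qt.[x] = q.[x + e] by rewrite horner_comp !hornerE.
have ch x : chordal (Some (c%:C%C * x ^+ 16)) (Some qt.[x]) <= d.
  have := chq (Some (x + e)); rewrite /= /base_poly hornerZ horner_exp hornerXsubC.
  by rewrite addrK qtE.
have close x : modulus x <= 3 * A ^+ 2 -> modulus (qt.[x] - c%:C%C * x ^+ 16) <= m.
  move=> xM; rewrite modulusC.
  have [|||b [<-] h] := @chordal_finite R M d (c%:C%C * x ^+ 16) (Some qt.[x]).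
  - rewrite modulusM modulusX modulus_real gtr0_norm// ler_pM2l// lerXn2r ?nnegrE ?modulus_ge0//.
    exact: ltW.
  - by apply: (le_trans d1); lra.
  - exact: ch.
  exact: (le_trans h d2).
(* At a zero with |x| > 3 the model value has modulus w >= 3, hence chordal distance at least 2w /
   (1 + w) >= 3/2 from 0, more than d. *)
have roots x : root qt x -> modulus x <= 3.
  move=> /eqP rx; rewrite leNgt; apply/negP => x3.
  have := ch x; rewrite rx /chordal subr0 modulus0 expr0n /= addr0 sqrtr1 mulr1.
  set w := modulus _; have w3 : 3 <= w.
    rewrite /w modulusM modulusX modulus_real gtr0_norm//.
    apply: (@le_trans _ _ (c * 3 ^+ 16)); last first.
      by rewrite ler_pM2l// lerXn2r ?nnegrE ?modulus_ge0// ltW.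
    by rewrite exprSr mulrA; lra.
  have := @sqrt1D_le R w; have := @sqrt1D_gt0 R w.
  set S := Num.sqrt _ => S0 /(_ _) S1.
  rewrite ler_pdivrMr//.
  have : d <= 1/2.
    by apply: le_trans d1; rewrite ler_peMr ?(ltW d0)//; lra.
  have : S <= 1 + w by apply: S1; lra.
  nra.
have sqt : size qt = size q by rewrite size_comp_poly2// size_XaddC.
have qt0 : qt != 0 by rewrite -size_poly_gt0 sqt; apply: leq_trans sq.
have s17 : (size qt <= 17)%N.
  rewrite leqNgt; apply/negP => s17.
  have A1 : 1 <= A by lra.
  have := zeros_growth (ler0n _ 3) A1 qt0 roots.
  set x1 : Cplx R := (3 * A)%:C%C; set x2 : Cplx R := (3 * A ^+ 2)%:C%C.
  have m10 : m <= 1/10 by rewrite ge_min lexx orbT.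
  have M1E : modulus x1 = 3 * A by rewrite modulus_real gtr0_norm.
  have M2E : modulus x2 = 3 * A ^+ 2 by rewrite modulus_real gtr0_norm.
  have h1 : modulus (qt.[x1] - c%:C%C * x1 ^+ 16) <= m by apply: close; rewrite M1E.
  have h2 : modulus (qt.[x2] - c%:C%C * x2 ^+ 16) <= m by apply: close; rewrite M2E.
  have L1 := modulus_lowerB (c%:C%C * x1 ^+ 16) qt.[x1].
  have L2 := modulus_lowerB qt.[x2] (c%:C%C * x2 ^+ 16).
  have N x : modulus (c%:C%C * x ^+ 16) = c * modulus x ^+ 16.
    by rewrite modulusM modulusX modulus_real gtr0_norm.
  rewrite N M1E modulusC in L1; rewrite N M2E in L2.
  have P : 31 ^+ 17 <= (A - 1) ^+ (size qt).-1.
    rewrite AE (_ : 32 - 1 = 31); last by lra.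
    by rewrite ler_weXn2l//; [lra|rewrite -ltnS prednK// (ltn_trans _ s17)].
  move=> growth.
  have {growth} : modulus qt.[x1] * 31 ^+ 17 <= modulus qt.[x2].
    by apply: le_trans growth; rewrite ler_wpM2l ?modulus_ge0.
  have E2 : c * (3 * A ^+ 2) ^+ 16 = (c * (3 * A) ^+ 16) * A ^+ 16.
    by rewrite -mulrA -exprMn; congr (_ * _ ^+ _); ring.
  rewrite E2 in L2.
  have B1 : 1 <= c * (3 * A) ^+ 16.
    apply: (le_trans c3); apply: ler_wpM2l; first exact: ltW.
    exact: (@pow_step 15 3 (3 * A) (ler0n _ 3) A3 A31).
  have E3 : A ^+ 16 = 32 ^+ 16 by rewrite AE.
  rewrite E3 in L2.
  have K1 : 1 <= 32 ^+ 16 :> R := @exprn_ege1 R 16 32 (ler1n _ 32).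
  have K12 := growth_constant.
  move=> uv.
  exact: growth_absurd m10 K12 K1 B1 L1 L2 h1 h2 uv.
exists (qt - c%:C%C *: 'X^16).
  split; last first.
    move=> k; have := @coef_bound R (qt - c%:C%C *: 'X^16) 1 eta k ler01 _.
    rewrite expr1n mulr1; apply=> x x1.
    rewrite hornerD hornerN hornerZ hornerXn; apply: le_trans (close x _) _.
      rewrite x1 AE; lra.
    by rewrite ge_min lexx.
  apply: leq_trans (size_polyD _ _) _; rewrite geq_max s17 size_polyN.
  by apply: leq_trans (size_scale_leq _ _) _; rewrite size_polyXn.
rewrite [_ + (qt - _)]addrC subrK -comp_polyA comp_polyD comp_polyX comp_polyC subrK.
by rewrite comp_polyXr.
Qed.

End chordal_neighbourhood.

(** * Words *)

Section words.
Variables (R : realType) (I : finType) (h : I -> {poly Cplx R}).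
Hypothesis hyp : forall i, hyperbolic_poly (h i).
Implicit Types (w v : seq I) (z x y : Cplx R).

(* The letters of a word act in the order in which they are written. *)
Fixpoint word_poly w : {poly Cplx R} :=
  if w is i :: v then word_poly v \Po h i else 'X.

Definition word_eval w z : Cplx R := (word_poly w).[z].

Definition word_annulus w : set (Cplx R) :=
  [set z | 1/2 <= modulus (word_eval w z) /\ modulus (word_eval w z) <= 4].

(** One word for each length, with no compatibility required. Since prefixes inherit the property
    and the alphabet is finite, Koenig's lemma identifies this with the existence of an infinite
    word. *)
Definition word_limit : set (Cplx R) :=
  [set z | forall n, exists2 w, size w = n & word_annulus w z].

Lemma word_eval0 z : word_eval [::] z = z.
Proof. by rewrite /word_eval hornerX. Qed.

Lemma word_eval_cons i w z : word_eval (i :: w) z = word_eval w (h i).[z].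
Proof. by rewrite /word_eval /= horner_comp. Qed.

Lemma word_eval_cat w v z : word_eval (w ++ v) z = word_eval v (word_eval w z).
Proof.
by elim: w z => [|i w IH] z; rewrite ?word_eval0// cat_cons !word_eval_cons IH.
Qed.

Lemma word_disc w z : modulus z < 1/2 -> modulus (word_eval w z) < 1/2.
Proof.
elim: w z => [|i w IH] z z2; first by rewrite word_eval0.
by rewrite word_eval_cons; apply/IH/(hyp_disc (hyp i))/ltW.
Qed.

Lemma word_disc_contract w x y : modulus x < 1/2 -> modulus y < 1/2 ->
  modulus (word_eval w x - word_eval w y) <= (1/2) ^+ size w.
Proof.
move=> x2 y2.
suff H : modulus (word_eval w x - word_eval w y) <= (1/2) ^+ size w * modulus (x - y).
  apply: (le_trans H); rewrite ler_piMr ?exprn_ge0//.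
  by apply: (le_trans (modulusB _ _)); lra.
elim: w x y x2 y2 => [|i w IH] x y x2 y2; first by rewrite !word_eval0 expr0 mul1r.
rewrite !word_eval_cons.
have dx := hyp_disc (hyp i) (ltW x2); have dy := hyp_disc (hyp i) (ltW y2).
apply: (le_trans (IH _ _ dx dy)); rewrite /= exprSr -mulrA ler_wpM2l ?exprn_ge0//.
by have := hyp_contract (hyp i) (ltW x2) (ltW y2); lra.
Qed.

Lemma word_escape w z : 4 <= modulus z -> 2 ^+ size w * modulus z <= modulus (word_eval w z).
Proof.
elim: w z => [|i w IH] z z4; first by rewrite word_eval0 expr0 mul1r.
have e := hyp_escape (hyp i) z4.
rewrite word_eval_cons; apply: le_trans (IH _ _); last lra.
by rewrite /= exprSr -mulrA ler_wpM2l// exprn_ge0.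
Qed.

Lemma word_escape_gt w z : 4 < modulus z -> 4 < modulus (word_eval w z).
Proof.
move=> z4; apply: lt_le_trans (word_escape w (ltW z4)).
apply: (lt_le_trans z4); rewrite ler_peMl ?modulus_ge0// exprn_ege1//; lra.
Qed.

(** An orbit that has left the annulus, into the disc or beyond |z| = 4, never returns, so its last
    position controls all earlier ones. *)
Lemma word_annulus_prefix w v z : word_annulus (w ++ v) z -> word_annulus w z.
Proof.
rewrite /word_annulus/= word_eval_cat => -[h1 h2]; split; rewrite leNgt; apply/negP.
  by move=> /(word_disc v); lra.
by move=> /(word_escape_gt v); lra.
Qed.

Lemma word_annulus_cat w v z :
  word_annulus (w ++ v) z <-> word_annulus v (word_eval w z).
Proof. by rewrite /word_annulus/= word_eval_cat. Qed.

Lemma word_deriv_expand w z : word_annulus w z ->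
  (3/2) ^+ size w <= modulus (word_poly w)^`().[z].
Proof.
elim: w z => [|i w IH] z wz; first by rewrite derivX hornerC modulus1.
have [z2 z4] : word_annulus [::] z by exact: (@word_annulus_prefix [::] (i :: w)).
have iwz : word_annulus w (h i).[z].
  by move: wz; rewrite /word_annulus/= word_eval_cons.
have [iz _] : word_annulus [::] (h i).[z] by exact: (@word_annulus_prefix [::] w).
rewrite !word_eval0 in z2 z4 iz.
rewrite /= deriv_comp hornerM horner_comp modulusM exprSr ler_pM ?exprn_ge0//; try lra.
  exact: IH.
exact: (hyp_expand (hyp i)).
Qed.

Lemma word_size_gt1 w : (1 < size (word_poly w))%N.
Proof.
elim: w => [|i w IH]; first by rewrite size_polyX.
have /= := size_comp_poly (word_poly w) (h i); rewrite (hyp_size (hyp i)) /=.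
move: IH; case: (size (word_poly w)) => [|[|n]]//= _; rewrite mulSn.
by case: (size _) => [|[|m]].
Qed.

Lemma word_size_gt2 w : w != [::] -> (2 < size (word_poly w))%N.
Proof.
case: w => // i w _ /=.
have := size_comp_poly (word_poly w) (h i); rewrite (hyp_size (hyp i)) /=.
have := word_size_gt1 w; case: (size (word_poly w)) => [|[|n]]//= _; rewrite mulSn.
by case: (size _) => [|[|[|m]]].
Qed.

(** By the chain rule the orbit passes through a critical point of a letter; these lie in |z| < 1/2,
    a disc that the orbit cannot leave. *)
Lemma word_crit_value w z : (word_poly w)^`().[z] = 0 ->
  modulus (word_eval w z) < 1/2.
Proof.
elim: w z => [|i w IH] z; first by rewrite derivX hornerC => /eqP; rewrite oner_eq0.
rewrite /= deriv_comp hornerM horner_comp word_eval_cons => /eqP.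
rewrite mulf_eq0 => /orP[/eqP|/eqP d0]; first exact: IH.
apply: word_disc; apply: (hyp_disc (hyp i)).
rewrite leNgt; apply/negP => /ltW /(hyp_crit (hyp i)).
by rewrite d0 eqxx.
Qed.

Lemma closed_word_annulus w : closed (word_annulus w).
Proof.
rewrite (_ : word_annulus w = (word_eval w @^-1` [set z | 1/2 <= modulus z]) `&`
  (word_eval w @^-1` [set z | modulus z <= 4])); last by [].
apply: closedI; apply: preimage_closed.
- by move=> z _; exact: continuous_hornerC.
- exact: closed_modulus_ge.
- by move=> z _; exact: continuous_hornerC.
- exact: closed_modulus_le.
Qed.

Lemma word_annulus_bounded w z : word_annulus w z -> modulus z <= 4.
Proof.
by move/(@word_annulus_prefix [::] w) => -[_]; rewrite word_eval0.
Qed.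

Lemma annular_base : annular [set z : Cplx R | 1/2 <= modulus z /\ modulus z <= 4].
Proof.
pose S : set (Cplx R) := [set u | ln (1/2) <= complex.Re u /\ complex.Re u <= ln 4].
exists S; split.
(* The strip is convex; it is written as a union of segments joining its points to ln 4. *)
- pose seg (u : Cplx R) (t : R) : Cplx R := Complex (t * complex.Re u + (1 - t) * ln 4) (t * complex.Im u).
  have cseg u : continuous (seg u).
    move=> t; apply: cvg_complex.
      apply: cvgD; first by apply: cvgM; [exact: cvg_id|exact: cvg_cst].
      by apply: cvgM; [apply: cvgB; [exact: cvg_cst|exact: cvg_id]|exact: cvg_cst].
    by apply: cvgM; [exact: cvg_id|exact: cvg_cst].
  have -> : S = \bigcup_(u in S) (seg u @` `[0, 1]).
    apply/seteqP; split=> [u Su|_ [u [u1 u2] [t + <-]]].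
      exists u => //; exists 1; first by rewrite /= in_itv/= ler01 lexx.
      by rewrite /seg !mul1r subrr mul0r addr0; case: u {Su}.
    rewrite /= in_itv/= => /andP[t0 t1].
    have ln24 : ln (1/2) <= ln 4 :> R by rewrite ler_ln ?posrE; lra.
    by split => /=; nra.
  apply: bigcup_connected => [|u _].
    exists (Complex (ln 4) 0) => u _; exists 0; first by rewrite /= in_itv/= ler01 lexx.
    by rewrite /seg !mul0r add0r subr0 mul1r.
  apply: connected_continuous_connected; first exact: segment_connected.
  exact: continuous_subspaceT.
- by move=> [a b]; rewrite /S/= ?addr0 ?subr0.
- apply/seteqP; split=> [z [z1 z2]|_ [u [u1 u2] <-]].
    have z0 : z != 0 by rewrite -modulus_gt0; lra.
    have [u uz] := cexp_surj z0; exists u => //.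
    rewrite -uz modulus_cexp in z1 z2.
    by split; rewrite -ler_expR lnK ?posrE//; lra.
  split; rewrite modulus_cexp.
    by rewrite -[leLHS]lnK ?posrE ?ler_expR//; lra.
  by rewrite -[leRHS]lnK ?posrE ?ler_expR//; lra.
Qed.

Lemma word_annulus_annular w : annular (word_annulus w).
Proof.
elim: w => [|i w IH].
  rewrite (_ : word_annulus [::] = [set z | 1/2 <= modulus z /\ modulus z <= 4]).
    exact: annular_base.
  by apply/seteqP; split=> z; rewrite /word_annulus/= word_eval0.
rewrite (_ : word_annulus (i :: w) = horner (h i) @^-1` word_annulus w).
  apply: (hyp_annular (hyp i)) => // z /(@word_annulus_prefix [::] w) [].
  by rewrite word_eval0.
by apply/seteqP; split=> z; rewrite /word_annulus/= word_eval_cons.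
Qed.

Lemma connected_word_annulus w : connected (word_annulus w).
Proof. exact/annular_connected/word_annulus_annular. Qed.

End words.

(** * The Julia set of the semigroup *)

Lemma subsequence (Q : nat -> nat -> Prop) :
  (forall k N, exists2 n, (N <= n)%N & Q k n) ->
  exists2 s : nat -> nat, {homo s : m n / (m < n)%N} & forall k, Q k (s k).
Proof.
move=> QP; have /choice[g gP] : forall kN : nat * nat, exists n, (kN.2 <= n)%N /\ Q kN.1 n.
  by move=> [k N]; have [n ? ?] := QP k N; exists n.
pose s := fix s k := if k is k'.+1 then g (k, (s k').+1) else g (0%N, 0%N).
exists s; last by case=> [|k]; [exact: (gP (0, 0)%N).2|exact: (gP (k.+1, (s k).+1)).2].
apply: homo_ltn => [? ? ?|k]; first exact: ltn_trans.
exact: (gP (k.+1, (s k).+1)).1.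
Qed.

Lemma increasing_ge (s : nat -> nat) : {homo s : m n / (m < n)%N} ->
  forall n, (n <= s n)%N.
Proof. by move=> hs; elim=> // n IH; apply: leq_ltn_trans IH (hs _ _ (ltnSn n)). Qed.

Lemma pigeonhole (T : finType) (P : T -> nat -> Prop) :
  (forall n, exists t, P t n) -> exists t, forall N, exists2 n, (N <= n)%N & P t n.
Proof.
move=> nP; apply: contrapT => /forallNP no.
have /choice[M MP] : forall t, exists M, forall n, (M <= n)%N -> ~ P t n.
  by move=> t; have /existsNP[M MP] := no t; exists M => n Mn Ptn; apply: MP; exists n.
have [t] := nP (\max_t M t)%N; apply: MP; exact: leq_bigmax.
Qed.

Lemma natS_le_exp2 (R : realType) (n k : nat) : (n <= k)%N -> n.+1%:R <= 2 ^+ k :> R.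
Proof.
move=> nk; rewrite -natrX ler_nat; apply: (@leq_trans (2 ^ n)).
  exact: ltn_expl.
by rewrite leq_exp2l.
Qed.

Section semigroup.
Variables (R : realType) (I : finType) (h : I -> {poly Cplx R}).
Hypothesis hyp : forall i, hyperbolic_poly (h i).
Implicit Types (w v : seq I).

Let wp := word_poly h.
Let we := word_eval h.
Let G := semigroup_gen (range (fun i => poly_map (h i))).

Lemma poly_map_comp (p q : {poly Cplx R}) : poly_map p \o poly_map q = poly_map (p \Po q).
Proof. by apply/funext => -[a|]//=; rewrite horner_comp. Qed.

Lemma word_poly_cat w v : wp (w ++ v) = wp v \Po wp w.
Proof.
elim: w => [|i w IH]; first by rewrite comp_polyXr.
by rewrite /wp /= -/wp IH comp_polyA.
Qed.

Lemma semigroup_words :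
  G = [set g | exists2 w, w != [::] & g = poly_map (wp w)].
Proof.
have one i : wp [:: i] = h i by rewrite /wp /= comp_polyX.
apply/seteqP; split.
  apply: smallest_sub => [f g [w w0 ->] [v v0 ->]|_ [i _ <-]].
    exists (v ++ w); last by rewrite poly_map_comp word_poly_cat.
    by case: v v0.
  by exists [:: i] => //; rewrite one.
move=> _ [w w0 ->]; case: w w0 => // i w _.
elim: w i => [|j w IH] i M [Mcomp Mi]; first by rewrite one; apply: Mi; exists i.
rewrite -[i :: _]/([:: i] ++ (j :: w)) word_poly_cat one -poly_map_comp.
by apply: (Mcomp); [exact: (IH j M (conj Mcomp Mi))|apply: Mi; exists i].
Qed.

Let D : set (sphere R) := @Some (Cplx R) @` [set z | modulus z < 1/2].
Let E : set (sphere R) := [set x | forall a, x = Some a -> 4 < modulus a].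

(* A sequence of maps given by words either repeats a word infinitely often or has
   unbounded word lengths; then it tends to a constant, by contraction in D or
   by escape in E. *)
Lemma normal_near x N (U : set (sphere R)) : open_nbhs x U ->
  (forall w, size w = N -> poly_map (wp w) @` U `<=` D \/ poly_map (wp w) @` U `<=` E) ->
  Fatou G x.
Proof.
move=> [oU Ux] absorbed; exists U => // u; rewrite semigroup_words => uG.
have /choice[w wP] n : exists w, u n = poly_map (wp w) by have [w _ ->] := uG n; exists w.
have [[v vio]|nv] := pselect (exists v, forall M, exists2 n, (M <= n)%N & w n = v).
  have [s sinc sv] := @subsequence (fun _ n => w n = v) (fun _ => vio).
  exists s; split => //; exists (poly_map (wp v)) => K _ _.
  apply/uniform_chordalP => e e0; near=> n => y _.
  by rewrite /= wP sv chordal_xx.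
(* Each of the finitely many words of length [L] occurs only up to some index, so that length is
   eventually exceeded. *)
have long L : exists M, forall n, (M <= n)%N -> (L <= size (w n))%N.
  elim: L => [|L [M MP]]; first by exists 0%N.
  have /choice[B BP] : forall t : L.-tuple I, exists B, forall n, (B <= n)%N -> w n <> t.
    move=> t; apply: contrapT => /forallNP no; apply: nv; exists (t : seq I) => N'.
    by have /existsNP[n /not_implyP[Nn /contrapT wn]] := no N'; exists n.
  exists (maxn M (\max_t B t)) => n; rewrite geq_max => /andP[Mn Bn].
  rewrite ltn_neqAle MP// andbT; apply/eqP => sz.
  have st : size (w n) == L by rewrite -sz.
  apply: (BP (Tuple st) n) => //; apply: leq_trans Bn.
  exact: (leq_bigmax (Tuple st)).
have /choice[e eP] : forall n, exists m, (n <= m)%N /\ (N + n <= size (w m))%N.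
  move=> n; have [M MP] := long (N + n)%N; exists (maxn n M).
  by rewrite leq_maxl; split => //; apply/MP/leq_maxr.
(* A subsequence shares its prefix [p] of length [N], so its maps all factor through one map that
   sends [U] into [D] or into [E]. *)
have [n|p pio] := @pigeonhole (N.-tuple I) (fun t n => take N (w (e n)) = t).
  have st : size (take N (w (e n))) == N.
    by rewrite size_takel//; apply: leq_trans (eP n).2; exact: leq_addr.
  by exists (Tuple st).
have [|s1 s1inc s1P] := @subsequence (fun k n => take N (w n) = p /\ (N + k <= size (w n))%N).
  move=> k M; have [n Mn pn] := pio (maxn M k); exists (e n).
    by apply: leq_trans (eP n).1; apply: leq_trans Mn; exact: leq_maxl.
  split => //; apply: leq_trans (eP n).2; rewrite leq_add2l.
  by apply: leq_trans Mn; exact: leq_maxr.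
pose r k := drop N (w (s1 k)).
have wE k : w (s1 k) = p ++ r k by rewrite /r -(s1P k).1 cat_take_drop.
have rk k : (k <= size (r k))%N.
  by rewrite size_drop; have := (s1P k).2; rewrite leq_subRL// (leq_trans _ (s1P k).2)// leq_addr.
have uE k y : u (s1 k) y = poly_map (wp (r k)) (poly_map (wp p) y).
  by rewrite wP wE word_poly_cat -poly_map_comp.
have [pD|pE] := absorbed p (size_tuple p).
  have U2 y : U y -> exists2 a, poly_map (wp p) y = Some a & modulus a < 1/2.
    by move=> Uy; have [|a a2 <-] := pD (poly_map (wp p) y); [exists y|exists a].
  have [a0 pa0 a02] := U2 _ Ux.
  (* The remaining words contract the disc, so every point of [U] follows this one orbit, and a
     cluster point of [c] is the constant limit along a subsequence. *)
  pose c k := we (r k) a0.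
  have c2 k : modulus (c k) < 1/2 by exact: word_disc.
  have [|l [_ cl]] := @compact_disc R 0 (1/2) _ (fmap_proper_filter c _ : ProperFilter (c @ \oo)).
    by exists 0%N => // k _ /=; rewrite subr0 ltW.
  have [|s2 s2inc s2P] := @subsequence (fun k j => modulus (l - c j) < k.+1%:R^-1).
    move=> k M.
    have [_ [[j /= Mj <-] jl]] : (c @` [set j | (M <= j)%N] `&` [set y | modulus (l - y) < k.+1%:R^-1]) !=set0.
      apply: cl; first by exists M => // j Mj; exists j.
      by apply/nbhs_modulusP; exists k.+1%:R^-1 => //; rewrite invr_gt0 ltr0n.
    by exists j.
  exists (s1 \o s2); split; first by move=> m n mn /=; exact/s1inc/s2inc.
  exists (fun=> Some l) => K _ KU; apply/uniform_chordalP => eps eps0.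
  have eps4 : 0 < eps / 4 by rewrite divr_gt0.
  near=> n => y Ky; rewrite /= uE.
  have [a -> a2] := U2 _ (KU _ Ky); rewrite /=.
  apply: le_lt_trans (chordal_le2 _ _) _.
  have h1 := s2P n.
  have h2 : modulus (c (s2 n) - (wp (r (s2 n))).[a]) <= n.+1%:R^-1.
    apply: (le_trans (word_disc_contract hyp (r (s2 n)) a02 a2)).
    rewrite div1r exprVn lef_pV2 ?posrE ?exprn_gt0 ?ltr0n//.
    apply: natS_le_exp2; apply: leq_trans (rk _); exact: increasing_ge.
  have h3 : n.+1%:R^-1 < eps / 4.
    near: n; have := near_infty_natSinv_lt (PosNum eps4); exact.
  have := modulus_tri (c (s2 n)) l (wp (r (s2 n))).[a].
  move=> h4; have := le_lt_trans h4 (ltrD (lt_trans h1 h3) (le_lt_trans h2 h3)).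
  by move: (modulus _) => m; lra.
exists s1; split => //; exists (fun=> None) => K _ KU.
apply/uniform_chordalP => eps eps0.
have eps2 : 0 < eps / 2 by rewrite divr_gt0.
near=> n => y Ky; rewrite /= uE.
have : E (poly_map (wp p) y) by apply: pE; exists y => //; exact: KU.
case: (poly_map (wp p) y) => [a|] Ea; last by rewrite /= eps0.
have a4 : 4 < modulus a by exact: Ea.
have n0 : 0 < n.+1%:R :> R by rewrite ltr0n.
apply: (@le_lt_trans _ _ (2 / n.+1%:R)).
  apply: chordal_infty => //.
  apply: le_trans (word_escape hyp (r n) (ltW a4)).
  have p2 : n.+1%:R <= 2 ^+ size (r n) :> R.
    exact/natS_le_exp2/rk.
  apply: (le_trans p2); rewrite ler_peMr ?exprn_ge0//; lra.
have : n.+1%:R^-1 < eps / 2.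
  near: n; have := near_infty_natSinv_lt (PosNum eps2); exact.
by move: (n.+1%:R^-1 : R) => t; lra.
Unshelve. all: by end_near. Qed.

Lemma Fatou_infty : Fatou G None.
Proof.
apply: (@normal_near None 0%N E).
  by split => //; exact: (@open_outside R 4).
move=> [|//] _; right => _ [x Ex <-].
by case: x Ex => [a|]//= Ea b [<-]; rewrite hornerX; exact: Ea.
Qed.

(** Some length [N] admits no word keeping [z] in the annulus. There are finitely many words of that
    length, so one neighbourhood of [z] is absorbed by all of them. *)
Lemma Fatou_escape z : ~ word_limit h z -> Fatou G (Some z).
Proof.
move=> /existsNP[N noN].
have nb (t : N.-tuple I) : \forall y \near nbhs z,
    modulus (we t z) < 1/2 /\ modulus (we t y) < 1/2 \/
    4 < modulus (we t z) /\ 4 < modulus (we t y).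
  have [tz|tz|tz] : [\/ modulus (we t z) < 1/2, 4 < modulus (we t z) | word_annulus h t z].
    case: (ltP (modulus (we t z)) (1/2)) => t1; first by constructor 1.
    case: (ltP 4 (modulus (we t z))) => t2; first by constructor 2.
    by constructor 3.
  - have H : \forall y \near nbhs z, modulus (we t y) < 1/2.
      apply: (@continuous_hornerC R (wp t) z [set y | modulus y < 1/2]).
      by apply: open_nbhs_nbhs; split => //; exact: open_modulus_lt.
    by apply: filterS H => y yt; left.
  - have H : \forall y \near nbhs z, 4 < modulus (we t y).
      apply: (@continuous_hornerC R (wp t) z [set y | 4 < modulus y]).
      by apply: open_nbhs_nbhs; split => //; exact: open_modulus_gt.
    by apply: filterS H => y yt; right.
  by exfalso; apply: noN; exists t => //; exact: size_tuple.
have := filter_forall (nbhs_filter z) nb.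
rewrite nbhsE /= => -[V [oV Vz] VP].
apply: (@normal_near _ N (@Some (Cplx R) @` V)).
  by split; [exact: open_Some|exists z].
move=> w wN; have st : size w == N by rewrite wN.
have VP' y : V y -> _ := fun Vy => VP y Vy (Tuple st).
have [[z2 _]|[z4 _]] := VP' z Vz; [left|right].
  move=> _ [_ [y Vy <-] <-] /=; exists (wp w).[y] => //.
  by have [[]|[]] := VP' y Vy => //=; rewrite /we /=; move: z2; rewrite /we /=; lra.
move=> _ [_ [y Vy <-] <-] /= _ [<-].
by have [[]|[]] := VP' y Vy => //=; rewrite /we /=; move: z4; rewrite /we /=; lra.
Qed.

(* On a disc where the maps are uniformly bounded, Cauchy's estimate bounds their
   derivatives at z, which however grow like (3/2) ^ n. *)
Lemma Julia_word_limit z : word_limit h z -> Julia G (Some z).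
Proof.
move=> zlim [U [oU Uz] nU].
have /choice[w wP] : forall n, exists w, size w = n.+1 /\ word_annulus h w z.
  by move=> n; have [w] := zlim n.+1; exists w.
have [n|s [sinc [f fP]]] := nU (fun n => poly_map (wp (w n))).
  rewrite semigroup_words; exists (w n) => //.
  by have := (wP n).1; case: (w n).
have /nbhs_modulusP[rho rho0 rhoU] : nbhs z (finite_part U).
  by apply: open_nbhs_nbhs; split => //; exact: open_preimage_Some.
pose K : set (sphere R) := @Some (Cplx R) @` [set y | modulus (y - z) <= rho / 2].
have cK : compact K.
  apply: continuous_compact (@compact_disc R z (rho / 2)).
  exact/continuous_subspaceT/continuous_Some.
have KU : K `<=` U.
  by move=> _ [y /= yz <-]; apply: rhoU; rewrite modulusC; lra.
have /uniform_chordalP fK := fP K cK KU.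
(* Twice 1/12 is 1/6, the largest distance allowed by [chordal_finite] for M = 5; it yields a
   Euclidean bound of 6, whence the bound 5 + 6 = 11 below. *)
have d0 : 0 < 1/12 :> R by lra.
have [N _ NP] := fK _ d0.
have close n y : (N <= n)%N -> modulus (y - z) <= rho / 2 ->
    chordal (Some (we (w (s N)) y)) (Some (we (w (s n)) y)) <= 1/6.
  move=> Nn yz.
  have Ky : K (Some y) by exists y.
  have /= h2 := NP _ (leqnn N) _ Ky; have /= h1 := NP _ Nn _ Ky.
  have h3 := @chordal_triangle R (f (Some y)) (Some (we (w (s N)) y)) (Some (we (w (s n)) y)).
  rewrite [chordal _ (f _)]chordal_sym in h3.
  have := le_trans h3 (lerD (ltW h2) (ltW h1)).
  by move=> /le_trans; apply; lra.
have [_ z4] := (wP (s N)).2.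
have /nbhs_modulusP[del del0 delP] : nbhs z [set y | modulus (we (w (s N)) y) < 5].
  apply: (@continuous_hornerC R (wp (w (s N))) z [set y | modulus y < 5]).
  apply: open_nbhs_nbhs; split; first exact: open_modulus_lt.
  by rewrite /=; move: z4; rewrite /word_eval -/wp; lra.
pose q := Num.min (rho / 2) (del / 2).
have q0 : 0 < q by rewrite lt_min !divr_gt0.
have bnd n y : (N <= n)%N -> modulus (y - z) = q -> modulus (we (w (s n)) y) <= 11.
  move=> Nn yz.
  have y5 : modulus (we (w (s N)) y) < 5.
    by apply: delP; rewrite modulusC yz gt_min; apply/orP; right; lra.
  have yr : modulus (y - z) <= rho / 2 by rewrite yz ge_min lexx.
  have [|b [<-]] := chordal_finite (ltW y5) _ (close _ _ Nn yr); first lra.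
  have := modulus_lowerB (we (w (s n)) y) (we (w (s N)) y).
  by rewrite [modulus (_ - we (w (s N)) y)]modulusC; lra.
have der n : (N <= n)%N -> (3/2) ^+ (s n).+1 * q <= 11.
  move=> Nn; pose p := wp (w (s n)) \Po ('X + z%:P).
  have p1 : p`_1 = (wp (w (s n)))^`().[z].
    rewrite -[p`_1]mulr1n -coef_deriv -horner_coef0 deriv_comp derivD derivX derivC.
    by rewrite addr0 mulr1 horner_comp !hornerE.
  have := @coef_bound R p q 11 1 (ltW q0) _; rewrite expr1 p1.
  move=> H; have {}H := H _.
  apply: le_trans (H _).
    rewrite ler_pM2r// -(wP (s n)).1.
    exact: word_deriv_expand (wP (s n)).2.
  move=> x xq; rewrite /p horner_comp !hornerE.
  by apply: bnd => //; rewrite addrK.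
have big n : (N <= n)%N -> n%:R * q / 2 <= 11.
  move=> Nn; apply: le_trans (der n Nn); rewrite mulrAC ler_pM2r//.
  have bern k : k%:R / 2 <= (3/2) ^+ k :> R /\ 1 <= (3/2) ^+ k :> R.
    elim: k => [|k [IH1 IH2]]; first by rewrite mul0r expr0 ler01.
    rewrite exprS -natr1; lra.
  apply: le_trans (bern (s n).+1).1; rewrite ler_pM2r// ler_nat.
  by apply: leqW; exact: increasing_ge.
have := @archimedean.Num.Theory.archi_boundP R (22 / q) (divr_ge0 (ler0n R 22) (ltW q0)).
set m := archimedean.Num.bound _ => hm.
have := big (maxn N m) (leq_maxl _ _).
have : m%:R <= (maxn N m)%:R :> R by rewrite ler_nat leq_maxr.
move: hm; rewrite ltr_pdivrMr// => h1 h2.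
have := ler_wpM2r (ltW q0) h2; lra.
Qed.

Lemma Julia_words : Julia G = @Some (Cplx R) @` word_limit h.
Proof.
apply/seteqP; split=> [[z|] Jz|_ [z zlim <-]]; last exact: Julia_word_limit.
  by exists z => //; apply: contrapT => nz; apply/Jz/Fatou_escape.
by case: Jz; exact: Fatou_infty.
Qed.

End semigroup.

(** * Postcritical set *)

Lemma is_derive_horner (F : numFieldType) (p : {poly F}) (x : F) :
  is_derive x (1 : F) (horner p) p^`().[x].
Proof.
elim/poly_ind: p => [|p c IH].
  rewrite deriv0 horner0 (_ : horner 0 = cst 0); first exact: is_derive_cst.
  by apply/funext => y; rewrite horner0.
rewrite (_ : horner _ = (horner p * id) + cst c); last first.
  by apply/funext => y; rewrite hornerMXaddC.
rewrite derivD derivM derivX derivC addr0 mulr1 hornerD hornerMX.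
apply: is_derive_eq.
by rewrite addr0 -[_ *: 1]/(_ * 1) -[_ *: _]/(_ * _) mulr1 addrC mulrC.
Qed.

Section postcritical.
Variables (R : realType) (I : finType) (h : I -> {poly Cplx R}).
Hypothesis hyp : forall i, hyperbolic_poly (h i).

Let G := semigroup_gen (range (fun i => poly_map (h i))).

Lemma critical_points_finite (p : {poly Cplx R}) (z : Cplx R) :
  critical_points (poly_map p) (Some z) -> p^`().[z] = 0.
Proof.
move=> /= dp; have -> := esym (@derive_val _ _ _ _ _ _ _ (is_derive_horner p z)).
exact: (@derive_val _ _ _ _ _ _ _ dp).
Qed.

(** Finite critical points have values in |z| < 1/2 and infinity is fixed, so the closure adds to
    the closed disc at most the point at infinity. *)
Lemma bounded_postcritical : bounded_set (finite_part (postcritical G)).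
Proof.
have cl : postcritical G `<=` ~` [set x : sphere R | forall a, x = Some a -> 1/2 < modulus a] `|` [set None].
  move=> x; have [->|x0] := pselect (x = None); first by right.
  move=> cx; left => /= xout.
  have [a xa] : exists a, x = Some a by case: x x0 {cx xout} => // a; exists a.
  have oU : open (@Some (Cplx R) @` [set z | 1/2 < modulus z] : set (sphere R)).
    by apply: open_Some; exact: open_modulus_gt.
  have [|y [[g Gg [c gc gcy]] [b bout by_]]] := cx _ (open_nbhs_nbhs (conj oU _)).
    by exists a => //=; exact: xout.
  move: Gg; rewrite /G semigroup_words => -[w _ gw].
  case: c gc gcy => [c|] gc gcy; last by rewrite gw /= -by_ in gcy.
  rewrite gw in gc gcy.
  have := word_crit_value hyp (critical_points_finite gc).
  rewrite -by_ /= in gcy; case: gcy => gcy; rewrite /word_eval gcy.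
  by rewrite ltNge (ltW bout).
exists (1/2)%:C%C; split; first by apply: ger0_real; rewrite lecR; lra.
move=> M /ltW hM z /cl [|//] /= nz; apply: le_trans hM.
rewrite modulusE lecR leNgt; apply/negP => z2; apply: nz => _ [<-].
exact: z2.
Qed.

Lemma calG_words : (exists i : I, True) -> calG G.
Proof.
move=> [i0 _]; split; last exact: bounded_postcritical.
  exists (range (fun i => poly_map (h i))); split => //.
    by exists (poly_map (h i0)); exists i0.
  by move=> _ [i _ <-]; exists (h i) => //; rewrite (hyp_size (hyp i)).
rewrite /G semigroup_words => _ [w w0 ->]; exists (word_poly h w) => //.
exact: word_size_gt2.
Qed.

End postcritical.

(** * Layers of the Julia set *)

Lemma horner_surj (R : realType) (p : {poly Cplx R}) (w : Cplx R) :
  (1 < size p)%N -> exists z, p.[z] = w.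
Proof.
move=> sp; have szw : (size (- w%:P : {poly Cplx R}) < size p)%N.
  by rewrite size_polyN; apply: leq_ltn_trans (size_polyC_leq1 _) sp.
have /closed_rootP[z] : size (p - w%:P) != 1%N by rewrite size_polyDl// gtn_eqF.
by rewrite /root !hornerE subr_eq0 => /eqP; exists z.
Qed.

Section outer_letter.
Variables (R : realType) (I : finType) (h : I -> {poly Cplx R}) (o p1 p2 : I).
Hypothesis hyp : forall i, hyperbolic_poly (h i).
Hypothesis letters : forall i, [\/ i = o, i = p1 | i = p2].
Hypotheses (p1o : p1 != o) (p2o : p2 != o).
Hypothesis inner_out : forall i z, i != o -> 3/2 <= modulus z -> 4 < modulus (h i).[z].
Hypothesis outer_in : forall z, modulus z <= 3/2 -> modulus (h o).[z] < 1/2.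
Hypothesis cross_left : forall t : R, 0 <= t ->
  1/2 <= modulus (h p2).[(- t)%:C%C] -> 4 < modulus (h p1).[(- t)%:C%C].
Hypothesis cross_right : forall t : R, 0 <= t ->
  modulus (h p2).[t%:C%C] <= 4 -> modulus (h p1).[t%:C%C] < 1/2.
Implicit Types (w v u : seq I) (z y : Cplx R) (n m k : nat).

Let X := word_annulus h.
Let we := word_eval h.
Let J := word_limit h.

Lemma word_eval_surj w y : exists z, we w z = y.
Proof. exact/horner_surj/word_size_gt1. Qed.

Lemma word_annulus_nonempty w : X w !=set0.
Proof.
have [z zw] := word_eval_surj w 1; exists z.
by rewrite /X /word_annulus /= -/we zw modulus1; split; lra.
Qed.

(** Along either half-axis the modulus of the image is below 1/2 at 0 and above 4 at distance 5, so
    it takes the value 1. *)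
Let axis_point w (s : R) : `|s| = 1 -> exists2 t : R, 0 <= t & X w (s * t)%:C%C.
Proof.
move=> s1; pose f (t : R) := modulus (we w (s * t)%:C%C).
have cf : {within `[0, 5], continuous f}.
  apply: continuous_subspaceT => t.
  have c1 : (fun t : R => (s * t)%:C%C : Cplx R) @ nbhs t --> ((s * t)%:C%C : Cplx R).
    apply: (@cvg_complex _ _ (nbhs t)); last exact: cvg_cst.
    by apply: cvgM; [exact: cvg_cst|exact: cvg_id].
  have c2 : (fun t : R => we w (s * t)%:C%C) @ nbhs t --> we w (s * t)%:C%C.
    apply: (cvg_comp _ _ c1); exact: continuous_hornerC.
  apply: (cvg_comp _ _ c2); exact: continuous_modulus.
have f0 : f 0 < 1/2.
  by rewrite /f mulr0; apply: word_disc => //; rewrite modulus0; lra.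
have f5 : 4 < f 5.
  rewrite /f; apply: word_escape_gt => //.
  by rewrite modulus_real normrM s1 mul1r ger0_norm; lra.
have [|t] := @IVT _ f 0 5 1 (ler0n _ 5) cf.
  by rewrite ge_min le_max; apply/andP; split; apply/orP; [left|right]; lra.
rewrite in_itv/= => /andP[t0 _] ft; exists t => //.
by rewrite /X /word_annulus/= -/we -/(f t) ft; split; lra.
Qed.

(* The connected set X (p2 :: v) meets both half-axes, and X (p1 :: w) separates
   the points where it does. *)
Lemma word_crossing w v : (X (p1 :: w) `&` X (p2 :: v)) !=set0.
Proof.
apply: contrapT => none.
pose U0 := [set z | modulus (we (p1 :: w) z) < 1/2].
pose U1 := [set z | 4 < modulus (we (p1 :: w) z)].
have oU0 : open U0.
  apply: (@open_comp _ _ (we (p1 :: w)) [set z | modulus z < 1/2]).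
    by move=> z _; exact: continuous_hornerC.
  exact: open_modulus_lt.
have oU1 : open U1.
  apply: (@open_comp _ _ (we (p1 :: w)) [set z | 4 < modulus z]).
    by move=> z _; exact: continuous_hornerC.
  exact: open_modulus_gt.
have U01 : U0 `&` U1 = set0.
  by apply/seteqP; split => // z [] /=; rewrite /U0 /U1 /=; lra.
have YU : X (p2 :: v) `<=` U0 `|` U1.
  move=> z Xz; case: (ltP (modulus (we (p1 :: w) z)) (1/2)) => t1; first by left.
  case: (ltP 4 (modulus (we (p1 :: w) z))) => t2; first by right.
  by exfalso; apply: none; exists z.
have one z : X (p2 :: v) z -> 1/2 <= modulus (h p2).[z] /\ modulus (h p2).[z] <= 4.
  move=> /(@word_annulus_prefix _ _ _ hyp [:: p2] v).
  by rewrite /word_annulus/= word_eval_cons word_eval0.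
have [t t0 Xt] := @axis_point (p2 :: v) 1 (normr1 _).
have [l l0 Xl] := @axis_point (p2 :: v) (-1) (normrN1 _).
rewrite mul1r in Xt; rewrite mulN1r in Xl.
have Ut : U0 t%:C%C.
  rewrite /U0/= /we word_eval_cons; apply: word_disc => //.
  by apply: cross_right => //; exact: (one _ Xt).2.
have Ul : U1 (- l)%:C%C.
  rewrite /U1/= /we word_eval_cons; apply: word_escape_gt => //.
  by apply: cross_left => //; exact: (one _ Xl).1.
have [Y0|Y1] := connected_subset (separated_open oU0 oU1 U01) YU (@connected_word_annulus _ _ _ hyp _).
  have : (U0 `&` U1) (- l)%:C%C by split => //; exact: Y0.
  by rewrite U01.
have : (U0 `&` U1) t%:C%C by split => //; exact: Y1.
by rewrite U01.
Qed.

Let g n : Cplx R -> Cplx R := we (nseq n o).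
(** The itineraries of a layer: [n] outer letters, then a word that will start with an inner
    letter. *)
Let N n v : seq I := nseq n o ++ v.

Let C n m : set (Cplx R) :=
  \bigcup_(t in [set: bool * m.-tuple I]) X (N n ((if t.1 then p1 else p2) :: t.2)).

(* layer n corresponds to h3^-n (h1^-1(J) U h2^-1(J)) and outer_layer to J(h3). *)
Definition layer n : set (Cplx R) := \bigcap_m C n m.
Definition outer_layer : set (Cplx R) := \bigcap_n X (nseq n o).

Let CP n m z : C n m z <-> exists i v, [/\ i != o, size v = m & X (N n (i :: v)) z].
Proof.
split=> [[[b v] _ /= Xz]|[i [v [io vm Xz]]]].
  by exists (if b then p1 else p2), v; rewrite size_tuple; case: b Xz.
have st : size v == m by rewrite vm.
case: (letters i) => E; first by rewrite E eqxx in io.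
  by exists (true, Tuple st) => //=; rewrite -E.
by exists (false, Tuple st) => //=; rewrite -E.
Qed.

Let XN n v z : X (N n v) z <-> X v (g n z).
Proof. exact: word_annulus_cat. Qed.

Let crossing n w v : (X (N n (p1 :: w)) `&` X (N n (p2 :: v))) !=set0.
Proof.
have [y [y1 y2]] := word_crossing w v; have [z zy] := word_eval_surj (nseq n o) y.
by exists z; split; apply/XN; rewrite /g zy.
Qed.

(** Every piece starting (after the outer letters) with [p1] meets every piece starting with [p2].
    In this complete bipartite pattern, [t0] is the hub through which all the pieces are joined. *)
Let connected_C n m : connected (C n m).
Proof.
pose t0 : m.-tuple I := [tuple of nseq m p1].
pose A v := X (N n (p1 :: v)); pose B v := X (N n (p2 :: v)).
pose U := \bigcup_(v in [set: m.-tuple I]) (A t0 `|` B v).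
have cU : connected U.
  apply: bigcup_connected => [|v _].
    by have [z Az] := word_annulus_nonempty (N n (p1 :: t0)); exists z => v _; left.
  apply: connectedU; first exact: crossing.
    exact: connected_word_annulus.
  exact: connected_word_annulus.
have -> : C n m = \bigcup_(v in [set: m.-tuple I]) (U `|` A v).
  apply/seteqP; split=> [z [[[] v] _ /= Xz]|z [v _ [[u _ [Az|Bz]]|Az]]].
  - by exists v => //; right.
  - by exists v => //; left; exists v => //; right.
  - by exists (true, t0).
  - by exists (false, u).
  - by exists (true, v).
apply: bigcup_connected => [|v _].
  have [z Az] := word_annulus_nonempty (N n (p1 :: t0)); exists z => v _; left.
  by exists t0 => //; left.
apply: connectedU => //; last exact: connected_word_annulus.
have [z [Az Bz]] := crossing n v t0; exists z; split => //.
by exists t0 => //; right.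
Qed.

Let closed_C n m : closed (C n m).
Proof.
by apply: closed_bigcup => [|t _]; [exact: finite_finset|exact: closed_word_annulus].
Qed.

Let C_dec n m : C n m.+1 `<=` C n m.
Proof.
move=> z /CP[i [v [io vm Xz]]]; apply/CP; exists i, (take m v); split => //.
  by rewrite size_takel// vm.
apply: (@word_annulus_prefix _ _ _ hyp _ (drop m v)).
by rewrite /N -catA cat_cons cat_take_drop.
Qed.

Let C_bounded n m z : C n m z -> modulus z <= 4.
Proof. by move=> [t _]; exact: word_annulus_bounded. Qed.

Lemma connected_layer n : connected (layer n).
Proof.
apply: (@nested_connected R (C n) 4).
- exact: closed_C.
- exact: C_dec.
- exact: C_bounded.
- exact: connected_C.
Qed.

Let nseq_dec i n : X (nseq n.+1 i) `<=` X (nseq n i).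
Proof. by move=> z; rewrite -addn1 nseqD; exact: word_annulus_prefix. Qed.

Let power_nonempty i : \bigcap_n X (nseq n i) !=set0.
Proof.
apply: (@nested_nonempty R (fun n => X (nseq n i)) 4).
- by move=> n; exact: closed_word_annulus.
- exact: nseq_dec.
- by move=> z; exact: word_annulus_bounded.
- by move=> n; exact: word_annulus_nonempty.
Qed.

Lemma connected_outer_layer : connected outer_layer.
Proof.
apply: (@nested_connected R (fun n => X (nseq n o)) 4).
- by move=> n; exact: closed_word_annulus.
- exact: nseq_dec.
- by move=> z; exact: word_annulus_bounded.
- by move=> n; exact: connected_word_annulus.
Qed.

Lemma power_sub_layer0 i : i != o -> \bigcap_n X (nseq n i) `<=` layer 0.
Proof.
move=> io z zi m _; apply/CP; exists i, (nseq m i); split => //.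
  by rewrite size_nseq.
exact: (zi m.+1).
Qed.

Lemma layer_nonempty n : layer n !=set0.
Proof.
have [y yi] := power_nonempty p1; have [z zy] := word_eval_surj (nseq n o) y.
exists z => m _; apply/CP; exists p1, (nseq m p1); split => //.
  by rewrite size_nseq.
by apply/XN; rewrite /g zy; exact: (yi m.+1).
Qed.

Lemma outer_layer_nonempty : outer_layer !=set0.
Proof. exact: power_nonempty. Qed.

Lemma preimage_outer_sub i z : i != o -> outer_layer (h i).[z] -> layer 0 z.
Proof.
move=> io zo m _; apply/CP; exists i, (nseq m o); split => //.
  by rewrite size_nseq.
by apply/XN; rewrite /g /we word_eval0 /X /word_annulus /= word_eval_cons; exact: (zo m).
Qed.

(** * Itineraries relative to the circle |z| = 3/2 *)

Let inner_lt i v z : i != o -> X (i :: v) z -> modulus z < 3/2.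
Proof.
move=> io /(@word_annulus_prefix _ _ _ hyp [:: i] v) [_].
rewrite word_eval_cons word_eval0 => h4; rewrite ltNge; apply/negP.
by move=> /(inner_out io); lra.
Qed.

Let outer_gt v z : X (o :: v) z -> 3/2 < modulus z.
Proof.
move=> /(@word_annulus_prefix _ _ _ hyp [:: o] v) [h4 _].
rewrite word_eval_cons word_eval0 in h4; rewrite ltNge; apply/negP.
by move=> /outer_in; lra.
Qed.

(** The points whose orbit under the outer map first enters |z| < 3/2 at time [n]. Strict
    inequalities make [S n] and [S_compl n] both open; the limit set avoids the points left out
    between them. *)
Let S n : set (Cplx R) :=
  [set z | (forall k, (k < n)%N -> 3/2 < modulus (g k z)) /\ modulus (g n z) < 3/2].

Let S_compl n : set (Cplx R) :=
  [set z | (exists2 k, (k < n)%N & modulus (g k z) < 3/2) \/ 3/2 < modulus (g n z)].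

Let gS k z : g k.+1 z = g k (h o).[z].
Proof. by rewrite /g /we /= word_eval_cons. Qed.

Let layer_S n : layer n `<=` S n.
Proof.
move=> z /(_ 0%N Logic.I) /CP[i [v [io _ Xz]]]; split=> [k kn|].
  move: Xz; rewrite /N -(subnKC kn) addSnnS nseqD -catA => /word_annulus_cat.
  exact: outer_gt.
by move/XN: Xz; exact: inner_lt.
Qed.

Let outer_S k : outer_layer `<=` [set z | 3/2 < modulus (g k z)].
Proof.
move=> z /(_ k.+1 Logic.I); rewrite -addn1 nseqD => /word_annulus_cat.
exact: outer_gt.
Qed.

(** At a point outside |z| = 3/2 an inner letter would cause escape, so the word is forced to
    continue with the outer letter. *)
Let word_outer_prefix n w z : (forall k, (k < n)%N -> 3/2 < modulus (g k z)) ->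
  X w z -> (n <= size w)%N -> exists v, w = N n v.
Proof.
elim: n w z => [|n IH] w z zS Xz nw; first by exists w.
case: w Xz nw => // j w Xz; rewrite ltnS => nw.
have jo : j = o.
  apply/eqP; apply: contraT => jo; have := inner_lt jo Xz.
  by have := zS 0%N isT; rewrite /g /we word_eval0; lra.
rewrite {}jo in Xz *.
have [||//|v ->] := IH w (h o).[z].
- by move=> k kn; rewrite -gS; exact: zS.
- by move: Xz; rewrite /X /word_annulus/= word_eval_cons.
by exists v.
Qed.

Let J_S_layer n z : J z -> S n z -> layer n z.
Proof.
(* Length n + m + 1: the forced outer prefix, one inner letter, and the m free letters of
   [C n m]. *)
move=> Jz [zn zS] m _; have [w sw Xw] := Jz (n + m.+1)%N.
have [|v wE] := word_outer_prefix zn Xw; first by rewrite sw leq_addr.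
have sv : size v = m.+1.
  by move: sw; rewrite wE size_cat size_nseq => /addnI.
case: v sv wE => // i v [sv] wE; apply/CP; exists i, v; split => //; last by rewrite -wE.
apply/eqP => io; move: Xw; rewrite wE io => /XN /outer_gt; lra.
Qed.

Let J_cases z : J z -> (exists n, S n z) \/ outer_layer z.
Proof.
move=> Jz; have [all|/existsNP nall] := pselect (forall k, 3/2 < modulus (g k z)).
  right=> n _; have [w sw Xw] := Jz n.
  have [|v wE] := @word_outer_prefix n w z (fun k _ => all k) Xw; first by rewrite sw.
  have : size v = 0%N by move: sw; rewrite wE size_cat size_nseq -[RHS]addn0 => /addnI.
  by move=> /size0nil v0; move: Xw; rewrite wE v0 /N cats0.
left; have ex : exists k, `[< ~ 3/2 < modulus (g k z) >].
  by have [k nk] := nall; exists k; apply/asboolP.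
(* [k] is the first time at which the orbit is not outside the circle. A word of length k + 1 shows
   it strictly inside, since its letter at position k cannot be [o]. *)
have [k /asboolP nk kmin] := ex_minnP ex; exists k.
have zk l : (l < k)%N -> 3/2 < modulus (g l z).
  move=> lk; apply: contrapT => /asboolP /kmin; by rewrite leqNgt lk.
split => //; have [w sw Xw] := Jz k.+1.
have [|v wE] := word_outer_prefix zk Xw; first by rewrite sw.
have sv : size v = 1%N by move: sw; rewrite wE size_cat size_nseq -addn1 => /addnI.
case: v sv wE => // i [|//] _ wE; move: Xw; rewrite wE => /XN Xi.
have [io|io] := eqVneq i o; last exact: inner_lt Xi.
by exfalso; apply: nk; rewrite io in Xi; exact: outer_gt Xi.
Qed.

Lemma layer_sub n : layer n `<=` J.
Proof.
move=> z zl q; have /CP[i [v [_ vq Xz]]] := zl q Logic.I.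
exists (take q (N n (i :: v))).
  by rewrite size_takel// /N size_cat /= vq addnS -addSn leq_addl.
by apply: (@word_annulus_prefix _ _ _ hyp _ (drop q (N n (i :: v)))); rewrite cat_take_drop.
Qed.

Lemma outer_layer_sub : outer_layer `<=` J.
Proof.
by move=> z zo n; exists (nseq n o); [rewrite size_nseq|exact: zo].
Qed.

Lemma limit_decomp z : J z -> (exists n, layer n z) \/ outer_layer z.
Proof.
move=> Jz; have [[n Sz]|zo] := J_cases Jz; last by right.
by left; exists n; exact: J_S_layer.
Qed.

Let S_disj n m z : S n z -> S m z -> n = m.
Proof.
move=> [n1 n2] [m1 m2]; case: (ltngtP n m) => [nm|nm|//].
  by exfalso; have := m1 _ nm; lra.
by exfalso; have := n1 _ nm; lra.
Qed.

Lemma layer_disj n m z : layer n z -> layer m z -> n = m.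
Proof. by move=> /layer_S h1 /layer_S h2; exact: S_disj h1 h2. Qed.

Lemma layer_outer_disj n z : layer n z -> outer_layer z -> False.
Proof. by move=> /layer_S[_ h1] /(@outer_S n z); rewrite /=; lra. Qed.

Let continuous_g k : continuous (g k). Proof. exact: continuous_hornerC. Qed.

Let open_glt k (a : R) : open [set z | modulus (g k z) < a].
Proof.
apply: (@open_comp _ _ (g k) [set z | modulus z < a]); last exact: open_modulus_lt.
by move=> z _; exact: continuous_g.
Qed.

Let open_ggt k (a : R) : open [set z | a < modulus (g k z)].
Proof.
apply: (@open_comp _ _ (g k) [set z | a < modulus z]); last exact: open_modulus_gt.
by move=> z _; exact: continuous_g.
Qed.

Let open_S n : open (S n).
Proof.
rewrite openE => z [zn zS]; rewrite /interior.
have H1 : \forall y \near nbhs z, forall k : 'I_n, 3/2 < modulus (g k y).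
  apply: filter_forall => k; apply: open_nbhs_nbhs; split; first exact: open_ggt.
  exact: zn.
have H2 : \forall y \near nbhs z, modulus (g n y) < 3/2.
  by apply: open_nbhs_nbhs; split => //; exact: open_glt.
apply: filterS2 H1 H2 => y h1 h2; split => // k kn.
exact: (h1 (Ordinal kn)).
Qed.

Let open_S_compl n : open (S_compl n).
Proof.
rewrite (_ : S_compl n = \bigcup_(k in [set k | (k < n)%N]) [set z | modulus (g k z) < 3/2]
   `|` [set z | 3/2 < modulus (g n z)]).
  by apply: openU => //; apply: bigcup_open => k _.
apply/seteqP; split=> z [[k kn zk]|zn]; by [left; exists k|right].
Qed.

Let S_S_compl n : S n `&` S_compl n = set0.
Proof.
apply/seteqP; split => // z [[h1 h2]] [[k kn]|]; last lra.
by have := h1 _ kn; lra.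
Qed.

Let J_S_cover n : J `<=` S n `|` S_compl n.
Proof.
move=> z Jz; have [[m Sm]|zo] := J_cases Jz; last first.
  by right; right; exact: (@outer_S n z zo).
case: (ltngtP m n) => mn; last by left; rewrite -mn.
  by right; left; exists m => //; exact: Sm.2.
by right; right; exact: Sm.1.
Qed.

Let some (A : set (Cplx R)) : set (sphere R) := @Some (Cplx R) @` A.

Let component_S n (T : set (sphere R)) z : connected T -> T `<=` some J ->
  T (Some z) -> S n z -> T `<=` some (S n).
Proof.
move=> cT TJ Tz Sz.
have dis : some (S n) `&` some (S_compl n) = set0.
  apply/seteqP; split => // _ [[y Sy <-] [x Cx [xy]]].
  have : (S n `&` S_compl n) y by split => //; rewrite -xy.
  by rewrite S_S_compl.
have cov : T `<=` some (S n) `|` some (S_compl n).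
  by move=> x /TJ[y /(J_S_cover n)[Sy|Cy] <-]; [left|right]; exists y.
have sep := separated_open (open_Some (@open_S n)) (open_Some (@open_S_compl n)) dis.
have [//|TC] := connected_subset sep cov cT.
have : (some (S n) `&` some (S_compl n)) (Some z).
  by split; [exists z|exact: TC].
by rewrite dis.
Qed.

Lemma component_layer n z : layer n z ->
  connected_component (some J) (Some z) = some (layer n).
Proof.
move=> zl; apply/seteqP; split; last first.
  apply: connected_component_max; first by exists z.
    by apply: image_subset; exact: layer_sub.
  exact/connected_Some/connected_layer.
move=> x xc.
have cJ := @connected_component_sub _ (some J) (Some z).
have zT : connected_component (some J) (Some z) (Some z).
  by apply: connected_component_refl; exists z => //; exact: layer_sub zl.
have [y Sy yx] := component_S (@component_connected _ _ _) cJ zT (layer_S zl) xc.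
have [y' Jy yx'] := cJ _ xc.
exists y => //; apply: J_S_layer => //; move: yx'; rewrite -yx => -[<-]; exact: Jy.
Qed.

(** No single open set cuts the outer layer off from all the layers, which accumulate on it. Each is
    excluded separately: a component meeting [S n] is contained in [S n], which the outer layer
    avoids. *)
Lemma component_outer z : outer_layer z ->
  connected_component (some J) (Some z) = some outer_layer.
Proof.
move=> zl; apply/seteqP; split; last first.
  apply: connected_component_max; first by exists z.
    by apply: image_subset; exact: outer_layer_sub.
  exact/connected_Some/connected_outer_layer.
move=> x xc; have cJ := @connected_component_sub _ (some J) (Some z).
have zT : connected_component (some J) (Some z) (Some z).
  by apply: connected_component_refl; exists z => //; exact: outer_layer_sub zl.
have [y Jy yx] := cJ _ xc; exists y => //.
have [[n Sn]|//] := J_cases Jy.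
have yc : connected_component (some J) (Some z) (Some y) by rewrite yx.
have [z' Sz' [zz']] := component_S (@component_connected _ _ _) cJ yc Sn zT.
have := @outer_S n z zl; rewrite /= -zz'; have := Sz'.2; lra.
Qed.

(** [W] lists prefixes of one infinite word. Off [K] some prefix sends the point into the disc
    ([U0]) or beyond 4 ([U1]); these disjoint open sets separate, and [U0] is bounded because points
    with |z| > 4 escape. This replaces the Jordan curve theorem. *)
Let bounded_complement (W : nat -> seq I) (K : set (Cplx R)) z :
  (forall k, exists u, W k.+1 = W k ++ u) -> \bigcap_k X (W k) `<=` K ->
  (exists k, modulus (we (W k) z) < 1/2) ->
  bounded_set (connected_component (~` K) z).
Proof.
move=> Wpre WK zW.
have pre k l : (k <= l)%N -> exists u, W l = W k ++ u.
  move/subnK => <-; elim: (l - k)%N => [|m [u IH]]; first by exists [::]; rewrite cats0.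
  by have [u' E] := Wpre (m + k)%N; exists (u ++ u'); rewrite addSn E IH catA.
pose U0 := \bigcup_k [set y | modulus (we (W k) y) < 1/2].
pose U1 := \bigcup_k [set y | 4 < modulus (we (W k) y)].
have oU0 : open U0.
  apply: bigcup_open => k _.
  apply: (@open_comp _ _ (we (W k)) [set z | modulus z < 1/2]).
    by move=> y _; exact: continuous_hornerC.
  exact: open_modulus_lt.
have oU1 : open U1.
  apply: bigcup_open => k _.
  apply: (@open_comp _ _ (we (W k)) [set z | 4 < modulus z]).
    by move=> y _; exact: continuous_hornerC.
  exact: open_modulus_gt.
have U01 : U0 `&` U1 = set0.
  apply/seteqP; split => // y [[k _ /= yk] [l _ /= yl]].
  have [kl|/ltnW lk] := leqP k l.
    have [u E] := pre _ _ kl; move: yl; rewrite E /we word_eval_cat.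
    by have := word_disc hyp u yk; lra.
  have [u E] := pre _ _ lk; move: yk; rewrite E /we word_eval_cat.
  by have := word_escape_gt hyp u yl; lra.
have cov : connected_component (~` K) z `<=` U0 `|` U1.
  move=> y /connected_component_sub nKy.
  have /existsNP[k /not_implyP[_ nk]] : ~ (\bigcap_k X (W k)) y by move=> /WK.
  case: (ltP (modulus (we (W k) y)) (1/2)) => t1; first by left; exists k.
  case: (ltP 4 (modulus (we (W k) y))) => t2; first by right; exists k.
  by exfalso; apply: nk; split.
have sub0 : connected_component (~` K) z `<=` U0.
  have [//|sub1] := connected_subset (separated_open oU0 oU1 U01) cov (@component_connected _ _ _).
  move=> y yc; exfalso.
  have zc : connected_component (~` K) z z.
    have [Kz|nKz] := pselect ((~` K) z); first exact: connected_component_refl.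
    by move: yc; rewrite connected_component_out.
  have : (U0 `&` U1) z.
    by split; [have [k zk] := zW; exists k|exact: sub1].
  by rewrite U01.
exists 4; split; first exact: ger0_real.
move=> M /ltW hM y /sub0 [k _ /= yk]; apply: le_trans hM.
rewrite modulusE -(rmorph_nat (@real_complex R : {rmorphism R -> R[i]})) lecR leNgt.
by apply/negP => /(word_escape_gt hyp (W k)); rewrite -/we; lra.
Qed.

Lemma surround (W : nat -> seq I) (K L : set (Cplx R)) z :
  (forall k, exists u, W k.+1 = W k ++ u) -> \bigcap_k X (W k) `<=` K ->
  (exists k, modulus (we (W k) z) < 1/2) ->
  connected L -> L z -> L `&` K = set0 -> surrounding_le L K.
Proof.
move=> Wpre WK zW cL Lz LK; right; exists z.
  by move=> Kz; have : (L `&` K) z by []; rewrite LK.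
split; first exact: bounded_complement zW.
by apply: connected_component_max => // y Ly Ky; have : (L `&` K) y by []; rewrite LK.
Qed.

Let layer_drop n z : layer n z -> modulus (g n.+1 z) < 1/2.
Proof.
move=> /layer_S[_ zS]; rewrite /g -addn1 nseqD /we word_eval_cat /= word_eval_cons word_eval0.
exact/outer_in/ltW.
Qed.

Let drop_disc n m z : (n <= m)%N -> modulus (g n z) < 1/2 -> modulus (g m z) < 1/2.
Proof.
by move=> /subnKC <- zn; rewrite /g nseqD /we word_eval_cat; exact: word_disc.
Qed.

Lemma layer_le n m : (n <= m)%N -> surrounding_le (layer n) (layer m).
Proof.
rewrite leq_eqVlt => /orP[/eqP ->|nm]; first by left.
have [z zl] := layer_nonempty n.
(* The infinite word with m outer letters followed by [p1] forever has its non-escaping set inside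
   layer m, and its prefix of m outer letters already sends layer n into the disc. *)
apply: (@surround (fun k => N m (nseq k p1)) _ _ z) => //.
- by move=> k; exists [:: p1]; rewrite /N -catA -(nseqD k 1) addn1.
- move=> y yW q _; apply/CP; exists p1, (nseq q p1); split => //.
    by rewrite size_nseq.
  exact: (yW q.+1).
- by exists 0%N; rewrite /N cats0; apply: drop_disc nm _; exact: layer_drop.
- exact: connected_layer.
- by apply/seteqP; split => // y [h1 h2]; move: nm; rewrite (layer_disj h1 h2) ltnn.
Qed.

Lemma layer_le_outer n : surrounding_le (layer n) outer_layer.
Proof.
have [z zl] := layer_nonempty n.
apply: (@surround (fun k => nseq k o) _ _ z) => //.
- by move=> k; exists [:: o]; rewrite -(nseqD k 1) addn1.
- by exists n.+1; exact: layer_drop.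
- exact: connected_layer.
- by apply/seteqP; split => // y [h1 h2]; case: (layer_outer_disj h1 h2).
Qed.

End outer_letter.

(** * The theorem *)

Section julia_map.
Variable R : realType.

(** A single map is a semigroup over the one-letter alphabet [unit], so the description of Julia
    sets by words also covers J(h_j). *)
Lemma word_limit_constant (I : finType) (h : I -> {poly Cplx R}) (i : I) :
  word_limit (fun _ : unit => h i) = \bigcap_n word_annulus h (nseq n i).
Proof.
have E w z : word_eval (fun _ : unit => h i) w z = word_eval h (nseq (size w) i) z.
  by elim: w z => [|[] w IH] z; rewrite ?word_eval0// !word_eval_cons IH.
apply/seteqP; split=> z zl n => [_|].
  by have [w <- ] := zl n; rewrite /word_annulus/= E.
exists (nseq n tt); first by rewrite size_nseq.
by have := zl n Logic.I; rewrite /word_annulus/= E size_nseq.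
Qed.

Lemma Julia_map_words (I : finType) (h : I -> {poly Cplx R}) (i : I) :
  hyperbolic_poly (h i) ->
  Julia_map (poly_map (h i)) =
  @Some (Cplx R) @` \bigcap_n word_annulus h (nseq n i).
Proof.
move=> hi; rewrite -word_limit_constant -Julia_words//; congr (Julia (semigroup_gen _)).
by apply/seteqP; split=> [_ ->|_ [[] _ <-]//]; exists tt.
Qed.

End julia_map.

Section perturbed_semigroup.
Variable R : realType.
Variables q1 q2 q3 : {poly Cplx R}.
Hypothesis near1 : near16 1 (1/4)%:C%C q1.
Hypothesis near2 : near16 1 (- (1/4)%:C%C) q2.
Hypothesis near3 : near16 (3 ^- 15) 0 q3.

Let I : finType := option bool.
Let h (i : I) : {poly Cplx R} :=
  match i with Some true => q1 | Some false => q2 | None => q3 end.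
Let o : I := None.
Let p1 : I := Some true.
Let p2 : I := Some false.

Let e4 : modulus ((1/4)%:C%C : Cplx R) <= 1/4.
Proof. by rewrite modulus_real ger0_norm; lra. Qed.

Let hyp i : hyperbolic_poly (h i).
Proof.
have one : 1 <= 1 * 3 ^+ 15 :> R by rewrite mul1r exprn_ege1// ler1n.
case: i => [[]|] /=.
- exact: near16_hyperbolic near1.
- by apply: near16_hyperbolic near2 => //; rewrite modulusN.
- have c3 : 0 < 3 ^+ 15 :> R by rewrite exprn_gt0.
  apply: near16_hyperbolic near3; rewrite ?invr_gt0 ?modulus0//; last lra.
  by rewrite invf_le1// exprn_ege1// ler1n.
Qed.

Let letters i : [\/ i = o, i = p1 | i = p2].
Proof. by case: i => [[]|]; [constructor 2|constructor 3|constructor 1]. Qed.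

Let inner_out i (z : Cplx R) : i != o -> 3/2 <= modulus z -> 4 < modulus (h i).[z].
Proof.
case: i => [[]|] // _; first exact: center_outside near1.
by apply: center_outside near2; rewrite modulusN.
Qed.

Let outer_in (z : Cplx R) : modulus z <= 3/2 -> modulus (h o).[z] < 1/2.
Proof. exact: outer_inside near3. Qed.

Let cross_left (t : R) : 0 <= t ->
  1/2 <= modulus (h p2).[(- t)%:C%C] -> 4 < modulus (h p1).[(- t)%:C%C].
Proof. move=> t0; exact: (crossing_left t0 near1 near2). Qed.

Let cross_right (t : R) : 0 <= t ->
  modulus (h p2).[t%:C%C] <= 4 -> modulus (h p1).[t%:C%C] < 1/2.
Proof. move=> t0; exact: (crossing_right t0 near1 near2). Qed.

Let G := semigroup_gen [set poly_map q1; poly_map q2; poly_map q3].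

Let GE : G = semigroup_gen (range (fun i => poly_map (h i))).
Proof.
congr semigroup_gen; apply/seteqP; split=> [_ [[->|->]|->]|_ [i _ <-]].
- by exists p1.
- by exists p2.
- by exists o.
by case: i => [[]|]; [left; left|left; right|right].
Qed.

Let JE : Julia G = @Some (Cplx R) @` word_limit h.
Proof. by rewrite GE Julia_words. Qed.

Let L n : set (sphere R) := @Some (Cplx R) @` layer h o p1 p2 n.
Let M : set (sphere R) := @Some (Cplx R) @` outer_layer h o.

Let finite_some (A : set (Cplx R)) : finite_part (@Some (Cplx R) @` A) = A.
Proof. by apply/seteqP; split=> [z [y Ay [<-]]|z Az] //; exists z. Qed.

(** The enumeration puts J(h3) at index 0 and layer k at index k + 1; with injectivity it gives the
    cardinality. *)
Let componentsE : Julia_components G = range (fun n => if n is k.+1 then L k else M).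
Proof.
have cl n z : layer h o p1 p2 n z -> connected_component (Julia G) (Some z) = L n.
  by move=> zl; rewrite JE; exact: (component_layer hyp letters isT isT inner_out outer_in cross_left cross_right zl).
have co z : outer_layer h o z -> connected_component (Julia G) (Some z) = M.
  by move=> zl; rewrite JE; exact: (component_outer hyp inner_out outer_in zl).
apply/seteqP; split=> [_ [x Jx <-]|_ [[|n] _ <-]].
- have [z Jz <-] : (@Some (Cplx R) @` word_limit h) x by rewrite -JE.
  have [[n zl]|zo] := limit_decomp hyp letters isT isT inner_out outer_in Jz.
    by exists n.+1 => //; rewrite (cl _ _ zl).
  by exists 0%N => //; rewrite (co _ zo).
- have [z zo] := outer_layer_nonempty o hyp.
  exists (Some z); last exact: co.
  by rewrite JE; exists z => //; exact: (outer_layer_sub zo).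
- have [z zl] := layer_nonempty hyp letters isT isT n.
  exists (Some z); last exact: cl.
  by rewrite JE; exists z => //; exact: (layer_sub hyp letters isT isT zl).
Qed.

Let components_inj : injective (fun n => if n is k.+1 then L k else M).
Proof.
have LM n : L n <> M.
  move=> E; have [z zl] := layer_nonempty hyp letters isT isT n.
  have [y yo [yz]] : M (Some z) by rewrite -E; exists z.
  by apply: (layer_outer_disj hyp letters isT isT inner_out outer_in zl); rewrite -yz.
move=> [|n] [|m] // => [/esym/LM//|/LM//|E]; congr S.
have [z zl] := layer_nonempty hyp letters isT isT n.
have [y ym [yz]] : L m (Some z) by rewrite -E; exists z.
by apply: (layer_disj hyp letters isT isT inner_out outer_in zl); rewrite -yz.
Qed.

Let Lcomp n : Julia_components G (L n). Proof. by rewrite componentsE; exists n.+1. Qed.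
Let Mcomp : Julia_components G M. Proof. by rewrite componentsE; exists 0%N. Qed.

Lemma perturbed_semigroup :
  calG_dis G /\
  exists Jmin Jmax : set (sphere R),
    [/\ is_J_min G Jmin, is_J_max G Jmax &
    [/\ Julia_map (poly_map q1) `|` Julia_map (poly_map q2) `<=` Jmin,
      Jmax = Julia_map (poly_map q3),
      (poly_map q1 @^-1` Julia_map (poly_map q3) `&` Jmin) !=set0,
      (poly_map q2 @^-1` Julia_map (poly_map q3) `&` Jmin) !=set0 &
      (Julia_components G #= [set: nat])%card]].
Proof.
have J1 := Julia_map_words (hyp p1); have J2 := Julia_map_words (hyp p2).
have J3 : Julia_map (poly_map q3) = M := Julia_map_words (hyp o).
split.
  split; first by rewrite GE; apply: calG_words => //; exists o.
  move=> cJ; have [z zl] := layer_nonempty hyp letters isT isT 0.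
  have Jz : Julia G (Some z).
    by rewrite JE; exists z => //; exact: (layer_sub hyp letters isT isT zl).
  (* A connected Julia set would be its own unique component, so the layers 0 and 1 would
     coincide. *)
  have EJ n : L n = Julia G.
    have [x Jx <-] := Lcomp n; exact: connected_component_id.
  by have := @components_inj 1%N 2%N (etrans (EJ 0%N) (esym (EJ 1%N))).
exists (L 0), M; split; [split => //|split => //|].
- move=> K; rewrite componentsE => -[[|n] _ <-]; rewrite !finite_some.
    exact: (layer_le_outer hyp letters isT isT inner_out outer_in cross_left cross_right).
  exact: (layer_le hyp letters isT isT inner_out outer_in cross_left cross_right).
- move=> K; rewrite componentsE => -[[|n] _ <-]; rewrite !finite_some; first by left.
  exact: (layer_le_outer hyp letters isT isT inner_out outer_in cross_left cross_right).
have pre i : i != o -> (poly_map (h i) @^-1` Julia_map (poly_map q3) `&` L 0) !=set0.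
  move=> io; have [y yo] := outer_layer_nonempty o hyp.
  have [|z zy] := @horner_surj R (h i) y; first by rewrite (hyp_size (hyp i)).
  exists (Some z); split; first by rewrite J3 /= zy; exists y.
  by exists z => //; apply: (preimage_outer_sub letters isT isT io); rewrite zy.
split => //.
- rewrite [Julia_map (poly_map q1)]J1 [Julia_map (poly_map q2)]J2.
  by move=> _ [[z zi <-]|[z zi <-]]; exists z => //;
    [exact: (power_sub_layer0 letters isT isT (i := p1) isT zi)|exact: (power_sub_layer0 letters isT isT (i := p2) isT zi)].
- exact: (pre p1).
- exact: (pre p2).
by rewrite componentsE; apply: inj_card_eq => n m _ _; exact: components_inj.
Qed.

End perturbed_semigroup.

Section neighbourhood.
Variable R : realType.

Lemma chordal_neighbourhood (c : R) (e : Cplx R) : 0 < c -> 1 <= c * 3 ^+ 15 ->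
  exists (f0 : Poly_deg_ge2 R) (V : set (Poly_deg_ge2 R)), nbhs f0 V /\
    forall f, V f -> exists2 q, near16 c e q & set_val f = poly_map q.
Proof.
move=> c0 c3; have [d d0 near] := chordal_near16 e c0 c3.
have base : poly_maps R 2 (poly_map (base_poly c e)).
  exists (base_poly c e) => //.
  by rewrite size_scale ?size_exp_XsubC// -modulus_eq0 modulus_real gt_eqF// gtr0_norm.
pose f0 : Poly_deg_ge2 R := SigSub (mem_set base).
exists f0, (set_val @^-1` [set g | forall x, chordal (poly_map (base_poly c e) x) (g x) < d]).
split.
  apply: (@initial_continuous (Poly_deg_ge2 R) {uniform sphere R -> sphere R} set_val f0).
  exact: uniform_sphere_nbhs.
move=> f /= Vf; have [q q2 fq] := set_valP f.
exists q => //; apply: near => // y; rewrite -fq; exact/ltW/Vf.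
Qed.

End neighbourhood.

Theorem proposition2p28 (R : realType) :
  exists V : set (Poly_deg_ge2 R * Poly_deg_ge2 R * Poly_deg_ge2 R),
    [/\ V !=set0, open V &
      forall f1 f2 f3 : Poly_deg_ge2 R, V (f1, f2, f3) ->
      let h1 : sphere R -> sphere R := set_val f1 in
      let h2 : sphere R -> sphere R := set_val f2 in
      let h3 : sphere R -> sphere R := set_val f3 in
      let G := semigroup_gen [set h1; h2; h3] in
      calG_dis G /\
      exists Jmin Jmax : set (sphere R),
        [/\ is_J_min G Jmin, is_J_max G Jmax &
        [/\ Julia_map h1 `|` Julia_map h2 `<=` Jmin,
          Jmax = Julia_map h3,
          (h1 @^-1` Julia_map h3 `&` Jmin) !=set0,
          (h2 @^-1` Julia_map h3 `&` Jmin) !=set0 &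
          (Julia_components G #= [set: nat])%card]]].
Proof.
have one : 1 <= 1 * 3 ^+ 15 :> R by rewrite mul1r exprn_ege1// ler1n.
have c3 : 0 < 3 ^+ 15 :> R by rewrite exprn_gt0.
have c30 : 0 < 3 ^- 15 :> R by rewrite invr_gt0.
have c31 : 1 <= 3 ^- 15 * 3 ^+ 15 :> R by rewrite mulVf// gt_eqF.
have [f1 [V1 [n1 P1]]] := chordal_neighbourhood (1/4)%:C%C ltr01 one.
have [f2 [V2 [n2 P2]]] := chordal_neighbourhood (- (1/4)%:C%C) ltr01 one.
have [f3 [V3 [n3 P3]]] := chordal_neighbourhood (0 : Cplx R) c30 c31.
(* The [Vi] are only neighbourhoods of the model maps, so the interior of their product is taken. *)
exists ((V1 `*` V2 `*` V3)°); split.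
- exists (f1, f2, f3); rewrite /interior; exists (V1 `*` V2, V3) => //.
  by split => //; exists (V1, V2).
- exact: open_interior.
move=> g1 g2 g3 /interior_subset [[/= /P1[q1 near1 ->] /P2[q2 near2 ->]] /P3[q3 near3 ->]].
exact: perturbed_semigroup near1 near2 near3.
Qed.
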